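(* Let $p$ be an odd prime, $S$ a finite $p$-group and $\mathcal{F}$ a saturated fusion system on $S$. Let $E\le S$ be an $\mathcal{F}$-essential subgroup of $S$ that is not $\mathcal{F}$-characteristic in $S$ and such that $N_S(E)$ has sectional rank $3$. Set $T=\mathrm{core}_{\mathcal{F}}(E)$ and $V=[E,O^{p'}(\mathrm{Aut}_{\mathcal{F}}(E))]T$. Then: (1) $V/T$ is a natural $\mathrm{SL}_2(p)$-module for $O^{p'}(\mathrm{Out}_{\mathcal{F}}(E))\cong\mathrm{SL}_2(p)$; (2) $N_S(E)/T$ has exponent $p$; (3) $E/T$ is elementary abelian and $p^2\le[E:T]\le p^3$; (4) $[E/T: Z(N_S(E)/T)]=p$; (5) $T$ is abelian, $T\le Z(V)$, $|[V,V]|\le p$ and $T/[V,V]$ is cyclic. Moreover, if $[E:T]=p^2$ then $T\le Z(N_S(E))$.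
   Context: Rank: minimal size of a generating set; a $p$-group has sectional rank $k$ if all its subgroups have rank at most $k$ and $k$ is minimal. For $P\le S$, $\mathrm{Aut}_{\mathcal{F}}(P)=\mathrm{Hom}_{\mathcal{F}}(P,P)$, $\mathrm{Out}_{\mathcal{F}}(P)=\mathrm{Aut}_{\mathcal{F}}(P)/\mathrm{Inn}(P)$, $P^{\mathcal{F}}=\{P\alpha:\alpha\in\mathrm{Hom}_{\mathcal{F}}(P,S)\}$. $E\le S$ is $\mathcal{F}$-essential if $C_S(P)\le P$ and $|N_S(E)|\ge|N_S(P)|$ for all $P\in E^{\mathcal{F}}$, and $\mathrm{Out}_{\mathcal{F}}(E)$ has a strongly $p$-embedded subgroup. $E$ is $\mathcal{F}$-characteristic in $S$ if normalized by $\mathrm{Aut}_{\mathcal{F}}(S)$. The $\mathcal{F}$-core $\mathrm{core}_{\mathcal{F}}(E)$ is the largest subgroup of $E$ normalized by both $\mathrm{Aut}_{\mathcal{F}}(E)$ and $\mathrm{Aut}_{\mathcal{F}}(N_S(E))$. $O^{p'}(G)$ is the subgroup generated by the $p$-elements of $G$; $[E,A]$ for a group $A$ of automorphisms of $E$ is the subgroup generated by all $x^{-1}(x\alpha)$, $x\in E$, $\alpha\in A$. A natural $\mathrm{SL}_2(p)$-module is the $2$-dimensional natural $\mathbb{F}_p$-module. *)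

(* Defs.v *)
From HB Require Import structures.
From mathcomp Require Import all_boot all_order all_algebra all_fingroup all_solvable.
Set Implicit Arguments. Unset Strict Implicit. Unset Printing Implicit Defensive.

Local Open Scope group_scope.

Section Fusion.
Variable gT : finGroupType.

(* A fusion system on S is encoded by a boolean predicate F : F P f holds iff
   the restriction of f to P is a morphism of F from P into S (so that
   Hom_F(P,Q) = {f | F P f, f(P) <= Q}).  Values of f outside P are
   irrelevant (axiom 2). *)
Definition fusion_system (S : {set gT})
    (F : {set gT} -> {ffun gT -> gT} -> bool) : Prop :=
  [/\ (forall (P : {set gT}) f, F P f ->
         [/\ group_set P, P \subset S, {in P &, {morph f : x y / x * y}},
             {in P &, injective f} & f @: P \subset S]),
      (forall (P : {set gT}) (f g : {ffun gT -> gT}), {in P, f =1 g} -> F P f = F P g),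
      (forall (P : {group gT}) x, P \subset S -> x \in S ->
         F P [ffun y => y ^ x]),
      (forall (P Q : {set gT}) (f g : {ffun gT -> gT}), F P f -> F Q g -> f @: P \subset Q ->
         F P [ffun y => g (f y)]) &
      (forall (P : {set gT}) f, F P f ->
         exists g, F (f @: P) g /\ {in P, forall y, g (f y) = y})].

Variable F : {set gT} -> {ffun gT -> gT} -> bool.

Definition Fclass (P : {set gT}) : {set {set gT}} :=
  [set Q : {set gT} | [exists f, F P f && (f @: P == Q)]].

Definition AutF (P : {set gT}) : {set {perm gT}} :=
  <<[set a in Aut P | F P [ffun x => a x]]>>.

Definition AutS (S P : {set gT}) : {set {perm gT}} :=
  <<[set a in Aut P | [exists x in 'N_S(P), [forall y in P, a y == y ^ x]]]>>.

Definition Inn (P : {set gT}) := AutS P P.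

Definition OutF (P : {set gT}) := AutF P / Inn P.

Definition fully_normalized (S P : {set gT}) :=
  forall Q, Q \in Fclass P -> #|'N_S(Q)| <= #|'N_S(P)|.

Definition fully_centralized (S P : {set gT}) :=
  forall Q, Q \in Fclass P -> #|'C_S(Q)| <= #|'C_S(P)|.

(* N_phi = {x in N_S(P) | phi c_x phi^-1 in Aut_S(phi(P))} *)
Definition Nphi (S P : {set gT}) (f : {ffun gT -> gT}) : {set gT} :=
  [set x in 'N_S(P) | [exists y in 'N_S(f @: P),
                       [forall z in P, f (z ^ x) == f z ^ y]]].

Definition saturated (p : nat) (S : {set gT}) : Prop :=
  (forall P : {group gT}, P \subset S -> fully_normalized S P ->
     fully_centralized S P /\ p.-Sylow(AutF P) (AutS S P)) /\
  (forall (P : {set gT}) f, F P f -> fully_centralized S (f @: P) ->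
     exists g, F (Nphi S P f) g /\ {in P, forall y, g y = f y}).

End Fusion.

Definition strongly_p_embedded (rT : finGroupType) (p : nat)
    (G H : {set rT}) : Prop :=
  [/\ H \proper G, p %| #|H| &
      forall g, g \in G :\: H -> p^'.-group (H :&: H :^ g)].

Definition essential (gT : finGroupType) p (S : {set gT})
    (F : {set gT} -> {ffun gT -> gT} -> bool) (E : {set gT}) : Prop :=
  [/\ E \subset S,
      (forall Q, Q \in Fclass F E ->
         'C_S(Q) \subset Q /\ #|'N_S(Q)| <= #|'N_S(E)|) &
      exists H : {group coset_of (Inn E)},
        strongly_p_embedded p (OutF F E) H].

Definition F_characteristic (gT : finGroupType) (S : {set gT})
    (F : {set gT} -> {ffun gT -> gT} -> bool) (E : {set gT}) : Prop :=
  forall a, a \in AutF F S -> [set a x | x in E] = E.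

Definition aut_inv (gT : finGroupType) (A : {set {perm gT}}) (T : {set gT}) :=
  [forall a in A, [set a x | x in T] \subset T].

(* core_F(E): largest subgroup of E normalized by Aut_F(E) and Aut_F(N_S(E)),
   realized as the subgroup generated by all such subgroups. *)
Definition coreF (gT : finGroupType) (S : {set gT})
    (F : {set gT} -> {ffun gT -> gT} -> bool) (E : {set gT}) : {set gT} :=
  <<\bigcup_(T : {group gT} | [&& T \subset E, aut_inv (AutF F E) T
                                 & aut_inv (AutF F 'N_S(E)) T]) T>>.

Definition Opp' (rT : finGroupType) (p : nat) (G : {set rT}) : {set rT} :=
  <<[set x in G | p.-elt x]>>.

Definition commAut (gT : finGroupType) (E : {set gT}) (A : {set {perm gT}}) :=
  <<[set x^-1 * (a : {perm gT}) x | x in E, a in A]>>.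

Definition Vsub (gT : finGroupType) p (S : {set gT})
    (F : {set gT} -> {ffun gT -> gT} -> bool) (E : {set gT}) : {set gT} :=
  commAut E (Opp' p (AutF F E)) <*> coreF S F E.

Definition gen_by_le (gT : finGroupType) (G : {set gT}) (n : nat) : Prop :=
  exists s : seq gT, size s <= n /\ <<[set x in s]>> = G.

Definition sectional_rank (gT : finGroupType) (G : {set gT}) (k : nat) :=
  (forall H : {group gT}, H \subset G -> gen_by_le H k) /\
  ~ (forall H : {group gT}, H \subset G -> gen_by_le H k.-1).

(* V/T is a natural SL_2(p)-module for O^{p'}(Out_F(E)) =~ SL_2(p):
   psi identifies V/T with F_p^2 (as groups), rho is an isomorphism of
   O^{p'}(Out_F(E)) onto SL_2(p), and the action of Aut_F(E) on V/T is
   given by rho (right action on row vectors). *)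
Definition natural_SL2_module (gT : finGroupType) (p : nat) (S : {set gT})
    (F : {set gT} -> {ffun gT -> gT} -> bool) (E : {set gT}) : Prop :=
  let T := coreF S F E in
  let V := Vsub p S F E in
  let O := Opp' p (OutF F E) in
  exists (psi : gT -> 'rV['F_p]_2) (rho : coset_of (Inn E) -> 'M['F_p]_2),
  [/\ [/\ {in V &, forall x y, psi (x * y) = (psi x + psi y)%R},
          {in V, forall x, (psi x == 0%R) = (x \in T)} &
          [set psi x | x in V] = [set: 'rV['F_p]_2]],
      {in O &, forall a b, rho (a * b) = (rho a *m rho b)%R},
      {in O &, injective rho},
      [set rho a | a in O] = [set M : 'M['F_p]_2 | (\det M == 1)%R] &
      forall a : {perm gT}, a \in AutF F E -> coset (Inn E) a \in O ->
        forall x, x \in V -> psi (a x) = (psi x *m rho (coset (Inn E) a))%R].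

(* Main.v *)
Require Import Defs.
From HB Require Import structures.
From mathcomp Require Import all_boot all_order all_algebra all_fingroup all_solvable.
From mathcomp Require Import ring.
Set Implicit Arguments. Unset Strict Implicit. Unset Printing Implicit Defensive.
Import GRing.Theory.
Local Open Scope group_scope.

(* Right translation embeds [gT] into the symmetric group on its elements, where
   every automorphism of a subgroup is induced by conjugation.  Thus Aut_F(E) and
   Aut_F(N), with N = N_S(E), are induced by groups of permutations GA and GB that
   normalize E and N respectively, and T is the largest subgroup of E that both
   normalize.

   Since E/Phi(E) has order at most p^3, counting an orbit of N on it shows that
   a strongly embedded subgroup forces |N : E| = p.  Let L be the normal closure
   of N in GA.  As E has index p in N and is not GB-invariant, the p'-elements of L
   centralize every subgroup of E that is normalized by GA and GB.  Comparing
   Omega_1(Z(E)) with its GB-conjugates then shows that E/T is elementary abelian,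
   and E and a GB-conjugate of E generate N, so N acts on E/T as a group of
   transvections.  Two conjugates of N act on V/T as opposite root groups, hence
   generate SL_2(p) there, and this already accounts for L.  Finally, a p'-element
   of L inverting V/T centralizes T, which yields the structure of V and of T. *)

(** Aut_F(E) and Aut_F(N) consist of maps on different groups, so no single action carries both;
    once both are conjugations in one symmetric group, commutators, quotients and coprime action
    apply to them together. What is known of their interaction is that [GB] does not normalize [E]:
    otherwise [N] would be self-normalizing in [S], so [N = S], and [E] would be F-characteristic.
    Because [|N : E| = p], this takes the form that a [GB]-invariant subgroup of [N] containing [E]
    must be [N].

    Beyond the bound on [|N : E|], strong embedding acts mainly through O_p(Out_F(E)) = 1. As [E]
    may be non-abelian, faithfulness is tested on p'-elements: if those of a subgroup of [GA] act
    trivially on the factors of a series of [E], they centralize [E], so the image in Out_F(E) is a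
    p-group; it is trivial when normal, and otherwise lies in a Sylow subgroup.

    The rank hypothesis is used as [|X : Phi(X)| <= p^3] for all [X <= N]. Oddness of [p] makes [p]
    divide the binomial coefficient of [p] over 2, keeps powers of -1 with exponent [p^k] equal to
    -1, and provides square roots. *)

Lemma prime_index_sandwich (gT : finGroupType) (E K N : {group gT}) :
  E \subset K -> K \subset N -> prime #|N : E| -> K :=: E \/ K :=: N.
Proof.
move=> sEK sKN; rewrite -(Lagrange_index sKN sEK) => pr.
have [NK1|NK1] := eqVneq #|N : K| 1%N.
  by right; apply/eqP; rewrite eqEsubset sKN -indexg_eq1 NK1.
have [KE1|KE1] := eqVneq #|K : E| 1%N.
  by left; apply/eqP; rewrite eqEsubset sEK -indexg_eq1 KE1.
have/primeP[_ /(_ _ (dvdn_mulr _ (dvdnn _)))] := pr.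
rewrite (negPf NK1) /= => /eqP e.
have NK0 : 0 < #|N : K| by [].
by move: (KE1); rewrite -(eqn_pmul2l NK0) muln1 -e eqxx.
Qed.

Lemma conjsg_eq_of_sub (gT : finGroupType) (X : {group gT}) x :
  X :^ x \subset X -> X :^ x = X.
Proof. by move=> s; apply/eqP; rewrite eqEcard s cardJg leqnn. Qed.

Lemma norms_conj (gT : finGroupType) (A : {group gT}) (X : {set gT}) :
  (forall x, x \in A -> X :^ x = X) -> A \subset 'N(X).
Proof. by move=> h; apply/subsetP=> x Ax; rewrite inE h. Qed.

Lemma abelem_joing (gT : finGroupType) (p : nat) (A B : {group gT}) :
  p.-abelem A -> p.-abelem B -> B \subset 'C(A) -> p.-abelem (A <*> B).
Proof.
move=> aA aB cAB.
by rewrite (cprod_abelem p (cprodEY cAB)) aA aB.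
Qed.

(** [X / Z] has order 1 or [p] and is normal in the p-group [N / Z]; it therefore meets the center
    and is central. *)
Lemma comm_prime_order (gT : finGroupType) (p : nat) (X N Z : {group gT}) :
  prime p -> p.-group N -> N \subset 'N(X) -> N \subset 'N(Z) -> Z \subset X ->
  X \subset N -> #|X : Z| <= p -> [~: X, N] \subset Z.
Proof.
move=> pr pN nX nZ sZX sXN leX.
have nZX : X \subset 'N(Z) := subset_trans sXN nZ.
have nXb : X / Z <| N / Z by apply: quotient_normal; rewrite /normal sXN.
have := card_quotient nZX => cX.
have [X1|X1] := eqVneq (X / Z) 1.
  apply: (@subset_trans _ _ X); first by rewrite commg_subl.
  by rewrite -quotient_sub1 // X1.
have ple : #|X / Z| = p.
  have pX : p.-group (X / Z) by apply: quotient_pgroup; apply: pgroupS pN.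
  have [_ /dvdn_leq h _] := pgroup_pdiv pX X1.
  by apply/eqP; rewrite eqn_leq h // cX leX.
have meet: (X / Z) :&: 'Z(N / Z) != 1.
  by apply: meet_center_nil => //; apply: pgroup_nil (quotient_pgroup _ pN).
have sub: X / Z \subset 'Z(N / Z).
  apply: contraR meet => h; apply/eqP.
  by apply: prime_TIg h; rewrite ple.
rewrite -quotient_cents2 //.
by apply: subset_trans sub (subsetIr _ _).
Qed.

(** * Pushing up *)

Section PushingUp.

Variables (gT : finGroupType) (p : nat) (N E GA GB : {group gT}).
Hypotheses (prp : prime p) (pN : p.-group N) (nsEN : E <| N) (iEN : #|N : E| = p).
Hypotheses (sNA : N \subset GA) (nEA : GA \subset 'N(E)) (nNB : GB \subset 'N(N)).
Hypothesis rkN : forall X : {group gT}, X \subset N -> #|X : 'Phi(X)| <= p ^ 3.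
Hypothesis cNE : 'C_N(E) \subset E.
Hypothesis coreEN : forall X : {group gT},
  X \subset E -> GA \subset 'N(X) -> GB \subset 'N(X) -> X :=: 1.

Let sEN : E \subset N := normal_sub nsEN.
Let pE : p.-group E := pgroupS sEN pN.
Let U := ('Ohm_1('Z(E)))%G.
Let Z := ('Ohm_1('Z(N)))%G.

Let abU : p.-abelem U.
Proof. by apply: Ohm1_abelem; [apply: pgroupS (center_sub _) pE | apply: center_abelian]. Qed.

Let sUZ : U \subset 'Z(E) := Ohm_sub _ _.
Let sUE : U \subset E := subset_trans sUZ (center_sub _).

Let in_Z (X : {group gT}) : X \subset N -> N \subset 'C(X) -> p.-abelem X -> X \subset Z.
Proof.
move=> sXN cXN abX; rewrite -(Ohm1_id abX); apply: OhmS.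
by rewrite subsetI sXN centsC.
Qed.

Let sZNE : 'Z(N) \subset E.
Proof. by apply: subset_trans cNE; apply: setIS; apply: centS. Qed.

Let sZU : Z \subset U.
Proof. by apply: OhmS; rewrite subsetI sZNE; apply: subset_trans (subsetIr _ _) (centS _). Qed.

Let N_neq1 : N :!=: 1.
Proof.
apply/eqP=> N1; have := dvdn_indexg N E.
by rewrite iEN N1 cards1 dvdn1 => /eqP p1; move: prp; rewrite p1.
Qed.

Let normB (X : {group gT}) : X \char N -> GB \subset 'N(X).
Proof. by move=> ch; apply: char_norm_trans ch nNB. Qed.

Let normA (X : {group gT}) : X \char E -> GA \subset 'N(X).
Proof. by move=> ch; apply: char_norm_trans ch nEA. Qed.

Let chUE : U \char E.
Proof. exact: char_trans (Ohm_char _ _) (center_char _). Qed.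

Let chZN : Z \char N.
Proof. exact: char_trans (Ohm_char _ _) (center_char _). Qed.

(* If [U <= E^g], then [X = U U^g] is elementary abelian of order [p^3] and
   [GA]-invariant, so that [Z = [X, E]] is invariant under [GA] and [GB]. *)
Lemma Ohm1_center_nsub_conj g : g \in GB -> E :^ g != E -> ~~ (U \subset E :^ g).
Proof.
move=> Bg nEg; apply/negP=> sUE1.
have Ng : N :^ g = N by apply/normP; apply: subsetP nNB _ Bg.
pose E1 := (E :^ g)%G; pose U1 := (U :^ g)%G.
have sE1N : E1 \subset N by rewrite -Ng conjSg.
have sU1E1 : U1 \subset E1 by rewrite conjSg.
have cE1U1 : E1 \subset 'C(U1).
  by rewrite /= centJ conjSg centsC; apply: subset_trans sUZ (subsetIr _ _).
have cEU : E \subset 'C(U) by rewrite centsC; apply: subset_trans sUZ (subsetIr _ _).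
have EorN (K : {group gT}) : E \subset K -> K \subset N -> K :=: E \/ K :=: N.
  by move=> a b; apply: prime_index_sandwich; rewrite ?iEN.
have joinN (K : {group gT}) : K \subset N -> ~~ (K \subset E) -> E <*> K = N.
  move=> sKN nKE; case: (EorN (E <*> K)%G) => //; rewrite ?joing_subl ?join_subG ?sEN //.
  by move=> /= e; case/negP: nKE; rewrite -e joing_subr.
have Zg : Z :^ g = Z by apply/normP; apply: (subsetP (normB chZN)).
have abU1 : p.-abelem U1 by rewrite abelemJ.
have sU1N : U1 \subset N by apply: subset_trans sE1N.
have sUN : U \subset N by apply: subset_trans sEN.
have sZ1 : Z \subset U1 by rewrite -Zg conjSg.
(* Otherwise [N = E U1] centralizes [U], so that [U <= Z] and [U1 = U^g <= Z^g = Z <= E]. *)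
have sU1E : U1 \subset E.
  apply/negPn/negP=> nU1E.
  have sUZ' : U \subset Z.
    apply: in_Z => //; rewrite -(joinN _ sU1N nU1E) join_subG cEU /=.
    by rewrite centsC; apply: subset_trans cE1U1.
  case/negP: nU1E; apply: subset_trans (subset_trans sZU sUE).
  by rewrite -Zg conjSg.
have cUU1 : U1 \subset 'C(U) by apply: subset_trans sU1E cEU.
have EE1 : E <*> E1 = N.
  apply: joinN => //; apply: contra nEg => s; apply/eqP.
  exact: conjsg_eq_of_sub.
have ZE : U :&: U1 = Z.
  apply/eqP; rewrite eqEsubset subsetI sZU sZ1 !andbT.
  apply: in_Z; rewrite ?subIset ?sUN //.
    rewrite -EE1 join_subG.
    rewrite (subset_trans cEU) ?centS ?subsetIl //=.
    by rewrite (subset_trans cE1U1) ?centS ?subsetIr //=.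
  by apply: abelemS abU; apply: subsetIl.
have Z1 : Z :!=: 1.
  rewrite Ohm1_eq1; apply: contra N_neq1 => /eqP zN1.
  by apply/eqP; apply: (trivg_center_pgroup pN).
have pZ : p.-group Z by apply: pgroupS pN; apply: subset_trans sUN.
have ltpZ : p <= #|Z| by have [_ /dvdn_leq -> //] := pgroup_pdiv pZ Z1.
have nUZ : U :!=: Z.
  apply/eqP=> e; case/negP: Z1; rewrite -e.
  apply/eqP/(coreEN sUE (normA chUE)).
  by rewrite e; apply: normB chZN.
have ltZU : p * #|Z| <= #|U|.
  rewrite -(Lagrange sZU) mulnC leq_pmul2l //.
  have pU : p.-group U := abelem_pgroup abU.
  have iU1 : #|U : Z| != 1%N by rewrite indexg_eq1; apply: contra nUZ => s; rewrite eqEsubset s sZU.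
  have [k e] := p_natP (pnat_dvd (dvdn_indexg U Z) pU : p.-nat #|U : Z|).
  by rewrite e; case: k e iU1 => [-> //|k] e _; rewrite -{1}(expn1 p) leq_exp2l // prime_gt1.
have abX : p.-abelem (U <*> U1) by apply: abelem_joing.
have small (X : {group gT}) : X \subset N -> p.-abelem X -> #|X| <= p ^ 3.
  move=> sXN aX; have := rkN sXN.
  by have pX := abelem_pgroup aX; move: aX; rewrite -(trivg_Phi pX) => /eqP->; rewrite indexg1.
have sXN : U <*> U1 \subset N by rewrite join_subG sUN.
have cardX : (#|U <*> U1| * #|Z| = #|U| * #|U|)%N.
  by rewrite (cent_joinEr cUU1) -ZE -mul_cardG /= cardJg.
have p0 : 0 < p by apply: prime_gt0.
(* The chain [|U|^2 = |U U1| |Z| <= p^3 |Z| <= p^2 |U|], together with [|Z| >= p], forces both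
   orders. *)
have [cU cZ] : #|U| = (p ^ 2)%N /\ #|Z| = p.
  have leX := small _ sXN abX.
  have h1 : #|U| * #|U| <= p ^ 2 * #|U|.
    rewrite -cardX (leq_trans (leq_mul leX (leqnn _))) //.
    by rewrite (expnS p 2) (mulnC p) -mulnA leq_pmul2l ?expn_gt0 ?p0.
  have h2 : #|U| <= p ^ 2 by move: h1; rewrite leq_pmul2r.
  have h3 : #|Z| = p.
    apply/eqP; rewrite eqn_leq ltpZ andbT -(leq_pmul2l p0).
    by apply: leq_trans ltZU _; rewrite mulnn.
  split=> //; apply/eqP; rewrite eqn_leq h2; move: ltZU.
  by rewrite h3 mulnn.
have cX3 : #|U <*> U1| = (p ^ 3)%N.
  by apply/eqP; rewrite -(eqn_pmul2r (cardG_gt0 Z)) cardX cU cZ -expnD -expnSr.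
have chU : U <| N by apply: char_normal_trans chUE nsEN.
have nU1N : U1 <| N by rewrite /normal sU1N -Ng normJ conjSg normal_norm.
have nZN : N \subset 'N(Z) by apply: char_norm.
have cmZ : [~: U1, E] \subset Z.
  apply: subset_trans (commgS _ sEN) _.
  apply: (comm_prime_order prp pN) => //; first exact: normal_norm.
  have := Lagrange sZ1; rewrite cZ /= cardJg cU expnS expn1 => /eqP.
  by rewrite eqn_pmul2l // => /eqP ->.
have nZA : ~~ (GA \subset 'N(Z)).
  apply: contra Z1 => h; apply/eqP/coreEN => //; last exact: normB.
  exact: subset_trans sUE.
(* If [a] moves [Z], of order [p], then [[U1^a, U1] <= Z :&: Z^a = 1]; so [U U1 U1^a] is elementary
   abelian, of order at most [p^3], and equals [U U1]. *)
have nXmove a : a \in GA -> Z :^ a != Z -> (U <*> U1) :^ a = U <*> U1.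
  move=> Aa nZa.
  have Ea : E :^ a = E by apply/normP; apply: (subsetP nEA).
  have Ua : U :^ a = U by apply/normP; apply: (subsetP (normA chUE)).
  have sU1aE : U1 :^ a \subset E by rewrite -Ea conjSg.
  have ZZa : Z :&: Z :^ a = 1.
    apply: prime_TIg; first by rewrite cZ.
    apply: contra nZa => s; rewrite eq_sym; apply/eqP/eqP.
    by rewrite eqEcard s cardJg leqnn.
  have cU1 : U1 :^ a \subset 'C(U1).
    have s1 : [~: U1 :^ a, U1] \subset Z.
      by rewrite commGC; apply: subset_trans (commgS _ sU1aE) cmZ.
    have s2 : [~: U1 :^ a, U1] \subset Z :^ a.
      apply: subset_trans (commgS _ sU1E) _.
      by rewrite -{1}Ea -conjsRg conjSg.
    apply/commG1P/trivgP.
    have s12 : [~: U1 :^ a, U1] \subset Z :&: Z :^ a by rewrite subsetI s1.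
    by rewrite ZZa in s12.
  have abX3 : p.-abelem ((U <*> U1) <*> (U1 :^ a)%G).
    apply: abelem_joing => //; first by rewrite abelemJ.
    rewrite /= centY subsetI cU1 andbT; exact: subset_trans cEU.
  have sX3 : (U <*> U1) <*> (U1 :^ a)%G \subset N.
    by rewrite join_subG sXN /= (subset_trans sU1aE).
  have e : (U <*> U1) <*> (U1 :^ a)%G = U <*> U1.
    apply/eqP; rewrite eq_sym eqEcard joing_subl cX3.
    exact: small sX3 abX3.
  have s : U1 :^ a \subset (U <*> U1) <*> (U1 :^ a)%G := joing_subr _ _.
  rewrite e in s; apply: (@conjsg_eq_of_sub _ (U <*> U1)%G).
  by rewrite conjYg Ua join_subG joing_subl.
have nXA : GA \subset 'N(U <*> U1).
  apply: norms_conj => a Aa.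
  (* When [a] fixes [Z], choose [b] moving [Z]: then [a * b] moves [Z] too, and the claim for [a]
     follows from those for [b] and [a * b]. *)
  have [Za|] := eqVneq (Z :^ a) Z; last exact: nXmove.
  have [b Ab nZb] : exists2 b, b \in GA & Z :^ b != Z.
    by case/subsetPn: nZA => b Ab; rewrite inE => h; exists b => //;
       apply: contra h => /eqP->.
  have := nXmove (a * b) (groupM Aa Ab); rewrite conjsgM Za => /(_ nZb).
  by rewrite conjsgM -{2}(nXmove b Ab nZb) => /conjsg_inj.
have cX : [~: U <*> U1, E] = Z.
  have sR : [~: U <*> U1, E] \subset Z.
    have UE1 : [~: U, E] = 1 by apply/commG1P; rewrite centsC.
    by rewrite (cent_joinEr cUU1) commMG UE1 ?mul1g ?norms1.
  apply/eqP; rewrite eqEsubset sR /=.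
  have prZ : prime #|Z| by rewrite cZ.
  have [|ti] := prime_subgroupVti [~: U <*> U1, E]%G prZ; first exact.
  have R1 : [~: U <*> U1, E] = 1 by rewrite -(setIidPl sR) ti.
  have sU1Z : U1 \subset Z.
    apply: in_Z => //; rewrite -EE1 join_subG cE1U1 andbT centsC.
    apply: subset_trans (joing_subr U U1) _.
    by apply/commG1P.
  have := subset_leq_card sU1Z; rewrite cardJg cU cZ.
  by rewrite -{2}(expn1 p) leq_exp2l // prime_gt1.
case/negP: nZA; rewrite -cX.
by apply: normsR.
Qed.

(* By the previous lemma [E^g U = N], hence [E = U (E :&: E^g)] and
   ['Phi(E) = 'Phi(E :&: E^g) = 'Phi(E^g)] for every [g] in [GB]. *)
Lemma pushing_up : p.-abelem E.
Proof.
have nPA : GA \subset 'N('Phi(E)) := normA (Phi_char E).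
rewrite -(trivg_Phi pE); apply/eqP/(coreEN (Phi_sub E) nPA).
have PhiD g : g \in GB -> E :^ g != E -> 'Phi(E) = 'Phi(E :&: E :^ g).
  move=> Bg nEg.
  have nUE := Ohm1_center_nsub_conj Bg nEg.
  have Ng : N :^ g = N by apply/normP; apply: subsetP nNB _ Bg.
  have mE : (E :^ g <*> U)%G :=: E :^ g \/ (E :^ g <*> U)%G :=: N.
    apply: prime_index_sandwich; rewrite ?joing_subl //.
      by rewrite join_subG -{1}Ng conjSg sEN /= (subset_trans sUE).
    by rewrite -{1}Ng indexJg iEN.
  have {mE} EU : (E :^ g) * U = N.
    case: mE => e; first by case/negP: nUE; rewrite -e joing_subr.
    rewrite -[RHS]e /= norm_joinEr //; apply: subset_trans (subset_trans sUE sEN) _.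
    by rewrite -Ng normJ conjSg normal_norm.
  have cUD : E :&: E :^ g \subset 'C(U).
    by rewrite subIset // centsC (subset_trans sUZ) // subsetIr.
  have -> : 'Phi(E) = 'Phi((E :&: E :^ g) * U).
    by rewrite group_modr // EU (setIidPl sEN).
  rewrite (@Phi_mulg p _ (E :&: E :^ g)%G) ?(abelem_pgroup abU) //; last by rewrite centsC.
    have /eqP-> : 'Phi(U) == 1 by rewrite (trivg_Phi (abelem_pgroup abU)).
    by rewrite mulg1.
  by apply: pgroupS pE; apply: subsetIl.
apply: norms_conj => g Bg /=.
have [Eg|nEg] := eqVneq (E :^ g) E; first by rewrite -PhiJ Eg.
have nEg' : E :^ g^-1 != E.
  by apply: contra nEg => /eqP {1}<-; rewrite conjsgKV.
rewrite {1}(PhiD _ (groupVr Bg) nEg') -PhiJ conjIg conjsgKV setIC.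
by rewrite -(PhiD g Bg nEg).
Qed.

End PushingUp.

(** * Coprime action *)

(** [A] acts trivially on [G / [G, A]], and under coprime action the fixed points of a quotient lift
    to fixed points. *)
Lemma coprime_comm_cent_prod (gT : finGroupType) (A G : {group gT}) :
  A \subset 'N(G) -> coprime #|G| #|A| -> solvable G ->
  [~: G, A] * 'C_G(A) = G.
Proof.
move=> nGA coGA solG; set R := [~: G, A].
have nRG : G \subset 'N(R) by apply: commg_norml.
have nRA : A \subset 'N(R) by apply: commg_normr.
have sRG : R \subset G by rewrite commg_subl.
have cGA : A / R \subset 'C(G / R) by rewrite centsC quotient_cents2r.
have eC : 'C_G(A) / R = G / R.
  by rewrite coprime_quotient_cent //; apply/setIidPl; rewrite centsC.
have nRC : 'C_G(A) \subset 'N(R) := subset_trans (subsetIl _ _) nRG.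
have := congr1 (fun X => coset R @*^-1 X) eC.
by rewrite /= !quotientK // (mulSGid sRG).
Qed.

Lemma coprime_commGid (gT : finGroupType) (A G : {group gT}) :
  A \subset 'N(G) -> coprime #|G| #|A| -> solvable G ->
  [~: G, A, A] = [~: G, A].
Proof.
move=> nGA coGA solG; have eG := coprime_comm_cent_prod nGA coGA solG.
have cR : [~: 'C_G(A), A] = 1 by apply/commG1P; apply: subsetIr.
suff eR : [~: [~: G, A] * 'C_G(A), A] = [~: [~: G, A], A] by rewrite -eR eG.
rewrite commMG ?cR ?mulg1 //.
apply: normsR; first exact: subset_trans (subsetIl _ _) (commg_norml _ _).
exact: subset_trans (subsetIr _ _) (cent_sub _).
Qed.

(** Coprime action gives [[X, r] = [X, r, r]]. Iterating this descends a series on whose factors [r]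
    acts trivially. *)
Lemma coprime_comm_step (gT : finGroupType) (p : nat) (X Y Z : {group gT}) r :
  p.-group X -> r \in 'N(X) -> p^'.-elt r ->
  [~: X, <[r]>] \subset Y -> [~: Y, <[r]>] \subset Z -> [~: X, <[r]>] \subset Z.
Proof.
move=> pX nXr p'r sXY sYZ; rewrite -coprime_commGid ?cycle_subG //.
- exact: subset_trans (commSg _ sXY) sYZ.
- exact: pnat_coprime pX p'r.
- exact: pgroup_sol pX.
Qed.

Lemma p'elt_sub_of_pquotient (gT : finGroupType) (p : nat) (C J : {group gT}) r :
  J \subset 'N(C) -> p.-group (J / C) -> r \in J -> p^'.-elt r -> r \in C.
Proof.
move=> nCJ pJC Jr p'r.
have nCr : r \in 'N(C) := subsetP nCJ r Jr.
have p'Cr : p^'.-elt (coset C r) by apply: morph_p_elt.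
have pCr : p.-elt (coset C r) by apply: mem_p_elt pJC _; apply: mem_quotient.
by apply: coset_idr nCr _; apply/eqP; rewrite -order_eq1; apply/eqP/(pnat_1 pCr p'Cr).
Qed.

Lemma pgroup_p'elt1 (gT : finGroupType) (p : nat) (G : {group gT}) :
  (forall x, x \in G -> p^'.-elt x -> x = 1) -> p.-group G.
Proof.
move=> h; apply/pgroupP=> q qpr qG.
have [x Gx ox] := Cauchy qpr qG.
rewrite inE; apply: contraT => nqp.
have x1 : x = 1 by apply: h => //; rewrite /p_elt ox pnatE //.
by move: qpr; rewrite -ox x1 order1.
Qed.

(** A p'-element of the image is also the image of the p'-constituent of any of its preimages. *)
Lemma morphim_pgroup_p'elt (aT rT : finGroupType) (p : nat) (G J : {group aT})
    (f : {morphism G >-> rT}) :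
  J \subset G -> (forall x, x \in J -> p^'.-elt x -> f x = 1) -> p.-group (f @* J).
Proof.
move=> sJG h; apply: pgroup_p'elt1 => y /morphimP[x Gx Jx ->] p'fx.
rewrite -(constt_p_elt p'fx) -morph_constt //.
by apply: h; rewrite ?p_elt_constt ?groupX.
Qed.

Lemma pquotient_joing (gT : finGroupType) (p : nat) (A B C : {group gT}) :
  A \subset C -> A <*> B \subset 'N(C) -> p.-group B ->
  p.-group ((A <*> B) / C).
Proof.
move=> sAC nCJ pB.
have -> : (A <*> B) / C = B / C.
  rewrite quotientY ?(subset_trans (joing_subl A B)) ?(subset_trans (joing_subr A B)) //.
  have -> : A / C = 1 by apply/trivgP; rewrite quotient_sub1 // (subset_trans (joing_subl A B)).
  by rewrite joing1G.
exact: quotient_pgroup.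
Qed.

(** The fixed points [H0] of [R] have index at most [p] in [H], so any [b] outside [H0] generates
    [H] together with [H0], and ['C_R(H) = 'C_R[b]]. The orbit of [b] lies in a coset of [[H, R]], a
    proper subgroup and thus of order at most [p]. *)
Lemma index_cent_small (gT : finGroupType) (p : nat) (R H : {group gT}) :
  prime p -> p.-group R -> R \subset 'N(H) -> p.-abelem H -> #|H| <= p ^ 2 ->
  #|R : 'C_R(H)| <= p.
Proof.
move=> pr pR nHR abH leH; have p0 := prime_gt0 pr.
have pH := abelem_pgroup abH.
have pRH : p.-group (H <*> R) by rewrite norm_joinEr // pgroupM pH.
have nH : H <| H <*> R by rewrite /normal joing_subl join_subG normG.
have [cH|ncH] := boolP (H \subset 'C(R)).
  by rewrite (setIidPl _) ?indexgg 1?centsC.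
have ntH : H :!=: 1 by apply: contra ncH => /eqP->; apply: sub1G.
pose H0 := 'C_H(R)%G.
have ntH0 : H0 :!=: 1.
  have := meet_center_nil (pgroup_nil pRH) nH ntH; apply: contra => /eqP H01.
  rewrite -subG1 -H01 subsetI subsetIl /=.
  rewrite (subset_trans (subsetIr _ _)) // (subset_trans (subsetIr _ _)) // centS //.
  exact: joing_subr.
have leH0 : p <= #|H0|.
  by have [_ /dvdn_leq -> //] := pgroup_pdiv (pgroupS (subsetIl _ _) pH : p.-group H0) ntH0.
have [b Hb nb] := subsetPn ncH.
have iH0 : #|H : H0| <= p.
  rewrite -(leq_pmul2l (cardG_gt0 H0)) Lagrange ?subsetIl //.
  by apply: leq_trans leH _; rewrite -mulnn leq_mul2r leH0 orbT.
have cb : 'C_R[b] \subset 'C(H).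
  have priH : prime #|H : H0|.
    have [k e] := p_natP (pnat_dvd (dvdn_indexg H H0) pH : p.-nat #|H : H0|).
    case: k e => [|[|k]] e; rewrite ?e ?expn1 //.
      case/negP: ncH; move/eqP: e; rewrite expn0 indexg_eq1 => s.
      by apply: subset_trans s (subsetIr _ _).
    by move: iH0; rewrite e -{2}(expn1 p) leq_exp2l ?prime_gt1.
  have sJ : H0 <*> <[b]> \subset H by rewrite join_subG subsetIl cycle_subG.
  have [e|e] := prime_index_sandwich (joing_subl H0 <[b]>) sJ priH.
    case/negP: nb; have : b \in H0 by rewrite -e -cycle_subG joing_subr.
    by case/setIP.
  rewrite -[H : {set gT}]e centY subsetI; apply/andP; split.
    by rewrite centsC (subset_trans (subsetIr _ _)) // centS // subsetIl.
  by rewrite cent_cycle subsetIr.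
have -> : 'C_R(H) = 'C_R[b].
  apply/eqP; rewrite eqEsubset setIS ?subsetI ?subsetIl ?cb //.
  by rewrite -cent_cycle centS // cycle_subG.
rewrite index_cent1.
have pr1 : [~: H, R] \proper H.
  apply: nil_comm_properl (pgroup_nil pRH) _ ntH _; rewrite ?joing_subl //.
  by rewrite subsetI joing_subr.
have leC : #|[~: H, R]| <= p.
  have pC : p.-group [~: H, R] := pgroupS (proper_sub pr1) pH.
  have [k e] := p_natP pC; have [m eH] := p_natP pH.
  have := proper_card pr1; move: leH; rewrite eH e !leq_exp2l ?ltn_exp2l ?prime_gt1 //.
  by case: m {eH} => [|[|[|]]] //; case: k {e} => [|[|]] // _ _ _; rewrite ?expn0 ?expn1 // prime_gt0.
apply: leq_trans leC; rewrite -(card_lcoset [~: H, R] b).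
apply: subset_leq_card; apply/subsetP=> _ /imsetP[y Ry ->].
by rewrite mem_lcoset -commgEl mem_commg.
Qed.

(** The preimage is the centralizer of [W / D] in ['N(D)]; kernels of actions on sections are
    written in this form below. *)
Lemma norm_quotient_cent_pre (gT : finGroupType) (J D W : {group gT}) :
  J \subset 'N(D) -> J \subset 'N(W) -> J \subset 'N(coset D @*^-1 'C(W / D)).
Proof.
move=> nJD nJW; apply: subset_trans (morphpre_norms _ _); last first.
  by apply: norms_cent; apply: quotient_norms nJW.
by rewrite -sub_quotient_pre.
Qed.

(** Burnside's theorem: [P = [P, r] 'C_P(r)], and the first factor consists of non-generators. *)
Lemma coprime_Phi_cent (gT : finGroupType) (p : nat) (P : {group gT}) r :
  p.-group P -> r \in 'N(P) -> p^'.-elt r -> [~: P, <[r]>] \subset 'Phi(P) ->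
  r \in 'C(P).
Proof.
move=> pP nPr p'r sR; rewrite -cycle_subG centsC.
have nP : <[r]> \subset 'N(P) by rewrite cycle_subG.
have eP := coprime_comm_cent_prod nP (pnat_coprime pP p'r) (pgroup_sol pP).
apply/setIidPl; rewrite -[RHS](@Phi_nongen _ P 'C_P(<[r]>)) ?genGid //.
have sP : P \subset 'Phi(P) <*> 'C_P(<[r]>).
  by rewrite -{1}eP mul_subG ?joing_subr // (subset_trans sR) ?joing_subl.
by apply/eqP; rewrite eqEsubset sP join_subG Phi_sub subsetIl.
Qed.

Lemma mem_quotient_cent_pre (gT : finGroupType) (W D : {group gT}) r : W \subset 'N(D) ->
  (r \in coset D @*^-1 'C(W / D)) = (r \in 'N(D)) && ([~: W, <[r]>] \subset D).
Proof.
move=> nDW; have [nDr|nDr] := boolP (r \in 'N(D)).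
  by rewrite -cycle_subG -sub_quotient_pre ?cycle_subG // centsC quotient_cents2 ?cycle_subG.
by apply: contraNF nDr => /morphpreP[].
Qed.

Lemma quotient_norms_inv (gT : finGroupType) (A X D : {group gT}) :
  A \subset 'N(D) -> D <| X -> A / D \subset 'N(X / D) -> A \subset 'N(X).
Proof.
move=> nDA nsDX nXA; rewrite -(quotientGK nsDX).
apply: subset_trans (morphpre_norms _ nXA).
by rewrite -sub_quotient_pre.
Qed.

(** [x] behaves as a transvection with axis [H]: since [b] is not in [H], which has prime index, [H]
    and [b] generate [W], and [x] centralizes both modulo [[b, x]]. *)
Lemma comm_hyperplane (gT : finGroupType) (W H : {group gT}) x b :
  abelian W -> H \subset W -> prime #|W : H| -> x \in 'C(H) -> b \in W ->
  b ^ x != b -> [~ b, x] \in W -> x \in 'C[[~ b, x]] ->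
  [~: W, <[x]>] \subset <[[~ b, x]]>.
Proof.
move=> cWW sHW priH cHx Wb nbx Ww cwx; pose D := <[[~ b, x]]>%G; change ([~: W, <[x]>] \subset D).
have WD : W \subset 'N(D) by apply: sub_abelian_norm; rewrite ?cycle_subG.
have nDx : x \in 'N(D) by apply: subsetP (cent_sub _) _ _; rewrite cent_cycle.
rewrite -quotient_cents2 ?cycle_subG // quotient_cycle // cent_cycle.
pose C := (coset D @*^-1 'C[coset D x])%G.
have sCW : H <*> <[b]> \subset C.
  rewrite join_subG cycle_subG; apply/andP; split.
    rewrite -sub_quotient_pre ?(subset_trans sHW) //= -cent_cycle -quotient_cycle //.
    by apply: quotient_cents; rewrite centsC cycle_subG.
  rewrite -sub1set -sub_quotient_pre ?sub1set ?(subsetP WD) //.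
  rewrite quotient_set1 ?sub1set ?(subsetP WD) //; apply/cent1P/commgP.
  rewrite -morphR ?(subsetP WD b) //; apply/eqP/coset_id.
  exact: cycle_id.
have sJ : H <*> <[b]> \subset W by rewrite join_subG sHW cycle_subG.
have [e|e] := prime_index_sandwich (joing_subl H <[b]>) sJ priH.
  case/negP: nbx; apply/eqP/conjg_fixP/commgP.
  have: b \in H by rewrite -e -cycle_subG joing_subr.
  by move/(centP cHx)/esym.
by rewrite sub_quotient_pre // -[W : {set gT}]e.
Qed.

(** If [G] is not abelian, then [G = A <b>] with [A] abelian of index [p] containing [Z]. As [b]
    centralizes [Z], of index [p] in [A], all commutators are powers of one [w = [c, b]], and [w^p =
    [c^p, b] = 1] because [c^p] is central. *)
Lemma card_der1_central (gT : finGroupType) (p : nat) (G Z : {group gT}) :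
  prime p -> Z \subset 'Z(G) -> #|G : Z| = (p ^ 2)%N ->
  (forall x, x \in G -> x ^+ p \in Z) -> #|[~: G, G]| <= p.
Proof.
move=> prp sZ iGZ Gp; have p0 := prime_gt0 prp.
have sZG : Z \subset G := subset_trans sZ (center_sub G).
have cZG : G \subset 'C(Z) by rewrite centsC (subset_trans sZ) ?subsetIr.
have [cGG|ncGG] := boolP (abelian G).
  by rewrite (commG1P cGG) cards1.
have [a Ga nZa] : exists2 a, a \in G & a \notin Z.
  by apply/subsetPn; rewrite -indexg_eq1 iGZ -(expn0 p) eqn_exp2l // prime_gt1.
pose A := (Z <*> <[a]>)%G.
have sAG : A \subset G by rewrite join_subG sZG cycle_subG.
have cAA : abelian A.
  rewrite abelianY cycle_abelian cycle_subG (subsetP cZG) //.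
  by rewrite (abelianS sZ (center_abelian G)).
have sZA : Z \subset A := joing_subl _ _.
have iprod : (#|G : A| * #|A : Z| = p ^ 2)%N by rewrite Lagrange_index.
have nA : (#|A : Z| != 1)%N.
  rewrite indexg_eq1; apply: contra nZa => s; apply: (subsetP s).
  by rewrite -cycle_subG joing_subr.
have nG : (#|G : A| != 1)%N.
  by rewrite indexg_eq1; apply: contra ncGG => s; apply: abelianS s cAA.
have [iA iG] : #|A : Z| = p /\ #|G : A| = p.
  have /(dvdn_pfactor _ _ prp)[k k2 ek] : #|A : Z| %| p ^ 2 by rewrite -iprod dvdn_mull.
  move: iprod nA nG; rewrite ek; case: k k2 {ek} => [|[|[|//]]] //.
    by rewrite expn1 expnS expn1 => _ /eqP; rewrite eqn_pmul2r // => /eqP.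
  move=> _ /eqP; rewrite -{2}[(p ^ 2)%N]mul1n eqn_pmul2r ?expn_gt0 ?p0 // => /eqP->.
  by rewrite eqxx.
have [b Gb nAb] : exists2 b, b \in G & b \notin A by apply/subsetPn; rewrite -indexg_eq1.
have eG : A <*> <[b]> = G.
  have sJ : A <*> <[b]> \subset G by rewrite join_subG sAG cycle_subG.
  have priA : prime #|G : A| by rewrite iG.
  have [e|//] := prime_index_sandwich (joing_subl A <[b]>) sJ priA.
  by case/negP: nAb; rewrite -[_ \in A]/(_ \in gval A) -e -cycle_subG joing_subr.
have abGZ : [~: G, G] \subset Z.
  have gZ : G / Z \subset 'C(G / Z).
    apply: (card_p2group_abelian prp).
    by rewrite card_quotient // (subset_trans cZG) ?cent_sub.
  by rewrite quotient_cents2 // ?(subset_trans cZG) ?cent_sub // in gZ.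
have [c Ac nbc] : exists2 c, c \in A & c ^ b != c.
  apply/exists_inP; apply: contraR ncGG; rewrite negb_exists_in => /forall_inP h.
  have cAb : b \in 'C(A).
    by apply/centP=> z Az; apply/esym/commgP/conjg_fixP/eqP; have := h z Az; rewrite negbK.
  by rewrite -eG abelianY cAA cycle_abelian /= cycle_subG.
pose w := [~ c, b].
have Gc := subsetP sAG c Ac.
have Zw : w \in Z by apply: (subsetP abGZ); apply: mem_commg.
have cwG : G \subset 'C(<[w]>).
  by apply: subset_trans cZG _; apply: centS; rewrite cycle_subG.
have nwG : G \subset 'N(<[w]>) := subset_trans cwG (cent_sub _).
have wp : w ^+ p == 1.
  rewrite /w -commXg; last first.
    exact: (centsP cZG).
  by apply/commgP/commute_sym; apply: (centsP cZG) => //; apply: Gp.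
have sDw : [~: G, G] \subset <[w]>.
  rewrite -quotient_cents2 // -eG.
  have nwA := subset_trans sAG nwG.
  have nwb : <[b]> \subset 'N(<[w]>) by rewrite cycle_subG (subsetP nwG).
  have cAb : [~: A, <[b]>] \subset <[w]>.
    apply: (comm_hyperplane cAA sZA) => //; rewrite ?iA //.
    - exact: (subsetP cZG).
    - by apply: (subsetP sZA).
    by rewrite -cent_cycle (subsetP cwG).
  rewrite quotientY // -[_ \subset _]/(abelian _) abelianY !quotient_abelian ?cycle_abelian //.
  by rewrite centsC quotient_cents2.
apply: leq_trans (subset_leq_card sDw) _.
by rewrite -orderE dvdn_leq // order_dvdn wp.
Qed.

(** * Strongly embedded subgroups *)

Section StronglyEmbedded.

Variables (gT : finGroupType) (p : nat) (O M : {group gT}).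
Hypothesis seM : strongly_p_embedded p O M.

Lemma strongly_embedded_sub : M \subset O.
Proof. by case: seM => /proper_sub. Qed.

Lemma strongly_embedded_mem x h : h \in O -> x \in M -> x \in M :^ h ->
  p.-elt x -> x != 1 -> h \in M.
Proof.
move=> Oh Mx Mhx px; apply: contraR => nMh.
have [_ _ /(_ h)] := seM; rewrite inE nMh => /(_ Oh) p'M.
have p'x : p^'.-elt x by apply: mem_p_elt p'M _; rewrite inE Mx.
by rewrite -order_eq1; apply/eqP/(pnat_1 px p'x).
Qed.

Lemma strongly_embeddedJ h : h \in O -> strongly_p_embedded p O (M :^ h).
Proof.
move=> Oh; have [prM pM hM] := seM; split.
- by rewrite -{1}(conjGid Oh) properJ.
- by rewrite cardJg.
move=> g /setDP[Og nMg].
have -> : (M :^ h) :^ g = (M :^ (h * g * h^-1)) :^ h by rewrite -!conjsgM mulgKV.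
have Ohg : h * g * h^-1 \in O by rewrite !groupM ?groupV.
rewrite -conjIg pgroupJ hM // inE Ohg andbT.
by move: nMg; rewrite mem_conjg conjgE !invgK mulgA.
Qed.

Hypothesis prp : prime p.

(** A Sylow subgroup [R] of [M] is non-trivial, and an element [y] of [O] normalizing it puts [R] in
    both [M] and [M^y], so [y] lies in [M]. Hence [R] is self-normalizing in a Sylow subgroup of [O]
    containing it, and equals it. *)
Lemma strongly_embedded_sylow (P : {group gT}) : p.-Sylow(O) P ->
  exists2 h, h \in O & P \subset M :^ h.
Proof.
move=> sylP; have sMO := strongly_embedded_sub.
have [R sylR] := Sylow_exists p M.
have sRM := pHall_sub sylR; have pR := pHall_pgroup sylR.
have [x Ox sRP] := Sylow_subJ sylP (subset_trans sRM sMO) pR.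
have pP : p.-group (P :^ x) by rewrite pgroupJ (pHall_pgroup sylP).
have ntR : R :!=: 1.
  have [_ pM _] := seM; apply/eqP=> R1.
  have := card_Hall sylR; rewrite R1 cards1 => /esym/eqP.
  rewrite partn_eq1 // p'natE //.
  by rewrite pM.
have nRM : 'N_(P :^ x)(R) \subset M.
  apply/subsetP=> y /setIP[Py Ny].
  have Oy : y \in O by apply: subsetP Py; rewrite -(conjGid Ox) conjSg (pHall_sub sylP).
  have [z Rz nz1] := trivgPn _ ntR.
  apply: strongly_embedded_mem Oy (subsetP sRM z Rz) _ (mem_p_elt pR Rz) nz1.
  by rewrite mem_conjg (subsetP sRM) // memJ_norm // groupV.
have eN : 'N_(P :^ x)(R) = R.
  apply: sub_pHall sylR _ _ nRM; first by apply: pgroupS (subsetIl _ _) pP.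
  by rewrite subsetI sRP normG.
have eP : (P :^ x)%G = R.
  by apply/val_inj/(nilpotent_sub_norm (pgroup_nil pP) sRP); rewrite /= eN.
exists x^-1; rewrite ?groupV //.
by rewrite -sub_conjg (congr_group eP).
Qed.

End StronglyEmbedded.

Lemma strongly_embedded_sylow_neq1 (gT : finGroupType) (p : nat) (O M P : {group gT}) :
  prime p -> strongly_p_embedded p O M -> p.-Sylow(O) P -> P :!=: 1.
Proof.
move=> pr [prM pM _] sylP; apply/eqP=> P1.
have := card_Hall sylP; rewrite P1 cards1 => /esym/eqP.
rewrite partn_eq1 // p'natE // (dvdn_trans pM) // cardSg //.
exact: proper_sub prM.
Qed.

(** Being normal, [R] lies in a conjugate of [M] and in all further conjugates; a non-trivial
    element of [R] would then force all of [O] into that conjugate. *)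
Lemma strongly_embedded_normal_pgroup (gT : finGroupType) (p : nat) (O M R : {group gT}) :
  prime p -> strongly_p_embedded p O M -> p.-group R -> R <| O -> R :=: 1.
Proof.
move=> pr seM0 pR /andP[sRO nRO].
have [P sylP] := Sylow_exists p O.
have [h Oh sPM] := strongly_embedded_sylow seM0 pr sylP.
have := strongly_embeddedJ seM0 Oh; set M' := (M :^ h)%G => seM.
have [x Ox sRP] := Sylow_subJ sylP sRO pR.
have sRM : R \subset M'.
  apply: subset_trans sPM; rewrite -(normP (subsetP nRO x^-1 _)) ?groupV //.
  by rewrite sub_conjgV.
have [prM _ _] := seM; have [g Og nMg] := subsetPn (proper_subn prM).
apply/eqP; apply: contraR nMg => ntR; have [z Rz nz1] := trivgPn _ ntR.
apply: (@strongly_embedded_mem _ p O M' seM z) => //.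
- exact: (subsetP sRM).
- rewrite mem_conjg; apply: (subsetP sRM); rewrite memJ_norm // groupV.
  exact: subsetP nRO g Og.
exact: mem_p_elt pR Rz.
Qed.

Section SylowOrder.

Variables (aT oT wT : finGroupType) (p : nat) (G N : {group aT}) (W : {group wT}).
Variables (pi : {morphism G >-> oT}) (q : {morphism G >-> wT}) (M0 : {group oT}).
Hypotheses (prp : prime p) (sNG : N \subset G) (pN : p.-group N).
Hypotheses (nWq : q @* G \subset 'N(W)) (abW : p.-abelem W) (leW : #|W| <= p ^ 3).
Hypothesis kerq : forall g, g \in G -> (pi g == 1) = (q g \in 'C(W)).
Hypothesis sylN : p.-Sylow(pi @* G) (pi @* N).
Hypothesis seM0 : strongly_p_embedded p (pi @* G) M0.

(* Assume [p^2 <= #|pi @* N|].  Then some [x] in [q @* N] centralizes an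
   invariant hyperplane [H] of [W], with [[W, x] = <w>].  For [g] with
   [pi g \notin M], strong embedding makes [N] act on [w' = w^g] with orbit the
   whole coset [w' H].  As [H :&: H^g] contains some [h != 1], the element [w' h]
   is a conjugate of [w'] that is also fixed by [x^g], and strong embedding is
   contradicted. *)
Lemma strongly_embedded_sylow_order : #|pi @* N| <= p.
Proof.
have p0 := prime_gt0 prp; have p1 := prime_gt1 prp.
rewrite leqNgt; apply/negP => gtP.
have [h Oh sPM] := strongly_embedded_sylow seM0 prp sylN.
have := strongly_embeddedJ seM0 Oh; move: sPM; set M := (M0 :^ h)%G => sPM seM.
have pW := abelem_pgroup abW; have cWW := abelem_abelian abW.
have geP : p ^ 2 <= #|pi @* N|.
  have [k e] := p_natP (pHall_pgroup sylN).
  by move: gtP; rewrite e -{1}(expn1 p) ltn_exp2l // leq_exp2l.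
set R := (q @* N)%G.
have pR : p.-group R by apply: morphim_pgroup.
have nRW : R \subset 'N(W) by apply: subset_trans (morphimS q sNG) nWq.
have pRW : p.-group (W <*> R) by rewrite norm_joinEr // pgroupM pW.
have nW : W <| W <*> R by rewrite /normal joing_subl join_subG normG.
(* By [kerq], [pi] and the action on [W] have the same kernel on [N]. *)
have cardP : #|R : 'C_R(W)| = #|pi @* N|.
  pose K := (N :&: q @*^-1 'C(W))%G.
  have cR : #|q @* N : q @* K| = #|N : K|.
    have sKN : K \subset N by apply: subsetIl.
    rewrite -(index_morphim_ker q sKN sNG).
    rewrite [X in (_ * X)%N](_ : _ = 1%N) ?muln1 //; apply/eqP.
    by rewrite indexg_eq1 setIS //= kerE morphpreS ?sub1G.
  rewrite card_morphim (setIidPr sNG) -(indexgI N ('ker pi)).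
  have <- : K = N :&: 'ker pi :> {set aT}.
    apply/setP=> x; rewrite !inE; case Nx: (x \in N) => //=.
    by rewrite (subsetP sNG x Nx) /= kerq ?(subsetP sNG).
  rewrite -cR; congr #|_ : _|; apply/eqP; rewrite eqEsubset; apply/andP; split.
    apply/subsetP=> y /setIP[/morphimP[x Gx Nx ->] Cx].
    by rewrite mem_morphim // !inE Nx Gx.
  apply/subsetP=> _ /morphimP[x Gx /setIP[Nx Cx] ->].
  by move: Cx; rewrite !inE Gx /= => ->; rewrite mem_morphim.
have ntW : W :!=: 1.
  apply: contraL geP => /eqP W1; rewrite -ltnNge -cardP W1 cent1T setIT indexgg.
  by rewrite -{1}(expn0 p) ltn_exp2l.
have [m oW] := p_natP pW.
have m0 : 0 < m.
  by case: m oW => // /eqP; rewrite expn0 -trivg_card1 (negPf ntW).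
have m3 : m <= 3 by rewrite -(leq_exp2l _ _ p1) -oW.
have [H [sHW nHWR oH]] : exists H : {group wT},
    [/\ H \subset W, H <| W <*> R & #|H| = p ^ m.-1]%N.
  by apply: normal_pgroup pRW nW _; rewrite oW pfactorK ?leq_pred.
have leH : #|H| <= p ^ 2 by rewrite oH leq_exp2l // -ltnS prednK.
have nHR : R \subset 'N(H).
  by apply: subset_trans (normal_norm nHWR); apply: joing_subr.
have iWH : #|W : H| = p.
  apply/eqP; rewrite -(eqn_pmul2l (cardG_gt0 H)) Lagrange // oW oH -expnSr.
  by rewrite prednK.
have cWR : [~: W, W <*> R] \subset H.
  apply: (comm_prime_order prp pRW (normal_norm nW) (normal_norm nHWR)) => //.
    exact: joing_subl.
  by rewrite iWH.
(* ['C_R(H)] has index at most [p] in [R], since [|H| <= p^2], whereas the index of ['C_R(W)]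
   exceeds [p]. *)
have [x /setIP[Rx cHx] nCx] : exists2 x, x \in 'C_R(H) & x \notin 'C(W).
  apply/subsetPn; apply: contraL gtP => s; rewrite -leqNgt -cardP.
  apply: leq_trans (index_cent_small prp pR nHR (abelemS sHW abW) leH).
  by rewrite dvdn_leq // indexgS // subsetI subsetIl.
have Nx : x \in 'N(W) := subsetP nRW x Rx.
have [z Gz Nz xz] := morphimP Rx.
have [b Wb nbx] : exists2 b, b \in W & b ^ x != b.
  apply/exists_inP; apply: contraR nCx; rewrite negb_exists_in => /forall_inP c.
  by apply/centP=> y Wy; apply/esym/commgP/conjg_fixP/eqP; have := c y Wy; rewrite negbK.
pose w := [~ b, x]; pose D := <[w]>%G.
have Hw : w \in H.
  by apply: (subsetP cWR); apply: mem_commg => //; apply: subsetP Rx; apply: joing_subr.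
have Ww := subsetP sHW w Hw.
have cwx : x \in 'C[w] by apply/cent1P; apply: (centP cHx).
have WD : W \subset 'N(D) by apply: sub_abelian_norm; rewrite ?cycle_subG.
have cWx : [~: W, <[x]>] \subset D.
  by apply: (comm_hyperplane cWW sHW) => //; rewrite iWH.
(* With [J] generated by [z] and [z^a], [q @* J] centralizes [D]. As [x] is trivial on [W / D],
   [q @* J] acts there as the p-group generated by [x^a]; so p'-elements of [J] are trivial on
   [W / D] and [D], hence on [W], and [pi @* J] is a p-group. It lies in some [M^y], which is [M]
   because both contain [pi z]. Then [pi z ^ pi a] lies in [M] and in its conjugate by [pi a]. *)
have key a : a \in G -> x ^ q a \in 'C[w] -> pi a \in M.
  move=> Ga cxa; pose J := (<[z]> <*> <[z ^ a]>)%G.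
  have sJG : J \subset G by rewrite join_subG !cycle_subG Gz groupJ.
  have eJ : q @* J = <[x]> <*> <[x ^ q a]>.
    by rewrite morphimY ?cycle_subG ?groupJ // !morphim_cycle ?groupJ // morphJ // -xz.
  have nJD : q @* J \subset 'C(D).
    by rewrite eJ join_subG !cycle_subG /= cent_cycle cwx.
  have px : p.-elt x := mem_p_elt pR Rx.
  pose C := (q @* J :&: coset D @*^-1 'C(W / D))%G.
  have nJW : q @* J \subset 'N(W) by apply: subset_trans nWq; apply: morphimS.
  have nJC : q @* J \subset 'N(C).
    apply: normsI; first exact: normG.
    apply: norm_quotient_cent_pre nJW.
    exact: subset_trans nJD (cent_sub _).
  have pJC : p.-group (q @* J / C).
    rewrite eJ; apply: pquotient_joing.
    - rewrite /= eJ subsetI joing_subl -sub_quotient_pre.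
        by rewrite centsC; apply: quotient_cents2r.
      by apply: subset_trans (cent_sub _); apply: subset_trans nJD; rewrite eJ joing_subl.
    - by rewrite -eJ.
    have pxa : p.-elt (x ^ q a) by rewrite p_eltJ.
    exact: pxa.
  have pJ : p.-group (pi @* J).
    apply: (morphim_pgroup_p'elt sJG) => r Jr p'r.
    have Gr := subsetP sJG r Jr; apply/eqP; rewrite kerq //.
    have Jqr : q r \in q @* J by apply: mem_morphim.
    have p'qr : p^'.-elt (q r) by apply: morph_p_elt.
    have /setIP[_ Cr] := p'elt_sub_of_pquotient nJC pJC Jqr p'qr.
    have nDr : q r \in 'N(D) by apply: subsetP (cent_sub _) _ (subsetP nJD _ Jqr).
    have s1 : [~: W, <[q r]>] \subset D.
      rewrite -quotient_cents2 ?cycle_subG // quotient_cycle // centsC cycle_subG.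
      by move: Cr; rewrite !inE; case/andP.
    have s2 : [~: D, <[q r]>] \subset 1%G.
      by apply/trivgP/commG1P; rewrite centsC cycle_subG (subsetP nJD).
    have := coprime_comm_step pW (subsetP nJW _ Jqr) p'qr s1 s2.
    by move/trivgP/commG1P; rewrite centsC cycle_subG.
  have sJO : pi @* J \subset pi @* G by apply: morphimS.
  have [y Oy sJN] := Sylow_subJ sylN sJO pJ.
  have sJM : pi @* J \subset M :^ y by apply: subset_trans sJN _; rewrite conjSg.
  have Mz : pi z \in M by apply: (subsetP sPM); apply: mem_morphim.
  have pz : p.-elt (pi z) by apply: morph_p_elt; rewrite ?(mem_p_elt pN).
  have z1 : pi z != 1 by rewrite kerq // -xz.
  have Jz : pi z \in pi @* J by rewrite mem_morphim //= -cycle_subG joing_subl.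
  have My := strongly_embedded_mem seM Oy Mz (subsetP sJM _ Jz) pz z1.
  have Mza : pi z ^ pi a \in M.
    rewrite -morphJ // -[M : {set oT}](conjGid My); apply: (subsetP sJM).
    by apply: mem_morphim (groupJ Gz Ga) _; rewrite /= -cycle_subG joing_subr.
  apply: (strongly_embedded_mem seM) Mza _ _ _; rewrite ?mem_morphim //.
  - by rewrite memJ_conjg.
  - by rewrite p_eltJ.
  - by rewrite conjg_eq1.
have [o Oo nMo] := subsetPn (proper_subn (let: And3 h _ _ := seM in h)).
have [g Gg _ eo] := morphimP Oo; rewrite {}eo {Oo} in nMo.
have Wqg a : a \in G -> q a \in 'N(W).
  by move=> Ga; apply: (subsetP nWq); apply: mem_morphim.
have keyV a : a \in G -> w ^ q a \in 'C[x] -> pi a \in M.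
  move=> Ga c; rewrite -groupV -morphV //; apply: key; rewrite ?groupV //.
  by rewrite morphV // cent1C cent1J mem_conjgV.
pose w' := w ^ q g.
(* If [w'^u] commutes with [x^g], then [keyV] puts [pi u] in the conjugate of [M] by [pi g]. As
   [pi u] lies in [M] and [pi g] does not, [pi u = 1]. *)
have stab u : u \in N -> w' ^ q u \in 'C[x ^ q g] -> q u \in 'C(W).
  move=> Nu c; have Gu := subsetP sNG u Nu.
  have Mc : pi (g * u * g^-1) \in M.
    have Ggu : g * u * g^-1 \in G by rewrite !groupM ?groupV.
    apply: keyV => //; rewrite (morphM q (groupM Gg Gu) (groupVr Gg)) (morphM q Gg Gu).
    by rewrite morphV // 2!conjgM -mem_conjg -cent1J.
  rewrite -kerq //; apply: contraR nMo => u1.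
  have Mu : pi u \in M by apply: (subsetP sPM); apply: mem_morphim.
  apply: (strongly_embedded_mem seM) Mu _ _ u1; rewrite ?mem_morphim //.
    move: Mc; rewrite (morphM pi (groupM Gg Gu) (groupVr Gg)) (morphM pi Gg Gu) morphV //.
    by rewrite [_ \in M :^ _]mem_conjg conjgE invgK mulgA.
  by apply: morph_p_elt; rewrite ?(mem_p_elt pN).
have Ww' : w' \in W by rewrite memJ_norm // Wqg.
have Cw' : w' \in 'C[x ^ q g] by rewrite cent1J memJ_conjg cent1C.
have cRw' : 'C_R[w'] = 'C_R(W).
  apply/eqP; rewrite eqEsubset subsetI subsetIl /=; apply/andP; split.
    apply/subsetP=> y /setIP[/morphimP[u Gu Nu ->] c].
    by apply: stab => //; rewrite (conjgE w') -(cent1P c) mulKg.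
  by rewrite setIS // -cent_set1 centS // sub1set.
have orbE : w' ^: R = w' *: H.
  apply/eqP; rewrite eqEcard card_lcoset -index_cent1 cRw' cardP (leq_trans leH geP) andbT.
  apply/subsetP=> _ /imsetP[y Ry ->]; rewrite mem_lcoset -commgEl.
  by apply: (subsetP cWR); apply: mem_commg => //; apply: subsetP Ry; apply: joing_subr.
have cH : #|H| = (p ^ 2)%N.
  by apply/eqP; rewrite eqn_leq leH -(card_lcoset H w') -orbE -index_cent1 cRw' cardP geP.
have [hh /setIP[Hh Hgh] h1] : exists2 hh, hh \in H :&: H :^ q g & hh != 1.
  apply/trivgPn/negP => /eqP ti.
  have sHg : H :^ q g \subset W by rewrite -(normP (Wqg g Gg)) conjSg.
  have := subset_leq_card (mul_subG sHW sHg).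
  rewrite TI_cardMg // cardJg cH -expnD leqNgt.
  by rewrite (leq_ltn_trans leW) // ltn_exp2l.
have : w' * hh \in w' ^: R by rewrite orbE mem_lcoset mulKg.
case/imsetP=> y /morphimP[u Gu Nu ->] e.
have cu : q u \in 'C(W).
  apply: stab => //; rewrite -e groupM //.
  rewrite /= cent1J; apply: subsetP Hgh; rewrite conjSg -cent_cycle centsC.
  by rewrite cycle_subG.
case/eqP: h1; apply: (mulgI w'); rewrite e mulg1.
by rewrite conjgE -(centP cu _ Ww') mulKg.
Qed.

End SylowOrder.

(** * Planes over the prime field *)

Section Coordinates.

Variables (gT : finGroupType) (p : nat) (Y : {group gT}) (u v : gT).
Hypotheses (prp : prime p) (abY : p.-abelem Y) (oY : #|Y| = (p ^ 2)%N).
Hypotheses (Yu : u \in Y) (Yv : v \in Y) (u1 : u != 1) (nuv : v \notin <[u]>).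

Local Notation V := 'rV['F_p]_2.

Let Yp y : y \in Y -> y ^+ p = 1.
Proof. by have [_ h] := abelemP prp abY; apply: h. Qed.

(** [(Zp_trunc (pdiv p)).+2] is the modulus to which arithmetic in ['F_p] unfolds; it equals [p] for
    [p] prime. *)
Let Yq y : y \in Y -> y ^+ (Zp_trunc (pdiv p)).+2 = 1.
Proof. by move=> Yy; rewrite Fp_cast // Yp. Qed.

Let expD y (a b : 'F_p) : y \in Y -> y ^+ (a + b)%R = y ^+ a * y ^+ b.
Proof. by move=> Yy; rewrite -expgD /= (expg_mod _ (Yq Yy)). Qed.

Let expM y (a b : 'F_p) : y \in Y -> y ^+ (a * b)%R = y ^+ a ^+ b.
Proof. by move=> Yy; rewrite -expgM /= (expg_mod _ (Yq Yy)). Qed.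

Let cY x y : x \in Y -> y \in Y -> commute x y.
Proof. by move=> Yx Yy; apply: (centsP (abelem_abelian abY)). Qed.

Definition of_coords (z : V) := u ^+ (z 0 0)%R * v ^+ (z 0 1)%R.

Lemma of_coordsD z w : of_coords (z + w)%R = of_coords z * of_coords w.
Proof.
rewrite /of_coords !mxE !expD // -!mulgA; congr (_ * _); rewrite !mulgA; congr (_ * _).
by apply: cY; rewrite groupX.
Qed.

Lemma of_coords_mem z : of_coords z \in Y.
Proof. by rewrite groupM ?groupX. Qed.

Lemma of_coords0 : of_coords 0%R = 1.
Proof. by rewrite /of_coords !mxE /= !expg0 mulg1. Qed.

Lemma of_coordsN z : of_coords (- z)%R = (of_coords z)^-1.
Proof. by apply/eqP; rewrite eq_sym eq_invg_mul -of_coordsD GRing.addrN of_coords0. Qed.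

Lemma of_coords_eq1 z : of_coords z = 1 -> z = 0%R.
Proof.
move=> e; have z1 : z 0%R 1%R = 0%R.
  apply/eqP; apply: contraR nuv => nz; rewrite -[v]expg1.
  have -> : 1%N = (z 0 1 * (z 0 1)^-1)%R :> nat.
    by rewrite GRing.divff //= Fp_cast // modn_small ?prime_gt1.
  rewrite expM // groupX //; have := congr1 (fun t => (u ^+ (z 0 0)%R)^-1 * t) e.
  by rewrite mulKg mulg1 => ->; rewrite groupV mem_cycle.
have z0 : z 0%R 0%R = 0%R.
  apply/eqP; apply: contraR u1 => nz; rewrite -[u]expg1.
  have -> : 1%N = (z 0 0 * (z 0 0)^-1)%R :> nat.
    by rewrite GRing.divff //= Fp_cast // modn_small ?prime_gt1.
  by move: e; rewrite expM // /of_coords z1 expg0 mulg1 => ->; rewrite expg1n.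
apply/rowP=> i; rewrite mxE.
case: i => [[|[|//]] hi].
  by rewrite (_ : Ordinal hi = 0%R) ?z0 //; apply/val_inj.
by rewrite (_ : Ordinal hi = 1%R) ?z1 //; apply/val_inj.
Qed.

Lemma of_coords_inj : injective of_coords.
Proof.
move=> z w e; apply/eqP; rewrite -GRing.subr_eq0; apply/eqP/of_coords_eq1.
by rewrite of_coordsD of_coordsN e mulgV.
Qed.

Lemma of_coords_onto y : y \in Y -> exists z, of_coords z = y.
Proof.
move=> Yy; have sY : of_coords @: [set: V] \subset Y.
  by apply/subsetP=> _ /imsetP[z _ ->]; apply: of_coords_mem.
have eY : of_coords @: [set: V] = Y.
  apply/eqP; rewrite eqEcard sY card_imset; last exact: of_coords_inj.
  by rewrite cardsT card_mx card_Fp // oY mul1n leqnn.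
by move: Yy; rewrite -eY => /imsetP[z _ ->]; exists z.
Qed.

(** The default 0 is returned only outside [Y], since [of_coords] maps onto [Y]. *)
Definition coords (y : gT) : V := odflt 0%R [pick z | of_coords z == y].

Lemma coordsK : cancel of_coords coords.
Proof.
move=> z; rewrite /coords; case: pickP => [w /eqP /of_coords_inj //|/(_ z)].
by rewrite eqxx.
Qed.

Lemma of_coordsK : {in Y, cancel coords of_coords}.
Proof. by move=> y /of_coords_onto[z <-]; rewrite coordsK. Qed.

Lemma coordsM : {in Y &, forall x y, coords (x * y) = (coords x + coords y)%R}.
Proof.
move=> x y Yx Yy; apply: of_coords_inj.
by rewrite of_coordsD !of_coordsK ?groupM.
Qed.

Lemma coordsX y n : y \in Y -> coords (y ^+ n) = (coords y *+ n)%R.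
Proof.
move=> Yy; elim: n => [|n IHn]; last by rewrite expgS coordsM ?groupX // IHn GRing.mulrS.
by rewrite GRing.mulr0n expg0 -of_coords0 coordsK.
Qed.

Lemma coords_eq0 y : y \in Y -> (coords y == 0%R) = (y == 1).
Proof.
move=> Yy; apply/eqP/eqP => [e|->]; last by rewrite -of_coords0 coordsK.
by rewrite -(of_coordsK Yy) e of_coords0.
Qed.

Lemma coords_u : coords u = delta_mx 0%R 0%R.
Proof.
apply: of_coords_inj; rewrite of_coordsK // /of_coords !mxE /= expg0 expg1 mulg1.
by [].
Qed.

Lemma coords_v : coords v = delta_mx 0%R 1%R.
Proof.
apply: of_coords_inj; rewrite of_coordsK // /of_coords !mxE /= expg0 expg1 mul1g.
by [].
Qed.

Definition coords_mx (g : gT) : 'M['F_p]_2 :=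
  \matrix_i (if i == 0%R then coords (u ^ g) else coords (v ^ g)).

Lemma coordsJ y g : y \in Y -> g \in 'N(Y) ->
  coords (y ^ g) = (coords y *m coords_mx g)%R.
Proof.
move=> Yy nYg; have [z <-] := of_coords_onto Yy; rewrite coordsK.
rewrite /of_coords conjMg !conjXg coordsM ?groupX ?memJ_norm //.
rewrite !coordsX ?memJ_norm //.
apply/rowP=> j; rewrite !mxE !big_ord_recl big_ord0 GRing.addr0 !mxE /=.
rewrite !mulmxnE -!(GRing.mulr_natl (_ _ _)) !natr_Zp.
by congr (_ + z _ _ * _)%R; apply/val_inj.
Qed.

Lemma coords_mx_unique g A : (forall y, y \in Y -> coords (y ^ g) = coords y *m A)%R ->
  coords_mx g = A.
Proof.
move=> h; apply/row_matrixP=> i; rewrite rowK.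
case: ifP => [/eqP->|i0]; first by rewrite h // coords_u -rowE.
rewrite h // coords_v -rowE; congr (row _ _).
by case: i i0 => [[|[|//]] hi] //= _; apply/val_inj.
Qed.

Lemma coords_mxM : {in 'N(Y) &, {morph coords_mx : g h / g * h >-> (g *m h)%R}}.
Proof.
move=> g h nYg nYh; apply: coords_mx_unique => y Yy.
by rewrite conjgM coordsJ ?memJ_norm // coordsJ // mulmxA.
Qed.

Lemma coords_mx_cent g : g \in 'C(Y) -> coords_mx g = 1%:M%R.
Proof.
move=> cYg; apply: coords_mx_unique => y Yy; rewrite mulmx1.
by rewrite conjgE -(centP cYg y Yy) mulKg.
Qed.

Lemma coords_mx_eq1 g : g \in 'N(Y) -> coords_mx g = 1%:M%R -> g \in 'C(Y).
Proof.
move=> nYg e; apply/centP=> y Yy; apply/esym/commgP/conjg_fixP.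
have := coordsJ Yy nYg; rewrite e mulmx1 => /(congr1 of_coords).
by rewrite !of_coordsK ?memJ_norm.
Qed.

End Coordinates.

(** * Generation of SL_2 by transvections *)

Section SL2.

Variable F : fieldType.
Local Open Scope ring_scope.

Definition upper (k : F) : 'M[F]_2 := \matrix_(i, j) (if i == j then 1 else if i == 0 then k else 0).
Definition lower (k : F) : 'M[F]_2 := \matrix_(i, j) (if i == j then 1 else if i == 0 then 0 else k).

Lemma mx2P (A B : 'M[F]_2) :
  A 0 0 = B 0 0 -> A 0 1 = B 0 1 -> A 1 0 = B 1 0 -> A 1 1 = B 1 1 -> A = B.
Proof.
move=> e1 e2 e3 e4; apply/matrixP => i j.
have d (k : 'I_2) : k = 0 \/ k = 1.
  by case: k => [[|[|//]] hk]; [left | right]; apply/val_inj.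
by case: (d i) => ->; case: (d j) => ->.
Qed.

Lemma det_mx2 (A : 'M[F]_2) : \det A = A 0 0 * A 1 1 - A 0 1 * A 1 0.
Proof.
rewrite (expand_det_row _ 0) !big_ord_recl big_ord0 addr0 /cofactor !det_mx11 !mxE /=.
rewrite expr0 expr1 mul1r mulN1r mulrN.
by congr (_ * A _ _ - A _ _ * A _ _); apply/val_inj.
Qed.

(** A matrix with rows [(a, b)], [(c, d)], determinant 1 and [c] non-zero factors explicitly as
    upper, lower, upper. If [c = 0], multiplying by [lower 1] on the right brings [d], which is then
    non-zero, into the place of [c]. *)
Lemma SL2_generated (P : 'M[F]_2 -> Prop) :
  (forall k, P (upper k)) -> (forall k, P (lower k)) ->
  (forall A B, P A -> P B -> P (A *m B)) ->
  forall A, \det A = 1 -> P A.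
Proof.
move=> PU PL PM.
have key (A : 'M[F]_2) : A 1 0 != 0 -> \det A = 1 -> P A.
  move=> nc; rewrite det_mx2 => dA.
  have -> : A = upper ((A 0 0 - 1) / A 1 0) *m lower (A 1 0) *m upper ((A 1 1 - 1) / A 1 0).
    apply: mx2P; rewrite !mxE !big_ord_recl !big_ord0 !mxE /= !big_ord_recl !big_ord0 !mxE /=.
    - by field.
    - have eb : A 0 1 = (A 0 0 * A 1 1 - 1) / A 1 0 by rewrite -dA; field.
      by rewrite [LHS]eb; field.
    - by field.
    - by field.
  by apply: (PM) => //; apply: PM.
move=> A dA; have [c0|] := eqVneq (A 1 0) 0; last by move=> c1; apply: key.
have l01 : lift ord0 ord0 = 1 :> 'I_2 by apply/val_inj.
have -> : A = (A *m lower 1) *m lower (- 1).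
  rewrite -mulmxA -[LHS]mulmx1; congr (_ *m _).
  by apply: mx2P; rewrite !mxE !big_ord_recl !big_ord0 !mxE /=; ring.
apply: PM => //; apply: key.
  rewrite !mxE !big_ord_recl !big_ord0 !mxE /= c0 l01 mul0r add0r addr0 mulr1.
  by apply: contra_eq_neq dA => d0; rewrite det_mx2 c0 d0 !mulr0 subr0 eq_sym oner_neq0.
by rewrite det_mulmx dA mul1r det_mx2 !mxE /=; ring.
Qed.

Lemma SL2_first_row (w : 'rV[F]_2) : w != 0 ->
  exists2 A : 'M[F]_2, \det A = 1 & delta_mx 0 0 *m A = w.
Proof.
move=> w0.
have d (k : 'I_2) : k = 0 \/ k = 1.
  by case: k => [[|[|//]] hk]; [left | right]; apply/val_inj.
have row0 (A : 'M[F]_2) : A 0 0 = w 0 0 -> A 0 1 = w 0 1 -> delta_mx 0 0 *m A = w.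
  by move=> e0 e1; rewrite -rowE; apply/rowP=> j; rewrite !mxE; case: (d j) => ->.
pose mk a b e f : 'M[F]_2 := \matrix_(i, j)
  (if i == 0 then if j == 0 then a else b else if j == 0 then e else f).
have [a0|a0] := eqVneq (w 0 0) 0.
  have b0 : w 0 1 != 0.
    apply: contra w0 => /eqP b0; apply/eqP/rowP=> j; rewrite mxE.
    by case: (d j) => ->.
  exists (mk 0 (w 0 1) (- (w 0 1)^-1) 0); last by apply: row0; rewrite !mxE.
  by rewrite det_mx2 !mxE /=; field.
exists (mk (w 0 0) (w 0 1) 0 (w 0 0)^-1); last by apply: row0; rewrite !mxE.
by rewrite det_mx2 !mxE /=; field.
Qed.

End SL2.

Lemma upperX (F : fieldType) (c : F) n : (upper c ^+ n = upper (c *+ n))%R.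
Proof.
elim: n => [|n IHn]; rewrite ?exprS ?IHn; apply: mx2P;
  rewrite ?GRing.expr0 !mxE ?big_ord_recl ?big_ord0 ?mxE //=; rewrite ?GRing.mulrS; ring.
Qed.

Lemma lowerX (F : fieldType) (c : F) n : (lower c ^+ n = lower (c *+ n))%R.
Proof.
elim: n => [|n IHn]; rewrite ?exprS ?IHn; apply: mx2P;
  rewrite ?GRing.expr0 !mxE ?big_ord_recl ?big_ord0 ?mxE //=; rewrite ?GRing.mulrS; ring.
Qed.

(** * Two opposite transvections acting on a plane *)

Section TransvectionPair.

Variables (gT : finGroupType) (p : nat) (Y G : {group gT}) (u v x y : gT).
Hypotheses (prp : prime p) (abY : p.-abelem Y) (oY : #|Y| = (p ^ 2)%N).
Hypotheses (Yu : u \in Y) (Yv : v \in Y) (u1 : u != 1) (nuv : v \notin <[u]>).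
Hypotheses (nYG : G \subset 'N(Y)) (Gx : x \in G) (Gy : y \in G).
Hypotheses (ux : u ^ x = u) (vx : v ^ x = v * u).
Hypotheses (vy : v ^ y = v) (uy : u ^ y != u) (uyv : [~ u, y] \in <[v]>).

Local Notation rG := (coords_mx p u v).

Let coordsX' := coordsX prp abY oY Yu Yv u1 nuv.
Let coordsM' := coordsM prp abY oY Yu Yv u1 nuv.

Let rGX g n : g \in G -> rG (g ^+ n) = (rG g ^+ n)%R.
Proof.
move=> Gg; elim: n => [|n IHn].
  by rewrite expg0 GRing.expr0 (coords_mx_cent prp abY oY) // group1.
rewrite expgS (coords_mxM prp abY oY) ?(subsetP nYG) ?groupX // IHn GRing.exprS.
by [].
Qed.

Let uE := coords_u prp abY oY Yu Yv u1 nuv.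
Let vE := coords_v prp abY oY Yu Yv u1 nuv.

(** In the basis [u], [v] the matrix of [x] is [lower 1] and that of [y] is [upper c] with [c]
    non-zero; over a prime field their powers exhaust both root groups. *)
Lemma transvection_pair_SL2 (A : 'M['F_p]_2) : (\det A = 1)%R -> exists2 g, g \in G & rG g = A.
Proof.
have rx : rG x = lower 1.
  by apply: mx2P; rewrite !mxE /= ?ux ?vx ?coordsM' // uE ?vE !mxE //= ?GRing.addr0 ?GRing.add0r.
have [c c0 ry] : exists2 c : 'F_p, c != 0%R & rG y = upper c.
  have /cycleP[m em] := uyv.
  exists m%:R%R; last first.
    have uye : u ^ y = u * v ^+ m by rewrite -em mulKVg.
    apply: mx2P; rewrite !mxE /= ?uye ?vy ?coordsM' ?coordsX' ?groupX // ?uE vE !mxE //=.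
    - by rewrite mulmxnE mxE /= GRing.mul0rn GRing.addr0.
    - by rewrite mulmxnE mxE /= GRing.add0r.
  apply: contra uy => /eqP m0; apply/eqP/conjg_fixP; rewrite em.
  have [_ h] := abelemP prp abY.
  have : p %| m by rewrite (dvdn_pcharf (pchar_Fp prp)) m0.
  by case/dvdnP=> k ->; rewrite mulnC expgM h // expg1n.
apply: (@SL2_generated _ (fun A => exists2 g, g \in G & rG g = A)).
- move=> k; exists (y ^+ (k / c)%R); first exact: groupX.
  by rewrite rGX // ry upperX -GRing.mulr_natr natr_Zp GRing.mulrC GRing.divfK.
- move=> k; exists (x ^+ k); first exact: groupX.
  by rewrite rGX // rx lowerX natr_Zp.
move=> _ _ [g Gg <-] [h Gh <-]; exists (g * h); first exact: groupM.
by rewrite (coords_mxM prp abY oY) ?(subsetP nYG).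
Qed.

Lemma transvection_pair_trans z : z \in Y -> z != 1 -> exists2 g, g \in G & u ^ g = z.
Proof.
move=> Yz z1; have := SL2_first_row (w := coords p u v z).
rewrite (coords_eq0 prp abY oY) // => /(_ z1)[A dA eA].
have [g Gg rg] := transvection_pair_SL2 dA; exists g => //.
have nYg := subsetP nYG g Gg.
have := coordsJ prp abY oY Yu Yv u1 nuv Yu nYg; rewrite uE rg eA.
by move/(congr1 (of_coords u v)); rewrite !(of_coordsK prp abY oY) ?memJ_norm.
Qed.

End TransvectionPair.

(** In characteristic [p], [d^(p^k) - 1 = (d - 1)^(p^k)]. *)
Lemma Fp_pelt_eq1 (p : nat) (d : 'F_p) k : prime p -> (d ^+ (p ^ k) = 1 -> d = 1)%R.
Proof.
move=> prp dk; have pk : ([pchar 'F_p]%R).-nat (p ^ k)%N.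
  by rewrite pnatX (eq_pnat _ (pcharf_eq (pchar_Fp prp))) pnat_id.
have : ((d - 1) ^+ (p ^ k) = 0)%R.
  by rewrite GRing.exprDn_pchar // GRing.exprNn_pchar // dk GRing.expr1n GRing.addrN.
by move/eqP; rewrite GRing.expf_eq0 GRing.subr_eq0 => /andP[_ /eqP].
Qed.

(** * Groups normalizing [E] and [N] *)

Section NormalClosure.

Variables (gT : finGroupType) (p : nat) (N GA L : {group gT}).
Hypotheses (prp : prime p) (pN : p.-group N) (sNA : N \subset GA) (sLA : L \subset GA).
Hypothesis hL : forall K : {group gT}, N \subset K -> K <| GA -> L \subset K.

Lemma comm_closure (X Y : {group gT}) : X \subset GA ->
  GA \subset 'N(X) -> GA \subset 'N(Y) -> [~: X, N] \subset Y -> [~: X, L] \subset Y.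
Proof.
move=> sXA nXA nYA sXN; pose K := (GA :&: coset Y @*^-1 'C(X / Y))%G.
have nXY := subset_trans sXA nYA.
have nYL := subset_trans sLA nYA; have nYN := subset_trans sNA nYA.
suff sLK : L \subset K.
  rewrite -quotient_cents2 // centsC sub_quotient_pre //.
  by apply: subset_trans sLK _; apply: subsetIr.
apply: hL.
  rewrite subsetI sNA -sub_quotient_pre // centsC.
  exact: quotient_cents2r.
rewrite /normal subsetIl normsI ?normG //.
exact: norm_quotient_cent_pre.
Qed.

Lemma comm_closure_prime (X Y : {group gT}) : X \subset N ->
  GA \subset 'N(X) -> GA \subset 'N(Y) -> Y \subset X -> #|X : Y| <= p ->
  [~: X, L] \subset Y.
Proof.
move=> sXN nXA nYA sYX leX; apply: comm_closure => //.
  exact: subset_trans sNA.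
by apply: comm_prime_order leX; rewrite ?(subset_trans sNA).
Qed.

End NormalClosure.

Section AbelemCase.

Variables (gT : finGroupType) (p : nat) (T N E GA GB L : {group gT}).
Hypotheses (prp : prime p) (pN : p.-group N) (sEN : E \subset N) (iEN : #|N : E| = p).
Hypotheses (sTE : T \subset E) (sNA : N \subset GA) (nEA : GA \subset 'N(E)).
Hypotheses (nTA : GA \subset 'N(T)) (nNB : GB \subset 'N(N)) (nTB : GB \subset 'N(T)).
Hypothesis nEB : ~~ (GB \subset 'N(E)).
Hypotheses (abT : p.-abelem T) (leT : #|T| <= p ^ 3).
Hypotheses (sLA : L \subset GA).
Hypothesis hL : forall K : {group gT}, N \subset K -> K <| GA -> L \subset K.

Let sTN : T \subset N := subset_trans sTE sEN.
Let commL := comm_closure sNA sLA hL.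
Let commLp := comm_closure_prime prp pN sNA sLA hL.

Lemma index_p_normB (K : {group gT}) :
  E \subset K -> K \subset N -> GB \subset 'N(K) -> K :=: N.
Proof.
move=> sEK sKN nKB.
have [eK|//] := prime_index_sandwich sEK sKN (eq_ind_r (fun n => prime n) prp iEN).
by case/negP: nEB; rewrite -eK.
Qed.

(* Put [C = 'C_T(E)] and [D = [T, E]].  If [C = D], this subgroup is also
   ['C_T(N)] or [[T, N]], hence [GB]-invariant, and [index_p_normB] shows that [N]
   centralizes [C] or [T / C]; otherwise [C] and [D] yield a [GA]-invariant series
   of [T] with factors of order at most [p]. *)
Lemma p'elt_cent_abelem r : r \in L -> p^'.-elt r -> r \in 'C(T).
Proof.
move=> Lr p'r; have pT := abelem_pgroup abT.
have p0 := prime_gt0 prp; have p1 := prime_gt1 prp.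
have Ar := subsetP sLA r Lr.
have nTr := subsetP nTA r Ar.
have sL (X Y : {set gT}) : [~: X, L] \subset Y -> [~: X, <[r]>] \subset Y.
  by apply: subset_trans; apply: commgS; rewrite cycle_subG.
have centr : [~: T, <[r]>] \subset [1] -> r \in 'C(T).
  by move/trivgP/commG1P; rewrite centsC cycle_subG.
have step2 (A : {group gT}) : A \subset T ->
    [~: T, L] \subset A -> [~: A, L] \subset [1] -> r \in 'C(T).
  move=> sAT s1 s2; apply: centr.
  by apply: (coprime_comm_step pT nTr p'r (sL _ _ s1)); apply: sL s2.
have chain (A B : {group gT}) : A \subset B -> B \subset T ->
    GA \subset 'N(A) -> GA \subset 'N(B) ->
    #|A| <= p -> #|B : A| <= p -> #|T : B| <= p -> r \in 'C(T).
  move=> sAB sBT nA nB leA leB leTB; have sAT := subset_trans sAB sBT.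
  have s1 : [~: T, L] \subset B by apply: commLp.
  have s2 : [~: B, L] \subset A by apply: commLp => //; apply: subset_trans sTN.
  have s3 : [~: A, L] \subset 1%G.
    by apply: commLp; rewrite ?sub1G ?norm1 ?subsetT ?indexg1 // (subset_trans sAT).
  have := coprime_comm_step pT nTr p'r (sL _ _ s1) (sL _ _ s2) => s4.
  by apply: centr; apply: (coprime_comm_step pT nTr p'r s4); apply: sL s3.
pose C := 'C_T(E)%G; pose D := [~: T, E]%G.
have nTN : N \subset 'N(T) := subset_trans sNA nTA.
have sCT : C \subset T := subsetIl _ _.
have sDT : D \subset T by rewrite commg_subl (subset_trans sEN).
have nCA : GA \subset 'N(C) by rewrite normsI // norms_cent.
have nDA : GA \subset 'N(D) by rewrite normsR.
have [cTE|ncTE] := boolP (E \subset 'C(T)).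
  have eN : 'C_N(T) = N.
    by apply: (@index_p_normB 'C_N(T)%G); rewrite ?subsetI ?sEN ?subsetIl // normsI // norms_cent.
  apply: centr; apply: sL; apply: commL; rewrite ?norm1 ?subsetT //.
    exact: subset_trans sTN sNA.
  by apply/trivgP/commG1P; rewrite centsC -eN subsetIr.
have ntT : T :!=: 1 by apply: contra ncTE => /eqP->; rewrite cent1T subsetT.
have ntD : D :!=: 1 by apply: contra ncTE => /eqP/commG1P; rewrite centsC.
have prD : D \proper T.
  by apply: (nil_comm_properl (pgroup_nil pN)) => //; rewrite subsetI sEN (subset_trans sEN).
have prC : C \proper T.
  by rewrite properE sCT subsetI subxx centsC.
have nsDN : D <| N by rewrite /normal (subset_trans sDT) // (subset_trans sNA).
have sCZ : T :&: 'Z(N) \subset C.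
  by rewrite setIS // (subset_trans (subsetIr _ _)) // centS.
have ntCD : C :&: D != 1.
  apply: contra (meet_center_nil (pgroup_nil pN) nsDN ntD) => /eqP e.
  rewrite -subG1 -e subsetI subsetIl andbT (subset_trans _ sCZ) //.
  by rewrite setSI.
have prC1 : forall X : {group gT}, X \subset T -> X :!=: 1 -> exists2 k, 0 < k & #|X| = (p ^ k)%N.
  move=> X sXT ntX; have [k oX] := p_natP (pgroupS sXT pT).
  exists k => //; rewrite lt0n; apply: contra ntX => /eqP k0.
  by rewrite trivg_card1 oX k0.
have ntC : C :!=: 1 by apply: contra ntCD => /eqP->; rewrite setI1g.
have [t t0 oT] := prC1 T (subxx _) ntT.
have [c c0 oC] := prC1 C sCT ntC.
have [d d0 oD] := prC1 D sDT ntD.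
have [a a0 oCD] := prC1 (C :&: D)%G (subset_trans (subsetIl _ _) sCT) ntCD.
have lct : c < t by rewrite -(ltn_exp2l _ _ p1) -oC -oT proper_card.
have ldt : d < t by rewrite -(ltn_exp2l _ _ p1) -oD -oT proper_card.
have lt3 : t <= 3 by rewrite -(leq_exp2l _ _ p1) -oT.
have lac : a <= c by rewrite -(leq_exp2l _ _ p1) -oC -oCD subset_leq_card ?subsetIl.
have lad : a <= d by rewrite -(leq_exp2l _ _ p1) -oD -oCD subset_leq_card ?subsetIr.
have leidx (X Y : {group gT}) x y : X \subset Y -> #|X| = (p ^ x)%N -> #|Y| = (p ^ y)%N ->
    y <= x.+1 -> #|Y : X| <= p.
  move=> sXY oX oY le; rewrite -(leq_pmul2l (cardG_gt0 X)) Lagrange //.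
  by rewrite oX oY -expnSr leq_exp2l.
have nCD : GA \subset 'N(C :&: D) by rewrite normsI.
(* The bounds [0 < a < c < t <= 3] leave only [a = 1], [c = 2], [t = 3], so [1 < C :&: D < C < T]
   has factors of order [p]. The case [a < d] is the same with [D] for [C]. *)
have [lt_ac|le_ca] := ltnP a c.
  have ea : a = 1%N.
    by apply/eqP; rewrite eqn_leq a0 andbT -ltnS (leq_trans lt_ac) // -ltnS (leq_trans lct).
  apply: (chain (C :&: D)%G C) => //; rewrite ?subsetIl //.
  - by rewrite oCD ea expn1.
  - by apply: leidx oCD oC _; rewrite ?subsetIl // ea -ltnS (leq_trans lct).
  by apply: leidx oC oT _; rewrite // (leq_trans lt3) // ltnS (leq_ltn_trans a0).
have [lt_ad|le_da] := ltnP a d.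
  have ea : a = 1%N.
    by apply/eqP; rewrite eqn_leq a0 andbT -ltnS (leq_trans lt_ad) // -ltnS (leq_trans ldt).
  apply: (chain (C :&: D)%G D) => //; rewrite ?subsetIr //.
  - by rewrite oCD ea expn1.
  - by apply: leidx oCD oD _; rewrite ?subsetIr // ea -ltnS (leq_trans ldt).
  by apply: leidx oD oT _; rewrite // (leq_trans lt3) // ltnS (leq_ltn_trans a0).
have eac : a = c by apply/eqP; rewrite eqn_leq lac.
have ead : a = d by apply/eqP; rewrite eqn_leq lad.
have eCD : C :=: D.
  have e1 : C :&: D = C by apply/eqP; rewrite eqEcard subsetIl oCD oC eac /=.
  have e2 : C :&: D = D by apply/eqP; rewrite eqEcard subsetIr oCD oD ead /=.
  by rewrite -e1 e2.
have sRN : [~: T, N] \subset T by rewrite commg_subl.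
have [c1|c1] := leqP c 1.
  have ec : c = 1%N by apply/eqP; rewrite eqn_leq c1.
  have eCN : C :=: 'C_T(N).
    have prC' : prime #|C| by rewrite oC ec expn1.
    have sNE : 'C_T(N) \subset C by apply: setIS; apply: centS.
    have [s|ti] := prime_subgroupVti 'C_T(N)%G prC'.
      by apply/eqP; rewrite eqEsubset s.
    case/eqP: ntD; apply/eqP; have nsTN : T <| N by rewrite /normal sTN.
    apply: contraR (meet_center_nil (pgroup_nil pN) nsTN ntT) => _.
    rewrite -subG1 -ti subsetI sCZ andbT setIS //; exact: subsetIr.
  have nCB : GB \subset 'N(C) by rewrite eCN normsI // norms_cent.
  have nCN : N \subset 'N(C) := subset_trans sNA nCA.
  have eN : N :&: coset C @*^-1 'C(T / C) = N.
    apply: (@index_p_normB (N :&: coset C @*^-1 'C(T / C))%G); rewrite ?subsetIl //.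
      rewrite subsetI sEN -sub_quotient_pre ?(subset_trans sEN) // centsC.
      by apply: quotient_cents2r; rewrite eCD.
    by rewrite normsI // norm_quotient_cent_pre.
  apply: (step2 C) => //.
    apply: commL => //; first exact: subset_trans sTN sNA.
    rewrite -quotient_cents2 ?(subset_trans sTN) // centsC sub_quotient_pre //.
    by rewrite -{1}eN subsetIr.
  apply: commLp; rewrite ?norm1 ?subsetT ?sub1G ?indexg1 ?oC ?ec //.
  exact: subset_trans sTN.
(* Now [D] has index [p] in [T]; the proper subgroup [[T, N]] contains [D], so it equals [D]. *)
have ec : c = 2 by apply/eqP; rewrite eqn_leq c1 andbT -ltnS (leq_trans lct).
have et : t = 3 by apply/eqP; rewrite eqn_leq lt3 -ec.
have eDN : D :=: [~: T, N].
  have sDN : D \subset [~: T, N] by apply: commgS.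
  have prR : [~: T, N] \proper T.
    by apply: (nil_comm_properl (pgroup_nil pN)) => //; rewrite subsetI subxx.
  have priD : prime #|T : D|.
    rewrite (_ : #|T : D| = p) //; apply/eqP.
    by rewrite -(eqn_pmul2l (cardG_gt0 D)) Lagrange // oD oT et -ead eac ec -expnSr.
  have [e|e] := @prime_index_sandwich _ D [~: T, N]%G T sDN sRN priD.
    by rewrite -e.
  by case/negP: (proper_subn prR); rewrite -{1}e.
have nDB : GB \subset 'N(D) by rewrite eDN normsR.
have eN : 'C_N(D) = N.
  apply: (@index_p_normB 'C_N(D)%G); rewrite ?subsetIl ?normsI ?norms_cent //.
  by rewrite subsetI sEN -eCD centsC subsetIr.
apply: (step2 D) => //.
  by apply: commLp => //; apply: leidx oD oT _ => //; rewrite -ead eac ec et.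
apply: commL; rewrite ?norm1 ?subsetT //.
  by rewrite (subset_trans sDT) // (subset_trans sTN).
by apply/trivgP/commG1P; rewrite centsC -eN subsetIr.
Qed.

End AbelemCase.

(** * The action of [GA] and [GB] on [E] modulo the core *)

Section Amalgam.

(* [GA] and [GB] are groups inducing Aut_F(E) and Aut_F(N) by conjugation, with
   [N] = N_S(E); [pi @* GA] is Out_F(E), and [T] is the F-core of [E]. *)
Variables (gT oT : finGroupType) (p : nat) (N E GA GB T : {group gT}).
Variables (pi : {morphism GA >-> oT}) (M : {group oT}).
Hypotheses (prp : prime p) (oddp : odd p) (pN : p.-group N) (nsEN : E <| N).
Hypotheses (sNA : N \subset GA) (nEA : GA \subset 'N(E)) (nNB : GB \subset 'N(N)).
Hypothesis rkN : forall X : {group gT}, X \subset N -> #|X : 'Phi(X)| <= p ^ 3.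
Hypothesis cNE : 'C_N(E) \subset E.
Hypothesis kerpi : 'ker pi = 'C_GA(E) * E.
Hypothesis sylN : p.-Sylow(pi @* GA) (pi @* N).
Hypothesis seM : strongly_p_embedded p (pi @* GA) M.
Hypothesis nEB : ~~ (GB \subset 'N(E)).
Hypotheses (sTE : T \subset E) (nTA : GA \subset 'N(T)) (nTB : GB \subset 'N(T)).
Hypothesis maxT : forall X : {group gT},
  X \subset E -> GA \subset 'N(X) -> GB \subset 'N(X) -> X \subset T.

Let sEN : E \subset N := normal_sub nsEN.
Let sEA : E \subset GA := subset_trans sEN sNA.
Let sTN : T \subset N := subset_trans sTE sEN.
Let pE : p.-group E := pgroupS sEN pN.
Let pT : p.-group T := pgroupS sTN pN.

(** Its image under [pi] is O^{p'}(Out_F(E)), because [pi @* N] is a Sylow subgroup. *)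
Definition normal_closure := <<class_support N GA>>%G.
Local Notation L := normal_closure.

Lemma normal_closure_sub : L \subset GA.
Proof. by rewrite gen_subG class_support_subG. Qed.

Lemma sub_normal_closure : N \subset L.
Proof. exact: subset_trans (sub_class_support _ _) (subset_gen _). Qed.

Lemma normal_closure_norm : GA \subset 'N(L).
Proof. exact: norms_gen (class_support_norm _ _). Qed.

Lemma normal_closure_min (K : {group gT}) : N \subset K -> K <| GA -> L \subset K.
Proof. by move=> sNK /andP[_ nKA]; rewrite gen_subG class_support_sub_norm. Qed.

Let sLA := normal_closure_sub.

Lemma pi_cent g : g \in GA -> g \in 'C(E) -> pi g = 1.
Proof.
move=> Ag Cg; apply/kerP => //; rewrite kerpi.
by apply: (subsetP (mulG_subl _ _)); rewrite inE Ag.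
Qed.


Lemma capN_kerpi : N :&: 'ker pi = E.
Proof.
apply/eqP; rewrite eqEsubset subsetI sEN kerpi mulG_subr !andbT.
apply/subsetP=> x /setIP[Nx /mulsgP[c e /setIP[_ Cc] Ee dx]].
rewrite dx groupMr //; apply: (subsetP cNE); rewrite inE Cc andbT.
by rewrite -(groupMr _ (subsetP sEN e Ee)) -dx.
Qed.

(** The image of [K] is normal and has no non-trivial p'-element; strong embedding leaves no
    non-trivial normal p-subgroup. *)
Lemma normal_p'elts_cent (K : {group gT}) : K \subset GA -> GA \subset 'N(K) ->
  (forall r, r \in K -> p^'.-elt r -> r \in 'C(E)) -> K \subset 'ker pi.
Proof.
move=> sKA nKA h; rewrite ker_trivg_morphim sKA /=.
have pK : p.-group (pi @* K).
  by apply: (morphim_pgroup_p'elt sKA) => x Kx p'x; rewrite pi_cent ?(subsetP sKA) ?h.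
rewrite (strongly_embedded_normal_pgroup prp seM pK) //.
by rewrite /normal morphimS // morphim_norms.
Qed.

Lemma closure_p'elt : exists2 r, r \in L & p^'.-elt r /\ r \notin 'C(E).
Proof.
have [/exists_inP[r Lr /andP[a b]]|] := boolP [exists r in L, p^'.-elt r && (r \notin 'C(E))].
  by exists r.
rewrite negb_exists_in => /forall_inP h.
have sLK : L \subset 'ker pi.
  apply: normal_p'elts_cent => //; first exact: normal_closure_norm.
  by move=> r Lr p'r; move: (h r Lr); rewrite p'r negbK.
case/eqP: (strongly_embedded_sylow_neq1 prp seM sylN); apply/trivgP.
have := morphimS pi (subset_trans sub_normal_closure sLK).
by rewrite morphim_ker.
Qed.

(** The orbit count is applied to the action on [E / 'Phi(E)], whose kernel is ['ker pi]:
    ['C_GA(E) * E] acts trivially there, and conversely the p'-elements of the kernel centralize [E]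
    by Burnside's theorem. *)
Lemma index_EN : #|N : E| = p.
Proof.
have nPA : GA \subset 'N('Phi(E)) by apply: char_norm_trans (Phi_char _) nEA.
have nPE : E \subset 'N('Phi(E)) := subset_trans sEA nPA.
pose q := restrm nPA (coset 'Phi(E)).
have oN : #|pi @* N| = #|N : E|.
  by rewrite card_morphim (setIidPr sNA) -(indexgI N ('ker pi)) capN_kerpi.
have N1 : pi @* N != 1.
  exact: (strongly_embedded_sylow_neq1 prp seM sylN).
have leN : #|pi @* N| <= p.
  apply: (@strongly_embedded_sylow_order _ _ _ p GA N (E / 'Phi(E))%G pi
           [morphism of q] M) => //.
  - by rewrite morphim_restrm setIid; apply: quotient_norms.
  - exact: Phi_quotient_abelem.
  - by rewrite card_quotient // rkN.
  move=> g Ag /=; rewrite /q /restrm.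
  have nPg := subsetP nPA g Ag.
  pose K := (GA :&: coset 'Phi(E) @*^-1 'C(E / 'Phi(E)))%G.
  have eK : (coset 'Phi(E) g \in 'C(E / 'Phi(E))) = (g \in K).
    by rewrite /K /= in_setI Ag morphpreE in_setI nPg inE.
  rewrite eK; apply/eqP/idP => [pig | Kg].
    have : g \in 'ker pi by apply/kerP.
    rewrite kerpi => /mulsgP[c e /setIP[Ac Cc] Ee ->].
    apply/setIP; split; first by rewrite groupM // (subsetP sEA).
    apply: groupM; rewrite mem_quotient_cent_pre //.
      rewrite (subsetP nPA) //=; have /commG1P-> : E \subset 'C(<[c]>).
        by rewrite centsC cycle_subG.
      exact: sub1G.
    rewrite (subsetP nPE) //= (subset_trans (commgS _ (_ : _ \subset E))) ?cycle_subG //.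
    by rewrite -quotient_cents2 //; apply: abelem_abelian (Phi_quotient_abelem pE).
  apply/kerP => //; apply: (subsetP (normal_p'elts_cent _ _ _) g Kg).
  - exact: subsetIl.
  - by rewrite normsI ?normG // norm_quotient_cent_pre.
  - move=> r /setIP[Ar]; rewrite mem_quotient_cent_pre // => /andP[nPr Cr] p'r.
    by apply: (coprime_Phi_cent pE) => //; apply: (subsetP nEA).
have pP : p.-group (pi @* N) := pHall_pgroup sylN.
have [_ /dvdn_leq h _] := pgroup_pdiv pP N1.
by apply/eqP; rewrite -oN eqn_leq leN h.
Qed.

(** Burnside's theorem reduces to [X / 'Phi(X)], which is elementary abelian and of order at most
    [p^3] by the rank bound. *)
Lemma invariant_p'elt_cent (X : {group gT}) r :
  X \subset E -> GA \subset 'N(X) -> GB \subset 'N(X) ->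
  r \in L -> p^'.-elt r -> r \in 'C(X).
Proof.
move=> sXE nXA nXB Lr p'r; pose D := 'Phi(X)%G.
have pX : p.-group X := pgroupS sXE pE.
have nDA : GA \subset 'N(D) by apply: char_norm_trans (Phi_char _) nXA.
have nDB : GB \subset 'N(D) by apply: char_norm_trans (Phi_char _) nXB.
have nDN := subset_trans sNA nDA; have nDL := subset_trans sLA nDA.
have nDE := subset_trans sEN nDN; have nDX := subset_trans sXE nDE.
have sDE : D \subset E := subset_trans (Phi_sub X) sXE.
have Ar := subsetP sLA r Lr.
have nDr := subsetP nDA r Ar.
have Cr : coset D r \in 'C(X / D).
  apply: (@p'elt_cent_abelem _ p (X / D)%G (N / D)%G (E / D)%G (GA / D)%G (GB / D)%G
           (L / D)%G) => //.
  - exact: quotient_pgroup.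
  - exact: quotientS.
  - by rewrite index_quotient_eq ?index_EN // subIset // sDE orbT.
  - exact: quotientS.
  - exact: quotientS.
  - exact: quotient_norms.
  - exact: quotient_norms.
  - exact: quotient_norms.
  - exact: quotient_norms.
  - apply: contra nEB; apply: quotient_norms_inv => //.
    by rewrite /normal sDE.
  - exact: Phi_quotient_abelem.
  - by rewrite card_quotient // rkN // (subset_trans sXE).
  - exact: quotientS.
  - move=> K sNK nKA; rewrite sub_quotient_pre //.
    apply: subset_trans (subsetIr GA _); apply: normal_closure_min.
      by rewrite subsetI sNA -sub_quotient_pre.
    rewrite /normal subsetIl normsI ?normG //.
    apply: subset_trans (morphpre_norms _ (normal_norm nKA)).
    by rewrite -sub_quotient_pre.
  - exact: mem_quotient.
  exact: morph_p_elt.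
apply: (coprime_Phi_cent pX) => //; first exact: (subsetP nXA).
have : r \in coset D @*^-1 'C(X / D) by rewrite mem_morphpre.
by rewrite mem_quotient_cent_pre // => /andP[].
Qed.

(** Otherwise [N = E K], so [N], and with it [L], acts trivially on [E] modulo [X 'Phi(E)]. A
    p'-element of [L] centralizes [X], hence acts trivially on [E / 'Phi(E)] and on [E], against
    [closure_p'elt]. *)
Lemma cent_quotient_invariant (X : {group gT}) :
  X \subset E -> GA \subset 'N(X) -> GB \subset 'N(X) ->
  N :&: coset X @*^-1 'C(E / X) \subset E.
Proof.
move=> sXE nXA nXB; pose K := (N :&: coset X @*^-1 'C(E / X))%G.
have nXN := subset_trans sNA nXA; have nXE := subset_trans sEN nXN.
apply/negPn/negP => nKE.
have iEN : prime #|N : E| by rewrite index_EN.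
have sJ : E <*> K \subset N by rewrite join_subG sEN subsetIl.
have [e|e] := prime_index_sandwich (joing_subl E K) sJ iEN.
  by case/negP: nKE; apply: subset_trans (joing_subr E K) _; rewrite e.
have nPA : GA \subset 'N('Phi(E)) by apply: char_norm_trans (Phi_char _) nEA.
have nPN := subset_trans sNA nPA; have nPE := subset_trans sEN nPN.
pose Y := (X <*> 'Phi(E))%G.
have nYA : GA \subset 'N(Y) by rewrite normsY.
have nYN := subset_trans sNA nYA; have nYE := subset_trans sEN nYN.
have cEN : [~: E, N] \subset Y.
  rewrite -quotient_cents2 // centsC -[N : {set gT}]e quotientY ?(subset_trans (subsetIl _ _)) //.
  rewrite join_subG; apply/andP; split; apply: quotient_cents2r.
    apply: subset_trans (joing_subr _ _); rewrite -quotient_cents2 //.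
    exact: abelem_abelian (Phi_quotient_abelem pE).
  apply: subset_trans (joing_subl _ _); rewrite commGC.
  rewrite -quotient_cents2 // ?(subset_trans (subsetIl _ _)) // centsC.
  have nXK : K \subset 'N(X) := subset_trans (subsetIl _ _) nXN.
  by rewrite sub_quotient_pre // subsetIr.
have cEL : [~: E, L] \subset Y := comm_closure sNA sLA normal_closure_min sEA nEA nYA cEN.
have [r Lr [p'r nCr]] := closure_p'elt.
have Ar := subsetP sLA r Lr.
case/negP: nCr; apply: (coprime_Phi_cent pE) => //; first exact: (subsetP nEA).
have s1 : [~: E, <[r]>] \subset Y.
  by apply: subset_trans cEL; apply: commgS; rewrite cycle_subG.
apply: (coprime_comm_step pE) s1 _ => //; first exact: (subsetP nEA).
have nXr := subsetP nXA r Ar; have nPr := subsetP nPA r Ar.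
rewrite /= norm_joinEr ?(subset_trans (Phi_sub _)) // commMG.
  rewrite mul_subG ?commg_subl ?cycle_subG //.
  have /commG1P-> : X \subset 'C(<[r]>); last exact: sub1G.
  by rewrite centsC cycle_subG; apply: invariant_p'elt_cent.
have /commG1P-> : X \subset 'C(<[r]>).
  by rewrite centsC cycle_subG; apply: invariant_p'elt_cent.
by rewrite norms1.
Qed.

(** Pushing up is applied modulo [T]: maximality of [T] leaves no non-trivial invariant subgroup in
    [E / T], and [cent_quotient_invariant] for [T] shows that [E / T] contains its centralizer in
    [N / T]. *)
Lemma core_abelem : p.-abelem (E / T).
Proof.
have nTN := subset_trans sNA nTA; have nTE := subset_trans sEN nTN.
apply: (@pushing_up _ p (N / T)%G (E / T)%G (GA / T)%G (GB / T)%G) => //.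
- exact: quotient_pgroup.
- exact: quotient_normal.
- by rewrite index_quotient_eq ?index_EN // subIset // sTE orbT.
- exact: quotient_norms.
- exact: quotient_norms.
- move=> X sX; have nsTN : T <| N by rewrite /normal sTN.
  have [Y eY sTY sYN] := inv_quotientS nsTN sX.
  have nTY := subset_trans sYN nTN.
  rewrite eY -(quotient_Phi (pgroupS sYN pN)) //.
  apply: leq_trans (rkN sYN).
  rewrite -(quotientYidr (subset_trans (Phi_sub Y) nTY)).
  rewrite index_quotient_eq //.
  - by apply: dvdn_leq => //; apply: indexgS; apply: joing_subl.
  - by rewrite subIset // joing_subr orbT.
  by rewrite join_subG Phi_sub.
- have := cent_quotient_invariant sTE nTA nTB.
  move=> s; apply/subsetP=> _ /setIP[/morphimP[x nTx Nx ->] Cx].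
  by apply: mem_quotient; apply: (subsetP s); rewrite inE Nx mem_morphpre.
move=> X sXE nXA nXB.
have nsTE : T <| E by rewrite /normal sTE.
have [Y eY sTY sYE] := inv_quotientS nsTE sXE.
have nsTY : T <| Y by rewrite (normalS _ sYE).
rewrite eY; apply/trivgP; rewrite quotient_sub1 ?normal_norm //.
have nYA : GA \subset 'N(Y) by apply: quotient_norms_inv nTA nsTY _; rewrite -eY.
have nYB : GB \subset 'N(Y) by apply: quotient_norms_inv nTB nsTY _; rewrite -eY.
exact: maxT.
Qed.

Let nTN : N \subset 'N(T) := subset_trans sNA nTA.
Let nTE : E \subset 'N(T) := subset_trans sEN nTN.

Lemma cent_core_sub : 'C_(N / T)(E / T) \subset E / T.
Proof.
apply/subsetP=> _ /setIP[/morphimP[x nTx Nx ->] Cx].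
apply: mem_quotient; apply: (subsetP (cent_quotient_invariant sTE nTA nTB)).
by rewrite inE Nx mem_morphpre.
Qed.

Lemma comm_EN_nsub_core : ~~ ([~: E, N] \subset T).
Proof.
apply/negP=> s; have := prime_gt1 prp; rewrite -index_EN ltnNge.
have /eqP-> : #|N : E| == 1%N; last by [].
rewrite indexg_eq1; apply: subset_trans (cent_quotient_invariant sTE nTA nTB).
by rewrite subsetI subxx -sub_quotient_pre // centsC quotient_cents2.
Qed.

(** If [|E : T| <= p], then [N] would centralize [E / T]. The upper bound is the rank bound, since
    ['Phi(E) <= T]. *)
Lemma index_core_pnat : exists2 k, #|E : T| = (p ^ k)%N & 2 <= k <= 3.
Proof.
have [k ek] := p_natP (pnat_dvd (dvdn_indexg E T) pE : p.-nat #|E : T|).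
exists k => //; apply/andP; split.
  rewrite ltnNge; apply: contra comm_EN_nsub_core => k1.
  apply: (comm_prime_order prp pN) => //.
  - exact: normal_norm.
  by rewrite ek -{2}(expn1 p) leq_exp2l // prime_gt1.
rewrite -(leq_exp2l _ _ (prime_gt1 prp)) -ek.
apply: leq_trans (rkN sEN); apply: dvdn_leq => //; apply: indexgS.
exact: Phi_min pE nTE core_abelem.
Qed.

(** [E1] is [E^g] for some [g] in [GB] moving [E]; as [g] normalizes [N] and [T], the properties of
    [E] carry over. *)
Lemma core_conj : exists E1 : {group gT},
  [/\ E1 <| N, E * E1 = N, #|E : E :&: E1| = p, T \subset E1 & p.-abelem (E1 / T)].
Proof.
have [g Bg] := subsetPn nEB; rewrite inE => nEg.
have nEg' : E :^ g != E by apply: contra nEg => /eqP->.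
have Ng : N :^ g = N by apply/normP; apply: subsetP nNB _ Bg.
have nTg := subsetP nTB g Bg; have Tg : T :^ g = T by apply/normP.
pose E1 := (E :^ g)%G; pose D := (E :&: E1)%G.
have iEN : prime #|N : E| by rewrite index_EN.
have sE1N : E1 \subset N by rewrite -Ng conjSg.
have nE1N : E1 <| N by rewrite /normal sE1N -Ng normJ conjSg normal_norm.
have nEE1 : E1 \subset 'N(E) := subset_trans sE1N (normal_norm nsEN).
have EE1 : E <*> E1 = N.
  have sJ : E <*> E1 \subset N by rewrite join_subG sEN.
  have [e|//] := prime_index_sandwich (joing_subl E E1) sJ iEN.
  case/eqP: nEg'; apply: conjsg_eq_of_sub.
  by apply: subset_trans (joing_subr E E1) _; rewrite e.
exists E1; split=> //.
- by rewrite -norm_joinEr.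
- apply/eqP; rewrite -(eqn_pmul2l (cardG_gt0 D)) Lagrange ?subsetIl //.
  have := mul_cardG E E1; rewrite -norm_joinEr // EE1.
  rewrite -(Lagrange sEN) index_EN cardJg -mulnA => /eqP.
  by rewrite eqn_pmul2l // mulnC => /eqP->.
- by rewrite -Tg conjSg.
by rewrite quotientJ // abelemJ core_abelem.
Qed.

Lemma comm_abelem_core (X : {group gT}) :
  X \subset 'N(T) -> p.-abelem (X / T) -> [~: X, X] \subset T.
Proof. by move=> nTX abX; rewrite -quotient_cents2 //; apply: abelem_abelian abX. Qed.

(** [D = E :&: E1] is centralized modulo [T] by both abelian groups [E / T] and [E1 / T], whose
    product is [N / T]. *)
Lemma core_hyperplane : exists D : {group gT},
  [/\ T \subset D, D \subset E, #|E : D| = p, [~: D, N] \subset T & D <| N].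
Proof.
have [E1 [nsE1N EE1 iD sTE1 abE1]] := core_conj.
have sE1N := normal_sub nsE1N; have nTE1 := subset_trans sE1N nTN.
exists (E :&: E1)%G; split; rewrite ?subsetIl ?subsetI ?sTE ?normalI //.
have nTD : E :&: E1 \subset 'N(T) by rewrite (subset_trans (subsetIl _ _)).
rewrite -quotient_cents2 // -EE1 quotientMl // centM subsetI !quotient_cents2 //.
rewrite (subset_trans _ (comm_abelem_core nTE core_abelem)) ?commSg ?subsetIl //.
by rewrite (subset_trans _ (comm_abelem_core nTE1 abE1)) ?commSg ?subsetIr.
Qed.

(** Write [x = e f] with [e] in [E] and [f] in [E1]. Modulo [T], [[f, e]] lies in both abelian
    groups and commutes with [e] and [f], so [(e f)^p] is [e^p f^p] times a power of [[f, e]] whose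
    exponent is divisible by [p]. *)
Lemma core_exponent x : x \in N -> x ^+ p \in T.
Proof.
have [E1 [nsE1N EE1 iD sTE1 abE1]] := core_conj.
have sE1N := normal_sub nsE1N; have nTE1 := subset_trans sE1N nTN.
rewrite -{1}EE1 => /mulsgP[e f Ee E1f ->{x}].
have nTe := subsetP nTE e Ee; have nTf := subsetP nTE1 f E1f.
have Ce : coset T e \in E / T by apply: mem_quotient.
have Cf : coset T f \in E1 / T by apply: mem_quotient.
set z := [~ coset T f, coset T e].
have sR : [~: E1, E] \subset E by rewrite commg_subr (subset_trans sE1N) ?normal_norm.
have sR1 : [~: E1, E] \subset E1 by rewrite commg_subl (subset_trans sEN) ?normal_norm.
have zE : z \in E / T.
  by rewrite /z -morphR //; apply/mem_quotient/(subsetP sR)/mem_commg.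
have zE1 : z \in E1 / T.
  by rewrite /z -morphR //; apply/mem_quotient/(subsetP sR1)/mem_commg.
apply: coset_idr; first by rewrite groupX // groupM.
rewrite morphX ?groupM // morphM // expMg_Rmul.
- have [_ xE] := abelemP prp core_abelem; have [_ xE1] := abelemP prp abE1.
  rewrite (xE _ Ce) (xE1 _ Cf) !mul1g -/z.
  have /dvdnP[k ->] : p %| 'C(p, 2) by rewrite prime_dvd_bin //= odd_prime_gt2.
  by rewrite mulnC expgM xE // expg1n.
- by apply: (centsP (abelem_abelian abE1)).
by apply: (centsP (abelem_abelian core_abelem)).
Qed.

(** Modulo [T], [N] is generated by the abelian group [E] and one element [y], which centralizes the
    hyperplane [D] and moves some [b]; take [w = [b, y]]. The fixed points are then exactly
    [D / T]. *)
Lemma comm_core_line : exists w : coset_of T,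
  [/\ w \in E / T, w != 1, [~: E / T, N / T] = <[w]>, N / T \subset 'C[w]
    & #|E / T : 'C_(E / T)(N / T)| = p].
Proof.
have [D [sTD sDE iD cDN nsDN]] := core_hyperplane.
have sDN := subset_trans sDE sEN; have nTD := subset_trans sDN nTN.
have cEE : abelian (E / T) := abelem_abelian core_abelem.
have cDNb : N / T \subset 'C(D / T) by rewrite centsC quotient_cents2.
have iDb : #|E / T : D / T| = p.
  by rewrite index_quotient_eq ?iD // subIset // sTD orbT.
have priD : prime #|E / T : D / T| by rewrite iDb.
have [x Nx nEx] : exists2 x, x \in N & x \notin E.
  apply/subsetPn/negP=> s; have := prime_gt1 prp; rewrite -index_EN.
  by move: s; rewrite -indexg_eq1 => /eqP->.
pose y := coset T x; have Ny : y \in N / T by apply: mem_quotient.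
have nTx := subsetP nTN x Nx.
have [b Eb nby] : exists2 b, b \in E / T & b ^ y != b.
  apply/exists_inP; apply: contraR nEx; rewrite negb_exists_in => /forall_inP c.
  have Cy : y \in 'C(E / T).
    by apply/centP=> z Ez; apply/esym/commgP/conjg_fixP/eqP; have := c z Ez; rewrite negbK.
  have Ey : y \in E / T by apply: (subsetP cent_core_sub); rewrite inE Ny.
  have nsTE : T <| E by rewrite /normal sTE.
  by rewrite -(quotientGK nsTE) mem_morphpre.
have nEN : N / T \subset 'N(E / T) by apply: quotient_norms; apply: normal_norm.
have sRD : [~: E / T, N / T] \subset D / T.
  apply: (comm_prime_order prp (quotient_pgroup T pN)); rewrite ?quotientS ?iDb //.
  by apply: quotient_norms; apply: normal_norm.
pose w := [~ b, y].
have Rw : w \in [~: E / T, N / T] by apply: mem_commg.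
have Dw := subsetP sRD w Rw; have Ew := subsetP (quotientS T sDE) w Dw.
have cNw : N / T \subset 'C[w].
  by apply: subset_trans cDNb _; rewrite -cent_cycle centS // cycle_subG.
exists w; split=> //.
- by apply: contra nby => e; apply/eqP/conjg_fixP.
- apply/eqP; rewrite eqEsubset cycle_subG Rw andbT.
  have nwN : N / T \subset 'N(<[w]>).
    by apply: subset_trans (cent_sub _); rewrite cent_cycle.
  have nwE := subset_trans (quotientS T sEN) nwN.
  have eN : (E / T) <*> <[y]> = N / T.
    have sJ : (E / T) <*> <[y]> \subset N / T by rewrite join_subG quotientS ?cycle_subG.
    have iENb : prime #|N / T : E / T|.
      by rewrite index_quotient_eq ?index_EN // subIset // sTE orbT.
    have [e|//] := prime_index_sandwich (joing_subl (E / T) <[y]>) sJ iENb.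
    case/negP: nby; apply/eqP/conjg_fixP/commgP; apply: (centsP cEE) => //.
    by rewrite -[E / T]e -cycle_subG joing_subr.
  have nwy : <[y]> \subset 'N(<[w]>) by rewrite cycle_subG (subsetP nwN).
  rewrite -quotient_cents2 // centsC -eN quotientY // join_subG quotient_cents //=.
  rewrite centsC quotient_cents2 //.
  apply: (comm_hyperplane cEE (quotientS T sDE)) => //.
    exact: (subsetP cDNb).
  exact: (subsetP cNw).
have sDC : D / T \subset 'C_(E / T)(N / T) by rewrite subsetI quotientS // centsC.
have [-> //|e] := prime_index_sandwich sDC (subsetIl _ _) priD.
case/negP: nby; apply/eqP/conjg_fixP/commgP.
have : b \in 'C_(E / T)(N / T) by rewrite e.
by case/setIP=> _ /centP/(_ y Ny).
Qed.

(* With [W = [E, N] T], the p'-elements of [<<N, N^a>>] act trivially on E/W, W/T and T,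
   so the image of this group under [pi] is a [p]-group. *)
Lemma transvection_conj a : a \in GA ->
  [~: E / T, N / T] \subset 'C(N :^ a / T) -> (pi @* N) :^ pi a = pi @* N.
Proof.
move=> Aa cEN; have [w [Ew w1 eR cNw _]] := comm_core_line.
have sNaA : N :^ a \subset GA by rewrite -(conjGid Aa) conjSg.
pose W := ([~: E, N] <*> T)%G; pose J := (N <*> N :^ a)%G.
have sRE : [~: E, N] \subset E by rewrite commg_subl normal_norm.
have sWE : W \subset E by rewrite join_subG sRE.
have sJA : J \subset GA by rewrite join_subG sNA.
have sJL : J \subset L.
  rewrite join_subG sub_normal_closure -(normP (subsetP normal_closure_norm a Aa)).
  by rewrite conjSg sub_normal_closure.
have nTJ := subset_trans sJA nTA; have nEJ := subset_trans sJA nEA.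
have nTW := subset_trans sWE nTE.
have cWJ : [~: W, J] \subset T.
  rewrite -quotient_cents2 // quotientYidr ?(subset_trans sRE) // quotientR //.
  have nTNa := subset_trans sNaA nTA.
  rewrite quotientY // centY subsetI cEN andbT eR.
  by rewrite centsC cent_cycle.
have nWJ : J \subset 'N(W).
  rewrite -commg_subl; apply: subset_trans cWJ _; exact: joing_subr.
pose C := (J :&: coset W @*^-1 'C(E / W))%G.
have nWE : E \subset 'N(W).
  by apply: subset_trans nWJ; apply: subset_trans sEN _; apply: joing_subl.
have nJC : J \subset 'N(C).
  by rewrite normsI ?normG // norm_quotient_cent_pre.
have nWN := subset_trans (joing_subl N (N :^ a)) nWJ.
(* [N] acts trivially on [E / W], so [J / C] is the image of [N^a] alone. *)
have pJC : p.-group (J / C).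
  apply: pquotient_joing => //; last by rewrite pgroupJ.
  rewrite subsetI joing_subl -sub_quotient_pre // centsC quotient_cents2 //.
  exact: joing_subl.
have pJ : p.-group (pi @* J).
  apply: (morphim_pgroup_p'elt sJA) => r Jr p'r.
  have Ar := subsetP sJA r Jr; have Lr := subsetP sJL r Jr.
  have nEr := subsetP nEA r Ar.
  apply: pi_cent => //; rewrite -cycle_subG centsC; apply/commG1P/trivgP.
  have sJr (X Y : {set gT}) : [~: X, J] \subset Y -> [~: X, <[r]>] \subset Y.
    by apply: subset_trans; apply: commgS; rewrite cycle_subG.
  have /setIP[_] := p'elt_sub_of_pquotient nJC pJC Jr p'r.
  rewrite mem_quotient_cent_pre // => /andP[_ s1].
  have s2 := coprime_comm_step pE nEr p'r s1 (sJr _ _ cWJ).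
  apply: (coprime_comm_step pE nEr p'r s2).
  have /commG1P-> // : T \subset 'C(<[r]>).
  by rewrite centsC cycle_subG invariant_p'elt_cent.
have eJ : pi @* J = pi @* N.
  apply: (sub_pHall sylN pJ); first by rewrite morphimS ?joing_subl.
  by rewrite morphimS.
apply: (@conjsg_eq_of_sub _ (pi @* N)%G); rewrite /= -morphimJ // -eJ.
by rewrite morphimS // joing_subr.
Qed.

Let Nb := (N / T)%G.
Let Eb := (E / T)%G.

(** The hypothesis gives [L <= 'ker pi * L0], where ['ker pi = 'C_GA(E) * E] and [E <= L0]. Thus [L]
    and [L0] induce the same automorphisms of [E]. *)
Lemma closure_factor (L0 : {group gT}) :
  E \subset L0 -> L0 \subset L ->
  (forall a, a \in GA -> pi @* (N :^ a) \subset pi @* L0) ->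
  forall l, l \in L -> exists c l0, [/\ c \in GA, c \in 'C(E), l0 \in L0 & l = c * l0].
Proof.
move=> sEL0 sL0L hN l Ll; have sL0A := subset_trans sL0L sLA.
have sLp : L \subset pi @*^-1 (pi @* L0).
  rewrite gen_subG class_supportEr; apply/bigcupsP=> a Aa.
  by rewrite -sub_morphim_pre ?hN // -(conjGid Aa) conjSg.
have := subsetP sLp l Ll; rewrite morphimK // kerpi => /mulsgP[_ f /mulsgP[c e Cc Ee ->] L0f ->].
exists c, (e * f); case/setIP: Cc => Ac Cc; split=> //; last by rewrite mulgA.
by rewrite groupM // (subsetP sEL0).
Qed.

(** [Y] is spanned by [v = w^a], for an [a] moving the Sylow subgroup [pi @* N], and by [u = [v, x]]
    with [x] in [N], a generator of the line of [w]. [N] fixes [u] and [N^a] fixes [v], so [x] and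
    [y] are opposite transvections. *)
Lemma core_transvection_pair : exists (Y G : {group coset_of T}) (u v x y : coset_of T) (a : gT),
  [/\ [/\ a \in GA, G :=: (N <*> N :^ a) / T & Y :=: ([~: E, L] <*> T) / T ],
      [/\ p.-abelem Y, #|Y| = (p ^ 2)%N, u \in Y, v \in Y & u != 1],
      [/\ v \notin <[u]>, L / T \subset 'N(Y), x \in G & y \in G],
      [/\ u ^ x = u, v ^ x = v * u, v ^ y = v, u ^ y != u & [~ u, y] \in <[v]>]
    & forall l, l \in L -> exists c l0,
        [/\ c \in GA, c \in 'C(E), l0 \in N <*> N :^ a & l = c * l0]].
Proof.
have [w [Ew w1 eR cNw iC]] := comm_core_line.
have cEE : abelian Eb := abelem_abelian core_abelem.
have [a Aa na] : exists2 a, a \in GA & (pi @* N) :^ pi a != pi @* N.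
  apply/exists_inP; have := strongly_embedded_sylow_neq1 prp seM sylN.
  apply: contraR; rewrite negb_exists_in => /forall_inP h.
  apply/eqP; apply: (strongly_embedded_normal_pgroup prp seM (pHall_pgroup sylN)).
  rewrite /normal morphimS //; apply/subsetP=> _ /morphimP[g _ Ag ->].
  by rewrite inE; have := h g Ag; rewrite negbK => /eqP->.
have nTa := subsetP nTA a Aa.
have sNaA : N :^ a \subset GA by rewrite -(conjGid Aa) conjSg.
have nTNa := subset_trans sNaA nTA.
have Ea : Eb :^ coset T a = Eb by rewrite /= -quotientJ // (normP (subsetP nEA a Aa)).
have eNa : N :^ a / T = Nb :^ coset T a by rewrite quotientJ.
have trans b : b \in GA -> N :^ b / T \subset 'C[w] -> (pi @* N) :^ pi b = pi @* N.
  by move=> Ab c; apply: transvection_conj => //; rewrite eR centsC cent_cycle.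
pose v := w ^ coset T a.
have Rv : [~: Eb, Nb :^ coset T a] = <[v]> by rewrite -{1}Ea -conjsRg eR cycleJ.
have Ev : v \in Eb by rewrite -Ea memJ_conjg.
(* If [N] fixed [v = w^a], then [N^(a^-1)] would fix [w], and [pi a] would normalize [pi @* N]. *)
have [x Nx vx] : exists2 x, x \in Nb & v ^ x != v.
  apply/exists_inP; apply: contraR na; rewrite negb_exists_in => /forall_inP h.
  have Aa' : a^-1 \in GA by rewrite groupV.
  suff e : (pi @* N) :^ pi a^-1 = pi @* N by rewrite -{1}e morphV // conjsgKV.
  apply: trans => //.
  rewrite quotientJ ?groupV // -(conjSg _ _ (coset T a)) morphV // conjsgKV -cent1J.
  apply/subsetP=> x Nx; apply/cent1P/commute_sym/commgP/conjg_fixP/eqP.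
  by have := h x Nx; rewrite negbK.
pose u := [~ v, x].
have u1 : u != 1 by apply: contra vx => e; apply/eqP/conjg_fixP.
have Ru : u \in <[w]> by rewrite -eR mem_commg.
have Eu : u \in Eb.
  by case/cycleP: Ru => i ->; rewrite groupX.
have ow : #[w] = p by apply: abelem_order_p core_abelem Ew w1.
have ou : #[u] = p by apply: abelem_order_p core_abelem Eu u1.
have euw : <[u]> = <[w]> by apply/eqP; rewrite eqEcard cycle_subG Ru -!orderE ow ou /=.
have cNu : Nb \subset 'C[u] by rewrite -cent_cycle euw cent_cycle.
have nuv : v \notin <[u]>.
  apply: contra vx; rewrite euw => /cycleP[i ->]; apply/eqP/conjg_fixP/commgP.
  by apply/commute_sym/commuteX/cent1P/(subsetP cNw).
have [y Ny uy] : exists2 y, y \in Nb :^ coset T a & u ^ y != u.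
  apply/exists_inP; apply: contraR na; rewrite negb_exists_in => /forall_inP h.
  apply/eqP/trans => //; rewrite eNa -cent_cycle -euw cent_cycle.
  apply/subsetP=> y Ny; apply/cent1P/commute_sym/commgP/conjg_fixP/eqP.
  by have := h y Ny; rewrite negbK.
have uyv : [~ u, y] \in <[v]> by rewrite -Rv mem_commg.
have vy : v ^ y = v.
  apply/conjg_fixP/commgP/commute_sym/cent1P.
  by apply: (subsetP _ _ Ny); rewrite cent1J conjSg.
have cuv : <[v]> \subset 'C(<[u]>).
  rewrite cent_cycle cycle_subG; apply/cent1P.
  by apply: (centsP cEE).
pose Y := (<[u]> <*> <[v]>)%G.
have sYE : Y \subset Eb by rewrite join_subG !cycle_subG Eu.
have abY : p.-abelem Y := abelemS sYE core_abelem.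
have Yu : u \in Y by rewrite -cycle_subG joing_subl.
have Yv : v \in Y by rewrite -cycle_subG joing_subr.
have ov : #[v] = p by rewrite orderJ.
have oY : #|Y| = (p ^ 2)%N.
  rewrite /= cent_joinEr // TI_cardMg -?orderE ?ou ?ov ?mulnn //.
  rewrite setIC; apply: prime_TIg; first by rewrite -orderE ov.
  by rewrite cycle_subG.
have cYN : [~: Eb, Nb] \subset Y by rewrite eR -euw joing_subl.
have cYNa : [~: Eb, Nb :^ coset T a] \subset Y by rewrite Rv joing_subr.
have nYN : Nb \subset 'N(Y).
  by rewrite -commg_subl; apply: subset_trans cYN; apply: commSg.
have nYNa : Nb :^ coset T a \subset 'N(Y).
  by rewrite -commg_subl; apply: subset_trans cYNa; apply: commSg.
pose L0 := (N <*> N :^ a)%G.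
have eG : L0 / T = Nb <*> (Nb :^ coset T a) by rewrite quotientY // eNa.
pose G := (L0 / T)%G.
have nYG : G \subset 'N(Y) by rewrite /= eG join_subG nYN.
have Gx : x \in G by rewrite /= eG; apply: (subsetP (joing_subl _ _)).
have Gy : y \in G by rewrite /= eG; apply: (subsetP (joing_subr _ _)).
have ux : u ^ x = u by apply/conjg_fixP/commgP/commute_sym/cent1P/(subsetP cNu).
have vxu : v ^ x = v * u by rewrite /u mulKVg.
have sL0L : L0 \subset L.
  rewrite join_subG sub_normal_closure -(normP (subsetP normal_closure_norm a Aa)).
  by rewrite conjSg sub_normal_closure.
have sEL0 : E \subset L0 := subset_trans sEN (joing_subl _ _).
(* The fixed points of [N^b] form a hyperplane, which meets the plane [Y] in some [z] other than 1.
   Transitivity gives [g] in [L0] with [u^g = z]; then [N^(b g^-1)] fixes [u], so [b g^-1]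
   normalizes [pi @* N] by [transvection_conj], and [N^b] has the same image as [N^g]. *)
have sylow_in b : b \in GA -> pi @* (N :^ b) \subset pi @* L0.
  move=> Ab; have nTb := subsetP nTA b Ab.
  have Eb' : Eb :^ coset T b = Eb by rewrite /= -quotientJ // (normP (subsetP nEA b Ab)).
  pose C := 'C_Eb(Nb :^ coset T b)%G.
  have iCb : #|Eb : C| = p.
    by rewrite -iC /C /= -{1 2}Eb' centJ -conjIg indexJg.
  have [z /setIP[Cz Yz] z1] : exists2 z, z \in C :&: Y & z != 1.
    apply/trivgPn/negP => /eqP ti.
    have := subset_leq_card (mul_subG (subsetIl _ _ : C \subset Eb) sYE).
    rewrite (TI_cardMg ti) -(Lagrange (subsetIl _ _ : C \subset Eb)) iCb oY.
    by rewrite leq_pmul2l // leqNgt -{1}(expn1 p) ltn_exp2l // prime_gt1.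
  have [g' Gg' ug] := transvection_pair_trans prp abY oY Yu Yv u1 nuv nYG Gx Gy ux vxu vy uy uyv Yz z1.
  have [g nTg L0g eg] := morphimP Gg'.
  have Lg := subsetP sL0L g L0g; have Ag := subsetP sLA g Lg.
  have Abg : b * g^-1 \in GA by rewrite groupM ?groupV.
  have := trans _ Abg; rewrite morphM ?groupV // morphV // conjsgM => h.
  rewrite morphimJ // -(conjSg _ _ (pi g)^-1) h.
    rewrite -[pi @* L0](conjGid (_ : pi g \in _)) ?mem_morphim // conjsgK.
    by rewrite morphimS // joing_subl.
  rewrite conjsgM quotientJ ?groupV // quotientJ // morphV // sub_conjgV.
  rewrite -cent_cycle -euw cent_cycle -cent1J -eg ug -cent_cycle centsC cycle_subG.
  by case/setIP: Cz.
have fac := closure_factor sEL0 sL0L sylow_in.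
have nYE : Eb \subset 'N(Y).
  by apply: subset_trans nYG; rewrite /= eG; apply: subset_trans (joing_subl _ _); apply: quotientS.
have cYG : [~: Eb, G] \subset Y.
  rewrite -quotient_cents2 // [gval G]eG quotientY // centY subsetI.
  by rewrite !quotient_cents2 // cYN.
have facb l : l \in L / T -> exists c l0,
    [/\ c \in 'C(Eb), l0 \in G & l = c * l0].
  case/morphimP=> k nTk Lk ->; have [c [l0 [Ac Cc L0l ->]]] := fac k Lk.
  have nTl : l0 \in 'N(T) by apply: (subsetP nTA); apply: (subsetP sLA); apply: (subsetP sL0L).
  have nTc := subsetP nTA c Ac.
  exists (coset T c), (coset T l0); split; last by rewrite morphM.
    by apply: (subsetP (quotient_cent _ _)); apply: mem_quotient.
  exact: mem_quotient.
have eY : Y :=: ([~: E, L] <*> T) / T.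
  have nTL := subset_trans sLA nTA.
  have sREL : [~: E, L] \subset 'N(T).
    by apply: subset_trans nTE; rewrite commg_subl (subset_trans sLA).
  rewrite quotientYidr // quotientR //; apply/eqP; rewrite eqEsubset; apply/andP; split.
    rewrite join_subG !cycle_subG; apply/andP; split.
      apply: (subsetP (commgS Eb (quotientS T sub_normal_closure)) u).
      by rewrite eR -euw cycle_id.
    have sNaL : Nb :^ coset T a \subset L / T.
      by rewrite -eNa quotientS // (subset_trans _ sL0L) ?joing_subr.
    apply: (subsetP (commgS Eb sNaL) v).
    by rewrite Rv cycle_id.
  rewrite gen_subG; apply/subsetP=> _ /imset2P[e l Ee Ll ->].
  have [c [l0 [Cc Gl ->]]] := facb l Ll.
  rewrite commgMJ (_ : [~ e, c] = 1) ?conj1g ?mulg1.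
    by apply: (subsetP cYG); apply: mem_commg.
  by apply/eqP/commgP/commute_sym/(centP Cc).
have nYL : L / T \subset 'N(Y).
  apply/subsetP=> l Ll; have [c [l0 [Cc Gl ->]]] := facb l Ll.
  apply: groupM; last exact: (subsetP nYG).
  exact: (subsetP (cent_sub Y) c (subsetP (centS sYE) c Cc)).
exists Y, G, u, v, x, y, a.
by split.
Qed.

Definition core_module := ([~: E, L] <*> T)%G.
Local Notation V := core_module.

Lemma core_module_norm : GA \subset 'N(V).
Proof. by rewrite normsY // normsR // normal_closure_norm. Qed.

Lemma core_module_sub : V \subset E.
Proof. by rewrite join_subG sTE andbT commg_subl (subset_trans sLA). Qed.

(** The p'-elements of the kernel act trivially on [E / V], on [V / T] and on [T]. *)
Lemma core_module_kernel g : g \in L -> coset T g \in 'C(V / T) -> pi g = 1.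
Proof.
move=> Lg Cg; have Ag := subsetP sLA g Lg.
have nTV := subset_trans core_module_sub nTE.
pose K := (L :&: coset T @*^-1 'C(V / T))%G.
have Kg : g \in K by rewrite inE Lg mem_morphpre ?(subsetP nTA).
have sKA : K \subset GA := subset_trans (subsetIl _ _) sLA.
suff: g \in 'ker pi by move/mker.
apply: (subsetP (normal_p'elts_cent sKA _ _)) Kg.
  rewrite normsI ?normal_closure_norm // norm_quotient_cent_pre //.
  exact: core_module_norm.
move=> r /setIP[Lr]; rewrite mem_quotient_cent_pre // => /andP[_ s2] p'r.
have nEr := subsetP nEA r (subsetP sLA r Lr).
rewrite -cycle_subG centsC; apply/commG1P/trivgP.
have s1 : [~: E, <[r]>] \subset V.
  apply: subset_trans (joing_subl _ _); apply: commgS; by rewrite cycle_subG.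
have s3 := coprime_comm_step pE nEr p'r s1 s2.
apply: (coprime_comm_step pE nEr p'r s3).
have /commG1P-> // : T \subset 'C(<[r]>).
by rewrite centsC cycle_subG invariant_p'elt_cent.
Qed.

Lemma core_natural_module :
  exists (psi : gT -> 'rV['F_p]_2) (rho : gT -> 'M['F_p]_2),
  [/\ {in V &, {morph psi : x y / x * y >-> (x + y)%R}},
      {in V, forall x, (psi x == 0%R) = (x \in T)},
      [set psi x | x in V] = [set: 'rV['F_p]_2] &
  [/\ {in L &, {morph rho : g h / g * h >-> (g *m h)%R}},
      {in L, forall g, (rho g == 1%:M%R) = (pi g == 1)},
      [set rho g | g in L] = [set A : 'M['F_p]_2 | (\det A == 1)%R] &
      {in L & V, forall g x, psi (x ^ g) = (psi x *m rho g)%R}]].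
Proof.
have [Y [G [u [v [x [y [a [[Aa eG eY] [abY oY Yu Yv u1] [nuv nYL Gx Gy]]]]]]]]] :=
  core_transvection_pair.
move=> [ux vx vy uy uyv] fac.
have nTL := subset_trans sLA nTA.
have nTV := subset_trans core_module_sub nTE.
have sGL : G \subset L / T.
  rewrite eG quotientS // join_subG sub_normal_closure.
  by rewrite -(normP (subsetP normal_closure_norm a Aa)) conjSg sub_normal_closure.
have nYG := subset_trans sGL nYL.
have VY z : z \in V -> coset T z \in Y by move=> Vz; rewrite eY; apply: mem_quotient.
have LY g : g \in L -> coset T g \in 'N(Y).
  by move=> Lg; apply: (subsetP nYL); apply: mem_quotient.
pose psi z := coords p u v (coset T z).
pose rho g := coords_mx p u v (coset T g).
have rhoM : {in L &, {morph rho : g h / g * h >-> (g *m h)%R}}.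
  move=> g h Lg Lh; rewrite /rho morphM ?(subsetP nTL) //.
  by rewrite (coords_mxM prp abY oY) ?LY.
have rho1 : rho 1 = 1%:M%R by rewrite /rho morph1 (coords_mx_cent prp abY oY).
have rhoX g n : g \in L -> rho (g ^+ n) = (rho g ^+ n)%R.
  move=> Lg; elim: n => [|n IHn]; first by rewrite expg0 rho1.
  by rewrite expgS rhoM ?groupX // IHn GRing.exprS.
(* [L] is generated by conjugates of the p-group [N], and an element of p-power order in the
   multiplicative group of ['F_p] is 1. *)
have detL g : g \in L -> (\det (rho g) = 1)%R.
  pose K := [set g in L | (\det (rho g) == 1)%R].
  have gK : group_set K.
    apply/group_setP; split; first by rewrite inE group1 rho1 det1 eqxx.
    move=> g1 g2; rewrite !inE => /andP[L1 /eqP d1] /andP[L2 /eqP d2].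
    by rewrite groupM // rhoM // det_mulmx d1 d2 GRing.mul1r eqxx.
  have sLK : L \subset Group gK.
    rewrite gen_subG class_supportEr; apply/bigcupsP=> b Ab; apply/subsetP=> h Nh.
    have Lh : h \in L.
      rewrite -(normP (subsetP normal_closure_norm b Ab)).
      by apply: subsetP Nh; rewrite conjSg sub_normal_closure.
    rewrite inE Lh; apply/eqP.
    have ph : p.-elt h by apply: mem_p_elt Nh; rewrite pgroupJ.
    have [k ok] := p_natP ph.
    apply: (@Fp_pelt_eq1 p _ k) => //.
    have := rhoX h #[h] Lh; rewrite expg_order rho1 ok => /(congr1 (fun A => \det A)%R).
    by rewrite det1 => e; rewrite [RHS]e;
      elim: (p ^ k)%N => [|n IHn]; rewrite ?GRing.expr0 ?det1 // !GRing.exprS IHn -det_mulmx.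
  by move=> Lg; have := subsetP sLK g Lg; rewrite inE => /andP[_ /eqP].
exists psi, rho; split; last split=> //.
- move=> z1 z2 V1 V2; rewrite /psi morphM ?(subsetP nTV) //.
  by rewrite (coordsM prp abY oY) ?VY.
- move=> z Vz; rewrite /psi (coords_eq0 prp abY oY) ?VY //.
  apply/eqP/idP => [|Tz]; last exact: coset_id.
  by apply: coset_idr; apply: (subsetP nTV).
- apply/setP=> z; rewrite inE; apply/imsetP.
  have : of_coords u v z \in Y by apply: of_coords_mem.
  rewrite eY => /morphimP[t nTt Vt et]; exists t => //.
  by rewrite /psi -et (coordsK prp abY Yu Yv u1 nuv).
- move=> g Lg; apply/eqP/eqP => [e|pg].
    apply: core_module_kernel => //; rewrite -eY.
    by apply: (coords_mx_eq1 prp abY oY Yu Yv u1 nuv) => //; apply: LY.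
  apply: (coords_mx_cent prp abY oY) => //.
  have : g \in 'ker pi by apply/kerP => //; apply: (subsetP sLA).
  rewrite kerpi => /mulsgP[c e /setIP[Ac Cc] Ee ->].
  have Ae := subsetP sEA e Ee.
  rewrite (morphM _ (subsetP nTA c Ac) (subsetP nTA e Ae)); apply: groupM.
    apply: (subsetP (centS (_ : Y \subset E / T))).
      by rewrite eY quotientS // core_module_sub.
    by apply: (subsetP (quotient_cent _ _)); apply: mem_quotient.
  apply: (subsetP (centS (_ : Y \subset E / T))).
    by rewrite eY quotientS // core_module_sub.
  by apply: (subsetP (abelem_abelian core_abelem)); apply: mem_quotient.
- apply/setP=> A; rewrite inE; apply/imsetP/eqP => [[g Lg ->]|dA]; first exact: detL.
  have [g Gg <-] := transvection_pair_SL2 prp abY oY Yu Yv u1 nuv nYG Gx Gy ux vx vy uy uyv dA.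
  have /morphimP[h nTh Lh ->] := subsetP sGL g Gg.
  by exists h.
move=> g z Lg Vz; rewrite /psi /rho morphJ ?(subsetP nTV z Vz) ?(subsetP nTL g Lg) //.
by rewrite (coordsJ prp abY oY) ?VY ?LY.
Qed.

Lemma core_module_index : #|V : T| = (p ^ 2)%N.
Proof.
have [Y [G [u [v [x [y [a [[_ _ eY] [_ oY _ _ _] _ _ _]]]]]]]] := core_transvection_pair.
by rewrite -card_quotient ?(subset_trans core_module_sub) // -oY eY.
Qed.

Lemma core_module_inverting : exists2 t, t \in L &
  p^'.-elt t /\ {in V, forall x, x ^ t * x \in T}.
Proof.
have [psi [rho [psiM psi0 _ [rhoM rho1 rhoL psiJ]]]] := core_natural_module.
have : (-1)%:M%R \in [set A : 'M['F_p]_2 | (\det A == 1)%R].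
  by rewrite inE det_scalar GRing.sqrrN GRing.expr1n.
rewrite -rhoL => /imsetP[l Ll el].
have rl1 : rho 1 = 1%:M%R by apply/eqP; rewrite rho1 ?morph1.
have rX n : rho (l ^+ n) = ((-1) ^+ n)%:M%R.
  elim: n => [|n IHn]; first by rewrite expg0 rl1 GRing.expr0.
  by rewrite expgS rhoM ?groupX // IHn -el -scalar_mxM GRing.exprS.
(* Raising [l], which acts as -1, to the p-part of its order gives a p'-element; that exponent is
   odd, so the action is still -1. *)
exists (l ^+ #[l]`_p); first exact: groupX.
split.
  rewrite /p_elt orderXdiv ?dvdn_part //.
  by rewrite -{1}(partnC p (order_gt0 l)) mulKn ?part_gt0 // part_pnat.
move=> x Vx; set t := l ^+ _.
have Lt : t \in L by apply: groupX.
have Vxt : x ^ t \in V.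
  by rewrite memJ_norm // (subsetP core_module_norm) // (subsetP sLA).
rewrite -psi0; last exact: groupM.
rewrite psiM // psiJ // rX -signr_odd.
have [k ->] : exists k, (#[l]`_p)%N = (p ^ k)%N by exists (logn p #[l]); rewrite p_part.
by rewrite oddX oddp orbT GRing.expr1 mul_mx_scalar GRing.scaleN1r GRing.addNr.
Qed.

(* With [t] inverting [V / T], set [V0 = [V, t]].  The three subgroup lemma shows
   that [V0] centralizes [T], and then [V = V0 T] with [V0 :&: T = [V0, V0]]. *)
Lemma core_module_center : [/\ abelian T, T \subset 'Z(V), #|[~: V, V]| <= p
  & cyclic (T / [~: V, V])].
Proof.
have [t Lt [p't tV]] := core_module_inverting.
have At := subsetP sLA t Lt.
have Ct : t \in 'C(T) by apply: invariant_p'elt_cent.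
have nVt : <[t]> \subset 'N(V) by rewrite cycle_subG (subsetP core_module_norm).
have sVE := core_module_sub; have sTV : T \subset V := joing_subr _ _.
have pV : p.-group V := pgroupS sVE pE; have nTV := subset_trans sVE nTE.
pose V0 := [~: V, <[t]>]%G.
have sV0V : V0 \subset V by rewrite commg_subl.
have pV0 : p.-group V0 := pgroupS sV0V pV; have nTV0 := subset_trans sV0V nTV.
have xpT x : x \in V -> x ^+ p \in T.
  by move=> Vx; apply: core_exponent; apply: (subsetP (subset_trans sVE sEN)).
have eV : V0 * T = V.
  rewrite (normC nTV0) -norm_joinEr //.
  apply/eqP; rewrite eqEsubset join_subG sV0V sTV /=; apply/subsetP=> x Vx.
  (* [[x, t] x^2] is a conjugate of [x^t x], an element of [T]. As [x^p] also lies in [T] and [p] is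
     odd, [x] itself is recovered from [x^2]. *)
  have x2 : x * x \in T <*> V0.
    rewrite -(mulKg [~ x, t] (x * x)) groupM //.
      by rewrite groupV (subsetP (joing_subr _ _)) // mem_commg // cycle_id.
    have -> : [~ x, t] * (x * x) = (x ^ t * x) ^ x.
      by rewrite commgEl [RHS]conjgE !mulgA.
    by rewrite (subsetP (joing_subl _ _)) // memJ_norm ?tV // (subsetP nTV).
  have -> : x = (x * x) ^+ (p.+1)./2 * (x ^+ p)^-1.
    have e2 : (2 * (p.+1)./2 = p.+1)%N by rewrite mul2n even_halfK //= oddp.
    by rewrite -[x * x]/(x ^+ 2) -expgM e2 expgS mulgK.
  by rewrite groupM ?groupX // groupV (subsetP (joing_subl _ _)) ?xpT.
have cTV0 : V0 \subset 'C(T).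
  apply/commG1P; apply: (three_subgroup (G := <[t]>) (H := T)).
    have -> : [~: <[t]>, T] = 1 by apply/commG1P; rewrite cycle_subG.
    exact: comm1G.
  have s1 : [~: T, V] \subset T by rewrite commg_subl.
  apply/trivgP; apply: subset_trans (commSg _ s1) _.
  by rewrite commGC; apply/trivgP/commG1P; rewrite cycle_subG.
pose D := [~: V0, V0]%G.
have sDT : D \subset T.
  apply: subset_trans (commgSS sV0V sV0V) _.
  apply: subset_trans (commgSS sVE sVE) _.
  exact: comm_abelem_core nTE core_abelem.
have sDV0 : D \subset V0 by rewrite commg_subl normG.
have nDV0 : V0 \subset 'N(D) by rewrite normsR ?normG.
have nV0t : <[t]> \subset 'N(V0) by apply: commg_normr.
have cop : coprime #|V0| #|<[t]>| by apply: pnat_coprime pV0 p't.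
(* [t] centralizes [V0 :&: T], but has no non-trivial fixed point on the abelian group [V0 / D =
   [V0 / D, t]]. *)
have eD : V0 :&: T = D.
  apply/eqP; rewrite eqEsubset [D \subset _]subsetI sDV0 sDT !andbT.
  have nDt : <[t]> \subset 'N(D) by rewrite normsR.
  have sZ : V0 :&: T \subset V0 := subsetIl _ _.
  rewrite -quotient_sub1 ?(subset_trans sZ) //.
  have <- : 'C_[~: V0 / D, <[t]> / D](<[t]> / D) = 1.
    apply: coprime_abel_cent_TI.
    - exact: quotient_norms.
    - by rewrite coprime_morph.
    by rewrite /abelian quotient_cents2.
  rewrite subsetI; apply/andP; split.
    have <- : V0 / D = [~: V0 / D, <[t]> / D].
      rewrite -quotientR //= coprime_commGid //.
        exact: pnat_coprime pV p't.
      exact: pgroup_sol pV.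
    exact: quotientS.
  apply: quotient_cents; rewrite centsC cycle_subG.
  by apply: (subsetP (centS (subsetIr _ _))).
have sDZ : D \subset 'Z(V0).
  by rewrite subsetI sDV0 -eD (subset_trans (subsetIr _ _)) // centsC.
have iD : #|V0 : D| = (p ^ 2)%N.
  by rewrite -eD indexgI -(indexMg T V0) -(normC nTV0) eV core_module_index.
have leD : #|D| <= p.
  apply: (card_der1_central prp sDZ iD) => x V0x.
  by rewrite -eD inE groupX // xpT // (subsetP sV0V).
have sPV0 : 'Phi(V0) \subset D.
  apply: (Phi_min pV0) => //; apply/(abelemP prp); split.
    by rewrite /abelian quotient_cents2.
  move=> _ /morphimP[x nDx V0x ->]; rewrite -morphX //; apply: coset_id.
  by rewrite -eD inE groupX // xpT // (subsetP sV0V).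
have nDT : T \subset 'N(D).
  by rewrite cents_norm // centsC (subset_trans sDV0).
have sPV : 'Phi(V) \subset 'Phi(T) <*> D.
  have <- : 'Phi(V0 * T) = 'Phi(V) by rewrite eV.
  rewrite (Phi_mulg pV0 pT) 1?centsC // mul_subG ?joing_subl //.
  exact: subset_trans sPV0 (joing_subr _ _).
have sQT : 'Phi(T) <*> D \subset T by rewrite join_subG Phi_sub.
(* The rank bound allows [p^3] for the index of ['Phi(V)] in [V], and [|V : T| = p^2] uses up all
   but one factor [p]. *)
have iQ : #|T : 'Phi(T) <*> D| <= p.
  have h : #|V : 'Phi(T) <*> D| <= p ^ 3.
    apply: leq_trans (rkN (subset_trans sVE sEN)); apply: dvdn_leq => //.
    exact: indexgS.
  move: h; rewrite -(Lagrange_index sTV sQT) core_module_index.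
  by rewrite (expnSr p 2) leq_pmul2l // expn_gt0 prime_gt0.
have cyT : cyclic (T / D).
  apply: Phi_quotient_cyclic.
  have le : #|(T / D) / 'Phi(T / D)| <= p.
    rewrite card_quotient ?(char_norm (Phi_char _)) //= -(quotient_Phi pT nDT).
    rewrite -(quotientYidr (subset_trans (Phi_sub T) nDT)).
    rewrite index_quotient_eq // ?subIset ?joing_subr ?orbT //.
  have pQ : p.-group ((T / D) / 'Phi(T / D)) by rewrite !quotient_pgroup.
  have [->|nt] := eqVneq ((T / D) / 'Phi(T / D)) 1; first exact: cyclic1.
  apply: prime_cyclic; rewrite (_ : #|_| = p) //.
  have [_ /dvdn_leq h _] := pgroup_pdiv pQ nt.
  by apply/eqP; rewrite eqn_leq le h.
have abT : abelian T.
  apply: (@cyclic_factor_abelian _ D) => //.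
  by rewrite subsetI sDT (subset_trans sDV0).
have sTZ : T \subset 'Z(V).
  by rewrite subsetI sTV -eV centM subsetI (abT : T \subset 'C(T)) andbT centsC.
have eDV : [~: V, V] = D.
  have cpV : V0 \* T = V by rewrite cprodE // centsC.
  have := der_cprod 1 cpV; rewrite !derg1 (_ : [~: T, T] = 1) ?cprodg1 //.
  exact/commG1P.
by rewrite eDV; split.
Qed.

(** Here [V = E], so [E] centralizes [T]; the [GB]-invariant subgroup ['C_N(T)] contains [E] and
    hence is [N]. *)
Lemma core_central : #|E : T| = (p ^ 2)%N -> T \subset 'Z(N).
Proof.
have [_ sTZ _ _] := core_module_center.
move=> iET; have eVE : V :=: E.
  have sTV : T \subset V := joing_subr _ _.
  apply/eqP; rewrite eqEcard core_module_sub /=.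
  by rewrite -(Lagrange sTE) iET -(Lagrange sTV) core_module_index.
have sEC : E \subset 'C_N(T).
  by rewrite subsetI sEN centsC -eVE (subset_trans sTZ) ?subsetIr.
have eN : 'C_N(T) = N.
  by apply: (index_p_normB prp index_EN nEB sEC); rewrite ?subsetIl // normsI // norms_cent.
by rewrite subsetI sTN centsC -eN subsetIr.
Qed.

(** On [L] the maps [rho] and [pi] have the same kernel, so [rho] descends. A general [g] is [c f l]
    with [c] centralizing [E], [f] in [E] and [l] in [L], and [f] acts trivially on the abelian
    group [E / T]. *)
Lemma core_natural_module_out :
  exists (psi : gT -> 'rV['F_p]_2) (rho : oT -> 'M['F_p]_2),
  [/\ [/\ {in V &, {morph psi : x y / x * y >-> (x + y)%R}},
          {in V, forall x, (psi x == 0%R) = (x \in T)} &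
          [set psi x | x in V] = [set: 'rV['F_p]_2]],
      {in pi @* L &, {morph rho : a b / a * b >-> (a *m b)%R}},
      {in pi @* L &, injective rho},
      [set rho a | a in pi @* L] = [set A : 'M['F_p]_2 | (\det A == 1)%R] &
      {in GA & V, forall g x, pi g \in pi @* L -> psi (x ^ g) = (psi x *m rho (pi g))%R}].
Proof.
have [psi [rho [psiM psi0 psiV [rhoM rho1 rhoL psiJ]]]] := core_natural_module.
pose rho' o := rho (odflt 1 [pick l in L | pi l == o]).
have rho_eq g h : g \in L -> h \in L -> pi g = pi h -> rho g = rho h.
  move=> Lg Lh e; have Lgh : g * h^-1 \in L by rewrite groupM ?groupV.
  have Ag := subsetP sLA g Lg; have Ah := subsetP sLA h Lh.
  rewrite -{1}(mulgKV h g) rhoM // (_ : rho (g * h^-1) = 1%:M%R) ?mul1mx //.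
  by apply/eqP; rewrite rho1 // morphM ?groupV // morphV // e mulgV.
have rhoE l : l \in L -> rho' (pi l) = rho l.
  move=> Ll; rewrite /rho'; case: pickP => [h /andP[Lh /eqP e]|/(_ l)].
    exact: rho_eq.
  by rewrite Ll eqxx.
exists psi, rho'; split=> //.
- move=> _ _ /morphimP[g Ag Lg ->] /morphimP[h Ah Lh ->].
  by rewrite -morphM // !rhoE ?groupM // rhoM.
- move=> _ _ /morphimP[g Ag Lg ->] /morphimP[h Ah Lh ->]; rewrite !rhoE // => e.
  have rhoV : (rho g *m rho (h^-1)%g)%R = 1%:M%R.
    by rewrite e -rhoM ?groupV // mulgV; apply/eqP; rewrite rho1 ?morph1.
  have := rho1 (g * h^-1) (groupM Lg (groupVr Lh)).
  rewrite rhoM ?groupV // rhoV eqxx morphM ?groupV // morphV // => /esym.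
  by rewrite -eq_mulgV1 => /eqP.
- rewrite -rhoL; apply/setP=> A; apply/imsetP/imsetP.
    by case=> _ /morphimP[l Al Ll ->] ->; exists l; rewrite ?rhoE.
  by case=> l Ll ->; exists (pi l); rewrite ?rhoE // mem_morphim // (subsetP sLA).
move=> g x Ag Vx /morphimP[l Al Ll e].
have : g * l^-1 \in 'ker pi.
  apply/kerP; first by rewrite groupM ?groupV.
  by rewrite morphM ?groupV // morphV // e mulgV.
rewrite kerpi => /mulsgP[c f /setIP[Ac Cc] Ef dg].
rewrite e rhoE //; have -> : g = c * f * l by rewrite -dg mulgKV.
have Ex := subsetP core_module_sub x Vx.
have nVf : f \in 'N(V) by apply: (subsetP core_module_norm); apply: (subsetP sEA).
rewrite !conjgM (_ : x ^ c = x); last first.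
  by apply/conjg_fixP/commgP/commute_sym; apply: (centP Cc).
rewrite psiJ ?memJ_norm // ; congr (_ *m _)%R.
have Txf : [~ x, f] \in T.
  by apply: (subsetP (comm_abelem_core nTE core_abelem)); apply: mem_commg.
have VT := subsetP (joing_subr [~: E, L] T).
have psiT : psi [~ x, f] = 0%R by apply/eqP; rewrite psi0 ?VT.
have -> : x ^ f = x * [~ x, f] by rewrite commgEl mulKVg.
by rewrite psiM ?(VT _ Txf) // psiT GRing.addr0.
Qed.

(** Exponent, commutativity and center are expressed by powers, commutators and indices, which pull
    back along the injective [rmul]. *)
Lemma core_structure :
  [/\ exists (psi : gT -> 'rV['F_p]_2) (rho : oT -> 'M['F_p]_2),
        [/\ [/\ {in V &, {morph psi : x y / x * y >-> (x + y)%R}},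
                {in V, forall x, (psi x == 0%R) = (x \in T)} &
                [set psi x | x in V] = [set: 'rV['F_p]_2]],
            {in pi @* L &, {morph rho : a b / a * b >-> (a *m b)%R}},
            {in pi @* L &, injective rho},
            [set rho a | a in pi @* L] = [set A : 'M['F_p]_2 | (\det A == 1)%R] &
            {in GA & V, forall g x, pi g \in pi @* L ->
               psi (x ^ g) = (psi x *m rho (pi g))%R}],
      {in N, forall x, x ^+ p \in T},
      [~: E, E] \subset T /\ (p ^ 2 <= #|E : T| <= p ^ 3)%N,
      ~~ ([~: E, N] \subset T) /\
        exists D : {group gT}, [/\ T \subset D, D \subset E, #|E : D| = p & [~: D, N] \subset T] &
      [/\ abelian T, T \subset 'Z(V), #|[~: V, V]| <= p & cyclic (T / [~: V, V])]
      /\ (#|E : T| = (p ^ 2)%N -> T \subset 'Z(N))].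
Proof.
split.
- exact: core_natural_module_out.
- by move=> x; apply: core_exponent.
- split; first exact: comm_abelem_core nTE core_abelem.
  by have [k -> lek] := index_core_pnat; have p1 := prime_gt1 prp; rewrite !leq_exp2l.
- split; first exact: comm_EN_nsub_core.
  by have [D [sTD sDE iD cDN _]] := core_hyperplane; exists D.
by split; [apply: core_module_center | apply: core_central].
Qed.

End Amalgam.

(** * Realizing automorphisms by conjugation *)

Section RightRegular.

Variable gT : finGroupType.

Definition rmul (x : gT) : {perm gT} := perm (@mulIg gT x).

Lemma rmulE x y : rmul x y = y * x.
Proof. by rewrite permE. Qed.

Lemma rmulM : {in [set: gT] &, {morph rmul : x y / x * y}}.
Proof. by move=> x y _ _; apply/permP=> z; rewrite permM !rmulE mulgA. Qed.

Canonical rmul_morphism := Morphism rmulM.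

Lemma rmul_inj : injective rmul.
Proof. by move=> x y e; have := congr1 (fun s : {perm gT} => s 1) e; rewrite /= !rmulE !mul1g. Qed.

Lemma injm_rmul : 'injm rmul.
Proof. by apply/injmP=> x y _ _; apply: rmul_inj. Qed.

Lemma rmul_conj x y : rmul x ^ rmul y = rmul (x ^ y).
Proof. by rewrite -(morphJ rmul_morphism) ?inE. Qed.

Lemma mem_rmul (X : {group gT}) x : (rmul x \in rmul @* X) = (x \in X).
Proof. by apply/idP/idP=> [/morphimP[y _ Xy /rmul_inj->]|Xx] //; rewrite mem_morphim ?inE. Qed.

Lemma Aut_mem (K : {group gT}) a k : a \in Aut K -> k \in K -> a k \in K.
Proof.
move=> Ka Kk; rewrite -(autmE Ka).
by have := mem_morphim (autm_morphism Ka) Kk Kk; rewrite im_autm.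
Qed.

Lemma Aut_mul (K : {group gT}) a k l : a \in Aut K -> k \in K -> l \in K ->
  a (k * l) = a k * a l.
Proof. by move=> Ka Kk Kl; rewrite -!(autmE Ka) morphM. Qed.

(* The permutation [g] maps [r k] to [r (a k)], for [r] in a transversal of the
   left cosets of [K] and [k] in [K]. *)
Lemma aut_extension (K : {group gT}) (a : {perm gT}) : a \in Aut K ->
  exists g : {perm gT}, {in K, forall k, rmul k ^ g = rmul (a k)}.
Proof.
move=> Ka; pose r (y : gT) := repr (y *: K).
have ry y : (r y)^-1 * y \in K.
  by rewrite -mem_lcoset -lcoset_sym; apply: mem_repr (lcoset_refl _ _).
pose f y := r y * a ((r y)^-1 * y).
have rE y k : k \in K -> r (y * k) = r y.
  by move=> Kk; rewrite /r lcosetM lcoset_id.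
have rf y : r (f y) = r y.
  rewrite /f; have -> : r (r y * a ((r y)^-1 * y)) = r (r y) by rewrite rE ?Aut_mem.
  by rewrite -{2}(mulKVg (r y) y) rE.
have finj : injective f.
  move=> y z e; have er : r y = r z by rewrite -rf e rf.
  by move: e; rewrite /f er => /mulgI/perm_inj/mulgI.
exists (perm finj) => k Kk; apply: (mulgI (perm finj)).
rewrite conjgE mulKVg; apply/permP=> y; rewrite !permM !permE /= /f rE //.
by rewrite mulgA (Aut_mul Ka) // mulgA.
Qed.

Section Realize.

Variables (K : {group gT}) (A : {group {perm gT}}).
Hypothesis sAK : A \subset Aut K.

Definition realizes (g a : {perm gT}) := [forall k in K, rmul k ^ g == rmul (a k)].

Lemma realizesP g (a : {perm gT}) : reflect {in K, forall k, rmul k ^ g = rmul (a k)} (realizes g a).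
Proof. by apply: (iffP forall_inP) => h k Kk; apply/eqP; apply: h. Qed.

(** All realizing permutations are taken, including those centralizing [rmul @* K]; hence the factor
    ['C_GA(E)] in the kernel of [pi]. *)
Definition realizers := [set g | [exists a in A, realizes g a]].

Lemma realizersP g :
  reflect (exists2 a : {perm gT}, a \in A & {in K, forall k, rmul k ^ g = rmul (a k)}) (g \in realizers).
Proof.
rewrite inE; apply: (iffP exists_inP) => [] [a Aa /realizesP h]; by exists a => //; apply/realizesP.
Qed.

Lemma realizers_group_set : group_set realizers.
Proof.
apply/group_setP; split.
  by apply/realizersP; exists 1 => // k _; rewrite conjg1 perm1.
move=> g h /realizersP[a Aa ga] /realizersP[b Ab hb]; apply/realizersP.
exists (a * b); first exact: groupM.
by move=> k Kk; rewrite conjgM ga // hb ?permM // (Aut_mem (subsetP sAK a Aa)).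
Qed.

Canonical realizers_group := Group realizers_group_set.

Definition realized (g : {perm gT}) := odflt 1 [pick a in A | realizes g a].

Lemma realizedP g : g \in realizers ->
  realized g \in A /\ {in K, forall k, rmul k ^ g = rmul (realized g k)}.
Proof.
move=> /realizersP[a Aa ga]; rewrite /realized; case: pickP => [b /andP[Ab /realizesP]//|/(_ a)].
by rewrite Aa (introT (realizesP _ _) ga).
Qed.

Lemma realized_unique g (a : {perm gT}) : a \in A -> {in K, forall k, rmul k ^ g = rmul (a k)} ->
  realized g = a.
Proof.
move=> Aa ga; have Gg : g \in realizers by apply/realizersP; exists a.
have [Ab gb] := realizedP Gg.
apply: (@eq_Aut _ K); rewrite ?(subsetP sAK) // => k Kk.
by apply: rmul_inj; rewrite -ga // -gb.
Qed.

Lemma realizedM : {in realizers &, {morph realized : g h / g * h}}.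
Proof.
move=> g h Gg Gh; have [Aa ga] := realizedP Gg; have [Ab hb] := realizedP Gh.
apply: realized_unique; first exact: groupM.
by move=> k Kk; rewrite conjgM ga // hb ?permM // (Aut_mem (subsetP sAK _ Aa)).
Qed.

Canonical realized_morphism := Morphism realizedM.

Lemma im_realized : realized @* realizers = A.
Proof.
apply/setP=> a; apply/idP/idP=> [/morphimP[g _ Gg ->]|Aa]; first by case: (realizedP Gg).
have [g ga] := aut_extension (subsetP sAK a Aa).
have Gg : g \in realizers by apply/realizersP; exists a.
by rewrite -(realized_unique Aa ga); apply: (mem_morphim realized_morphism).
Qed.

Lemma realizers_norm : realizers \subset 'N(rmul @* K).
Proof.
apply: norms_conj => g Gg; have [Aa ga] := realizedP Gg.
apply: (@conjsg_eq_of_sub _ (rmul @* K)%G); apply/subsetP=> _ /imsetP[_ /morphimP[k _ Kk ->] ->].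
by rewrite ga // mem_rmul (Aut_mem (subsetP sAK _ Aa)).
Qed.

Lemma realizers_norm_sub (X : {group gT}) : X \subset K ->
  (realizers \subset 'N(rmul @* X)) = aut_inv A X.
Proof.
move=> sXK; apply/idP/forall_inP => [nX a Aa | hX].
  have [g ga] := aut_extension (subsetP sAK a Aa).
  have Gg : g \in realizers by apply/realizersP; exists a.
  apply/subsetP=> _ /imsetP[x Xx ->].
  rewrite -mem_rmul -ga ?(subsetP sXK) // memJ_norm ?mem_rmul //.
  exact: (subsetP nX).
apply: norms_conj => g Gg; have [Aa ga] := realizedP Gg.
apply: (@conjsg_eq_of_sub _ (rmul @* X)%G); apply/subsetP=> _ /imsetP[_ /morphimP[x _ Xx ->] ->].
rewrite ga ?(subsetP sXK) // mem_rmul; apply: (subsetP (hX _ Aa)).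
exact: imset_f.
Qed.

End Realize.
End RightRegular.

Arguments rmul {gT}.

(** * Fusion systems *)

Section FusionSystems.

Variables (gT : finGroupType) (S : {group gT}) (F : {set gT} -> {ffun gT -> gT} -> bool).
Hypothesis fusF : fusion_system S F.

Let F_eq (P : {set gT}) (f g : {ffun gT -> gT}) : {in P, f =1 g} -> F P f = F P g.
Proof. by case: fusF => _ h _ _ _; apply: h. Qed.

Let F_conj (P : {group gT}) x : P \subset S -> x \in S -> F P [ffun y => y ^ x].
Proof. by case: fusF => _ _ h _ _; apply: h. Qed.

(** The set generating [AutF] is already a group: the identity is conjugation by 1, and F is closed
    under composition. *)
Lemma AutF_group_set (P : {group gT}) : P \subset S ->
  group_set [set a in Aut P | F P [ffun x => (a : {perm gT}) x]].
Proof.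
move=> sPS; apply/group_setP; split.
  apply/setIdP; split; first exact: group1.
  rewrite -(F_eq (f := [ffun y => y ^ 1])) ?F_conj //.
  by move=> y _; rewrite !ffunE conjg1 perm1.
move=> a b /setIdP[Pa Fa] /setIdP[Pb Fb]; apply/setIdP; split; first exact: groupM.
have [_ _ _ Fcomp _] := fusF.
have sab : [ffun x => a x] @: P \subset P.
  by apply/subsetP=> _ /imsetP[x Px ->]; rewrite ffunE (Aut_mem Pa).
rewrite -(F_eq (f := [ffun y => [ffun x => b x] ([ffun x => a x] y)])) ?(Fcomp P P) //.
by move=> x _; rewrite !ffunE permM.
Qed.

Lemma mem_AutF (P : {group gT}) a : P \subset S ->
  (a \in AutF F P) = (a \in Aut P) && F P [ffun x => (a : {perm gT}) x].
Proof. by move=> sPS; rewrite /AutF gen_set_id ?AutF_group_set // in_set. Qed.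

Lemma AutF_sub (P : {group gT}) : P \subset S -> AutF F P \subset Aut P.
Proof. by move=> sPS; apply/subsetP=> a; rewrite mem_AutF // => /andP[]. Qed.

Lemma AutS_conj (P : {group gT}) : AutS S P = conj_aut P @* 'N_S(P).
Proof.
have sNP : 'N_S(P) \subset 'N(P) := subsetIr _ _.
rewrite -[RHS]genGid; congr <<_>>; apply/setP=> a.
apply/setIdP/morphimP => [[Pa /exists_inP[x Nx /forall_inP h]]|[x nPx Nx ->]].
  have nPx := subsetP sNP x Nx; exists x => //.
  apply: (@eq_Aut _ P) => //.
    by apply: (subsetP (Aut_conj_aut P 'N(P))); apply: mem_morphim.
  by move=> y Py; rewrite norm_conj_autE //; apply/eqP/h.
split; first by apply: (subsetP (Aut_conj_aut P 'N(P))); apply: mem_morphim.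
by apply/exists_inP; exists x => //; apply/forall_inP=> y Py; rewrite norm_conj_autE.
Qed.

Lemma conj_aut_AutF (P : {group gT}) x : P \subset S -> x \in 'N_S(P) ->
  conj_aut P x \in AutF F P.
Proof.
move=> sPS /setIP[Sx nPx]; rewrite mem_AutF //; apply/andP; split.
  by apply: (subsetP (Aut_conj_aut P 'N(P))); apply: mem_morphim.
rewrite -(F_eq (f := [ffun y => y ^ x])) ?F_conj //.
by move=> y Py; rewrite !ffunE norm_conj_autE.
Qed.

Lemma mem_Fclass_refl (P : {group gT}) : P \subset S -> gval P \in Fclass F P.
Proof.
move=> sPS; rewrite inE; apply/existsP; exists [ffun y => y ^ 1]; rewrite F_conj //=.
apply/eqP/setP=> y; apply/imsetP/idP=> [[x Px ->]|Py]; first by rewrite ffunE conjg1.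
by exists y; rewrite ?ffunE ?conjg1.
Qed.

End FusionSystems.

Lemma index_Phi_gen_by (gT : finGroupType) (p k : nat) (H : {group gT}) :
  prime p -> p.-group H -> gen_by_le H k -> #|H : 'Phi(H)| <= p ^ k.
Proof.
move=> prp pH [s [ss eH]]; have nPH : H \subset 'N('Phi(H)) := char_norm (Phi_char H).
have abH := Phi_quotient_abelem pH.
rewrite -card_quotient //; have [m em] := p_natP (abelem_pgroup abH).
rewrite em leq_exp2l ?prime_gt1 // -(pfactorK m prp) -em -(rank_abelem abH).
rewrite -(grank_abelian (abelem_abelian abH)).
have sSH : [set x in s] \subset H by rewrite -eH subset_gen.
have e : H / 'Phi(H) = <<[set x in s] / 'Phi(H)>>.
  by rewrite -quotient_gen ?eH // (subset_trans sSH).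
rewrite /= e; apply: leq_trans (grank_min _) _; apply: leq_trans ss.
apply: leq_trans (card_size s); rewrite -(cardsE (mem s)).
exact: leq_quotient.
Qed.

(** By Sylow's theorem every p-element lies in a conjugate of [P]. *)
Lemma Opp'_class_support (gT : finGroupType) (p : nat) (G P : {group gT}) :
  p.-Sylow(G) P -> Opp' p G = <<class_support P G>>.
Proof.
move=> sylP; have [sPG pP _] := and3P sylP.
apply/eqP; rewrite eqEsubset !gen_subG; apply/andP; split; apply/subsetP=> x.
  rewrite inE => /andP[Gx px].
  have sxG : <[x]> \subset G by rewrite cycle_subG.
  have [g Gg sxP] := Sylow_subJ sylP sxG px.
  apply: mem_gen; rewrite class_supportEr; apply/bigcupP; exists g => //.
  by rewrite -cycle_subG.
move=> PGx; apply: mem_gen; rewrite inE (subsetP (class_support_subG sPG)) //=.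
move: PGx; rewrite class_supportEr => /bigcupP[g Gg Pgx].
by apply: mem_p_elt Pgx; rewrite pgroupJ.
Qed.

Lemma morphim_class_support (aT rT : finGroupType) (D A : {group aT}) (f : {morphism D >-> rT}) :
  A \subset D -> f @* <<class_support A D>> = <<class_support (f @* A) (f @* D)>>.
Proof.
move=> sAD; rewrite morphim_gen ?class_support_subG //; congr <<_>>.
rewrite !class_supportEr; apply/setP=> y; apply/morphimP/bigcupP.
  move=> [x Dx /bigcupP[g Dg Agx] ->]; exists (f g); first exact: mem_morphim.
  by rewrite -morphimJ // mem_morphim.
move=> [_ /morphimP[g Dg _ ->]]; rewrite -morphimJ // => /morphimP[x Dx Agx ->].
by exists x => //; apply/bigcupP; exists g.
Qed.

Canonical AutF_group (gT : finGroupType) F (P : {set gT}) := Eval hnf in [group of AutF F P].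
Canonical AutS_group (gT : finGroupType) (S P : {set gT}) := Eval hnf in [group of AutS S P].
Canonical Inn_group (gT : finGroupType) (P : {set gT}) := Eval hnf in [group of Inn P].
Canonical coreF_group (gT : finGroupType) (S : {set gT}) F E := Eval hnf in [group of coreF S F E].

(** * The map from realizing permutations to outer automorphisms *)

Section OuterMorphism.

Variables (gT : finGroupType) (K : {group gT}) (A I : {group {perm gT}}).
Hypotheses (sAK : A \subset Aut K) (nIA : A \subset 'N(I)).

Definition realized_coset (g : {perm gT}) := coset I (realized K A g).

Lemma realized_cosetM : {in realizers K A &, {morph realized_coset : g h / g * h}}.
Proof.
move=> g h Gg Gh; rewrite /realized_coset realizedM // morphM //.
  by apply: (subsetP nIA); case: (realizedP Gg).
by apply: (subsetP nIA); case: (realizedP Gh).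
Qed.

Definition realized_coset_morphism : {morphism realizers_group sAK >-> coset_of I} :=
  Morphism realized_cosetM.

Local Notation pi := realized_coset_morphism.

Lemma im_realized_coset (X : {set {perm gT}}) : X \subset realizers K A ->
  pi @* X = (realized_morphism sAK @* X) / I.
Proof.
move=> sX; apply/setP=> o; apply/morphimP/morphimP => [[g _ Xg ->]|[a nIa /morphimP[g Gg Xg ->] ->]].
  have Gg := subsetP sX g Xg.
  exists (realized K A g) => //; last exact: (mem_morphim (realized_morphism sAK)).
  by apply: (subsetP nIA); case: (realizedP Gg).
by exists g.
Qed.

(** If [g] induces an element of [I], it agrees on [rmul @* K] with some [h] in [rmul @* J], and
    [g h^-1] centralizes [rmul @* K]. *)
Lemma ker_realized_coset (J : {group gT}) : J \subset K ->
  rmul @* J \subset realizers K A -> realized_morphism sAK @* (rmul @* J) = I ->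
  'ker pi = 'C_(realizers K A)(rmul @* K) * rmul @* J.
Proof.
move=> sJK sJG eI; apply/setP=> g; apply/idP/mulsgP.
  move=> kg; have Gg : g \in realizers K A := dom_ker kg.
  have [Aa ga] := realizedP Gg.
  have Ia : realized K A g \in I.
    apply: coset_idr; first exact: (subsetP nIA).
    exact: (mker kg).
  move: Ia; rewrite -eI => /morphimP[h Gh Jh e].
  have [_ hb] := realizedP Gh.
  exists (g * h^-1) h => //; last by rewrite mulgKV.
  rewrite inE; apply/andP; split; first exact: (groupM (G := realizers_group sAK) Gg (groupVr Gh)).
  apply/centP=> _ /morphimP[k _ Kk ->]; apply/commute_sym/commgP/conjg_fixP.
  rewrite conjgM ga //; apply: (conjg_inj h); rewrite conjgKV hb //.
  by rewrite -[realized K A h]e.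
case=> c h /setIP[Gc Cc] Jh ->; have Gh := subsetP sJG h Jh.
apply/kerP; first exact: (groupM (G := realizers_group sAK) Gc Gh).
rewrite morphM // (_ : pi c = 1) ?mul1g; last first.
  rewrite /= /realized_coset (@realized_unique _ _ _ sAK c 1) ?morph1 // => k Kk.
  rewrite perm1; apply/conjg_fixP/commgP/commute_sym; apply: (centP Cc).
  by rewrite mem_rmul.
rewrite /= /realized_coset; apply: coset_id; rewrite -eI.
exact: (mem_morphim (realized_morphism sAK)).
Qed.

End OuterMorphism.

(** Applied to the subgroups generating the core, this makes the core itself invariant. *)
Lemma aut_inv_gen (gT : finGroupType) (K : {group gT}) (A : {set {perm gT}})
    (P : pred {group gT}) :
  A \subset Aut K -> (forall X, P X -> X \subset K /\ aut_inv A X) ->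
  aut_inv A <<\bigcup_(X : {group gT} | P X) X>>.
Proof.
move=> sAK h; apply/forall_inP=> a Aa; set U := <<_>>.
have Ka := subsetP sAK a Aa.
have sU : U \subset autm Ka @*^-1 <<\bigcup_(X : {group gT} | P X) X>>.
  rewrite gen_subG; apply/bigcupsP=> X PX; apply/subsetP=> x Xx.
  have [sXK /forall_inP/(_ a Aa) aX] := h X PX.
  rewrite mem_morphpre ?(subsetP sXK) //=.
  apply: mem_gen; apply/bigcupP; exists X => //.
  rewrite autmE; apply: (subsetP aX); exact: imset_f.
apply/subsetP=> _ /imsetP[x Ux ->].
by have /morphpreP[_] := subsetP sU x Ux; rewrite /= autmE.
Qed.

Lemma conj_aut_conjg (gT : finGroupType) (E : {group gT}) (a : {perm gT}) x :
  a \in Aut E -> x \in E -> conj_aut E x ^ a = conj_aut E (a x).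
Proof.
move=> Ea Ex; have nEE := normG E.
have nEy y : y \in E -> y \in 'N(E) by apply: (subsetP nEE).
have Eax := Aut_mem Ea Ex.
have Ac y : y \in E -> conj_aut E y \in Aut E.
  by move=> Ey; apply: (subsetP (Aut_conj_aut E E)); apply: mem_morphim; rewrite ?nEy.
apply: (@eq_Aut _ E); rewrite ?groupJ ?Ac // => y Ey.
have Ey' : a^-1 y \in E by apply: Aut_mem; rewrite ?groupV.
rewrite conjgE !permM !norm_conj_autE ?nEy //.
by rewrite -!(autmE Ea) morphJ //= !autmE permKV.
Qed.

Lemma injm_cyclic_quotient (aT rT : finGroupType) (D X Y : {group aT}) (f : {morphism D >-> rT}) :
  'injm f -> X \subset D -> Y <| X -> cyclic (f @* X / f @* Y) = cyclic (X / Y).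
Proof.
move=> injf sXD nsYX; pose g := [morphism of restrm sXD f].
have injg : 'injm g by apply: injm_restrm.
have := injm_cyclic (injm_quotm nsYX injg) (subxx (X / Y)).
by rewrite morphim_quotm !morphim_restrm setIid (setIidPr (normal_sub nsYX)).
Qed.

Canonical Vsub_group (gT : finGroupType) p (S : {set gT}) F E :=
  Eval hnf in [group of Vsub p S F E].

Theorem theorem3p3 (gT : finGroupType) (p : nat) (S E : {group gT})
    (F : {set gT} -> {ffun gT -> gT} -> bool) :
  prime p -> odd p -> p.-group S ->
  fusion_system S F -> saturated F p S ->
  essential p S F E -> ~ F_characteristic S F E ->
  sectional_rank 'N_S(E) 3 ->
  let T := coreF S F E in
  let V := Vsub p S F E in
  [/\ natural_SL2_module p S F E,
      exponent ('N_S(E) / T) = p,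
      p.-abelem (E / T) /\ (p ^ 2 <= #|E : T| <= p ^ 3)%N,
      #|E / T : 'Z('N_S(E) / T)| = p &
      [/\ abelian T, T \subset 'Z(V), #|[~: V, V]| <= p & cyclic (T / [~: V, V])]]
  /\ (#|E : T| = (p ^ 2)%N -> T \subset 'Z('N_S(E))).
Proof.
move=> prp oddp pS fusF [sat1 _] [sES essE [H seH]] nchar [rk _] T V.
pose N := 'N_S(E)%G.
have sNS : N \subset S := subsetIl _ _.
have pN : p.-group N := pgroupS sNS pS.
have nsEN : E <| N := normalSG sES.
have sEN : E \subset N := normal_sub nsEN.
have nEN : N \subset 'N(E) := normal_norm nsEN.
have Ecl := mem_Fclass_refl fusF sES.
have [cSE _] := essE _ Ecl.
(* An essential subgroup is fully normalized, so saturation applies to [E]. *)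
have [_ sylE] : fully_centralized F S E /\ p.-Sylow(AutF F E) (AutS S E).
  by apply: sat1 => // Q /essE[].
pose A := AutF_group F E; pose B := AutF_group F N; pose I := Inn_group E.
have sA : A \subset Aut E := AutF_sub fusF sES.
have sB : B \subset Aut N := AutF_sub fusF sNS.
have eI : I = conj_aut E @* E :> {set _}.
  by rewrite /I /= /Inn AutS_conj (setIidPl (normG E)).
have nIA : A \subset 'N(I).
  apply: norms_conj => a Aa; apply: conjsg_eq_of_sub; rewrite eI.
  apply/subsetP=> _ /imsetP[_ /morphimP[x nx Ex ->] ->].
  rewrite conj_aut_conjg ?(subsetP sA) // mem_morphim //.
    by rewrite (subsetP (normG E)) // (Aut_mem (subsetP sA a Aa)).
  by rewrite (Aut_mem (subsetP sA a Aa)).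
pose GA := realizers_group sA; pose GB := realizers_group sB.
pose pi : {morphism GA >-> coset_of I} := realized_coset_morphism sA nIA.
pose Nr := (rmul @* N)%G; pose Er := (rmul @* E)%G.
pose T0 := coreF_group S F E; pose Tr := (rmul @* T0)%G.
have realN x : x \in N -> (rmul x \in GA) /\ realized E A (rmul x) = conj_aut E x.
  move=> Nx; have Ax : conj_aut E x \in A by apply: (conj_aut_AutF fusF sES).
  have h : {in E, forall k, rmul k ^ rmul x = rmul (conj_aut E x k)}.
    by move=> k Ek; rewrite rmul_conj norm_conj_autE // (subsetP nEN).
  split; first by apply/realizersP; exists (conj_aut E x).
  exact: realized_unique h.
have sNA : Nr \subset GA.
  by apply/subsetP=> _ /morphimP[x _ Nx ->]; case: (realN x Nx).
have imreal (X : {group gT}) : X \subset N ->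
    realized_morphism sA @* (rmul @* X) = conj_aut E @* X.
  move=> sXN; apply/setP=> a; apply/morphimP/morphimP.
    move=> [_ _ /morphimP[x _ Xx ->] ->]; have Nx := subsetP sXN x Xx.
    by exists x; rewrite ?(subsetP nEN) //=; case: (realN x Nx).
  move=> [x nx Xx ->]; have [Gx ex] := realN x (subsetP sXN x Xx).
  by exists (rmul x); rewrite ?mem_rmul.
have imN : realized_morphism sA @* Nr = AutS S E by rewrite imreal // AutS_conj.
have imE : realized_morphism sA @* Er = I by rewrite imreal // eI.
have sEA : Er \subset GA by apply: subset_trans sNA; rewrite morphimS.
have piGA : pi @* GA = OutF F E.
  by rewrite im_realized_coset // im_realized.
have piN : pi @* Nr = AutS S E / I by rewrite im_realized_coset // imN.
have kerpi : 'ker pi = 'C_GA(Er) * Er := ker_realized_coset nIA (subxx E) sEA imE.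
have sylN : p.-Sylow(pi @* GA) (pi @* Nr).
  by rewrite piGA piN; apply: quotient_pHall (sylE); exact: subset_trans (pHall_sub sylE) nIA.
have seO : strongly_p_embedded p (pi @* GA) H by rewrite piGA.
have nEA : GA \subset 'N(Er) := realizers_norm sA.
have nNB : GB \subset 'N(Nr) := realizers_norm sB.
have injr := @injm_rmul gT.
have subr (X Y : {group gT}) : (rmul @* X \subset rmul @* Y) = (X \subset Y).
  by rewrite injmSK ?subsetT.
have indr (X Y : {group gT}) : #|rmul @* X : rmul @* Y| = #|X : Y|.
  by rewrite index_injm ?subsetT.
have lift (X : {group {perm gT}}) : X \subset Nr -> exists2 X' : {group gT},
    X' \subset N & X = (rmul @* X')%G.
  move=> sXN; exists (rmul @*^-1 X)%G; last first.
    by apply/val_inj; rewrite /= morphpreK // (subset_trans sXN) ?morphimS ?subsetT.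
  by rewrite -subr /= morphpreK // (subset_trans sXN) ?morphimS ?subsetT.
have rkN (X : {group {perm gT}}) : X \subset Nr -> #|X : 'Phi(X)| <= p ^ 3.
  move=> /lift[X' sXN ->]; rewrite -injm_Phi ?subsetT // indr.
  by apply: index_Phi_gen_by => //; [apply: pgroupS pN | apply: rk].
have cNE : 'C_Nr(Er) \subset Er.
  rewrite -injm_subcent ?subsetT // subr (subset_trans _ cSE) // setSI //.
have nsENr : Er <| Nr by rewrite morphim_normal.
(* If Aut_F(N) preserved [E], then ['N_S(N)], acting through it, would normalize [E] and lie in [N].
   Normalizers grow in p-groups, so [S = N] and [E] would be F-characteristic. *)
have nEB : ~~ (GB \subset 'N(Er)).
  rewrite realizers_norm_sub //; apply/negP => /forall_inP invE.
  case: nchar => a Sa.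
  have sNN : 'N_S(N) \subset N.
    apply/subsetP=> x Nx; have Bx := conj_aut_AutF fusF sNS Nx.
    case/setIP: Nx => Sx nNx; rewrite inE Sx inE.
    apply/subsetP=> _ /imsetP[y Ey ->].
    have Ny := subsetP sEN y Ey.
    rewrite -(norm_conj_autE nNx Ny); apply: (subsetP (invE _ Bx)).
    exact: imset_f.
  have eS : S = N by apply/val_inj/(nilpotent_sub_norm (pgroup_nil pS) sNS).
  have Ba : a \in AutF F N by rewrite -eS.
  apply/eqP; by rewrite eqEcard (invE _ Ba) card_imset ?leqnn //; apply: perm_inj.
have core_in (X : {group gT}) : X \subset E -> aut_inv A X -> aut_inv B X -> X \subset T0.
  move=> sXE iA iB; apply: subset_trans (subset_gen _).
  by apply: (bigcup_sup X) => //; rewrite sXE iA.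
have sTE : T0 \subset E by rewrite gen_subG; apply/bigcupsP=> X /and3P[].
have iTA : aut_inv A T0.
  by apply: (aut_inv_gen sA) => X /and3P[].
have iTB : aut_inv B T0.
  apply: (aut_inv_gen sB) => X /and3P[sXE _ iB]; split=> //.
  exact: subset_trans sEN.
have sTN := subset_trans sTE sEN.
have sTEr : Tr \subset Er by rewrite subr.
have nTA : GA \subset 'N(Tr) by rewrite realizers_norm_sub.
have nTB : GB \subset 'N(Tr) by rewrite realizers_norm_sub.
have maxT (X : {group {perm gT}}) :
    X \subset Er -> GA \subset 'N(X) -> GB \subset 'N(X) -> X \subset Tr.
  move=> sXE; have [X' sX'N eX] := lift X (subset_trans sXE (morphimS _ sEN)).
  have sX'E : X' \subset E by rewrite -subr; move: sXE; rewrite eX.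
  rewrite eX subr /= !realizers_norm_sub //; exact: core_in.
have core := core_structure prp oddp (morphim_pgroup _ pN) nsENr sNA nEA nNB rkN cNE kerpi
  sylN seO nEB sTEr nTA nTB maxT.
pose L := normal_closure Nr GA; pose Vg := Vsub_group p S F E.
have sLA : L \subset GA := normal_closure_sub sNA.
have eL : pi @* L = Opp' p (OutF F E).
  by rewrite -piGA morphim_class_support // (Opp'_class_support sylN).
have eO : realized_morphism sA @* L = Opp' p (AutF F E).
  rewrite (Opp'_class_support (P := AutS_group S E) (G := A)) //.
  by rewrite (morphim_class_support (realized_morphism sA) sNA) imN im_realized.
(* For [l] inducing [a] on [E], the commutator of [rmul x] and [l] is [rmul (x^-1 * a x)], so the
   two generating sets correspond. *)
have eR : rmul @* commAut E (Opp' p (AutF F E)) = [~: Er, L].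
  rewrite morphim_gen ?subsetT //; congr <<_>>; apply/setP=> z; apply/morphimP/imset2P.
    move=> [_ _ /imset2P[x a Ex Oa ->] ->]; move: Oa; rewrite -eO => /morphimP[g Gg Lg ea].
    exists (rmul x) g => //; first by rewrite mem_rmul.
    have [_ h] := realizedP Gg.
    rewrite commgEl h // ea /= morphM ?inE // morphV ?inE //.
  move=> [_ l /morphimP[x _ Ex ->] Ll ->].
  have Gl := subsetP sLA l Ll; have [_ h] := realizedP Gl.
  exists (x^-1 * realized E A l x); rewrite ?inE //.
    apply/imset2P; exists x (realized E A l) => //.
    by rewrite -eO; apply: (mem_morphim (realized_morphism sA)).
  by rewrite commgEl h // morphM ?inE // morphV ?inE.
have eV : (rmul @* Vg)%G = core_module Nr Er GA Tr.
  by apply/val_inj; rewrite /= morphimY ?subsetT //= eR.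
have memV x : x \in V -> rmul x \in core_module Nr Er GA Tr.
  by move=> Vx; rewrite -eV /= mem_morphim ?inE.
have eVV : rmul @* [~: V, V] = [~: core_module Nr Er GA Tr, core_module Nr Er GA Tr].
  by rewrite morphimR ?subsetT // -eV.
have commsub (X Y Z : {group gT}) :
    ([~: rmul @* X, rmul @* Y] \subset rmul @* Z) = ([~: X, Y] \subset Z).
  by rewrite -morphimR ?subsetT // injmSK ?subsetT.
have nTN : N \subset 'N(T0).
  by rewrite -commg_subl -commsub commg_subl (subset_trans sNA).
have sVEr : core_module Nr Er GA Tr \subset Er.
  by rewrite join_subG sTEr commg_subl (subset_trans sLA) ?nEA.
have sVE : Vg \subset E by rewrite -subr; move: sVEr; rewrite -eV.
case: core => [[psi [rho [[psiM psi0 psiV] rhoM rhoI rhoO psiJ]]] expT [abE iET]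
  [ncEN [D [sTD sDE iD cDN]]] [[abT sTZ cV cyc] cen]].
have nTE := subset_trans sEN nTN.
have expT' x : x \in N -> x ^+ p \in T0.
  by move=> Nx; rewrite -mem_rmul morphX ?inE // expT // mem_rmul.
have ncEN' : ~~ ([~: E, N] \subset T0) by rewrite -commsub.
have abET : p.-abelem (E / T).
  apply/(abelemP prp); split; first by rewrite /abelian quotient_cents2 // -commsub.
  move=> _ /morphimP[x nTx Ex ->]; rewrite -morphX //; apply: coset_id.
  by apply: expT'; apply: (subsetP sEN).
split; last first.
  move=> iE; have : Tr \subset 'Z(Nr) by apply: cen; rewrite indr.
  by rewrite -injm_center ?subsetT // injmSK ?subsetT.
split.
- exists (fun x => psi (rmul x)), rho; rewrite -eL; split=> //.
    split.
    + by move=> x y Vx Vy; rewrite morphM ?inE // psiM ?memV.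
    + by move=> x Vx; rewrite psi0 ?memV // mem_rmul.
    rewrite -psiV; apply/setP=> z; apply/imsetP/imsetP.
      by move=> [x Vx ->]; exists (rmul x); rewrite ?memV.
    by rewrite -eV; move=> [_ /morphimP[x _ Vx ->] ->]; exists x.
  move=> a Aa Oa x Vx.
  have : a \in realized_morphism sA @* realizers E A by rewrite im_realized.
  case/morphimP=> g Gg _ ea.
  have Ex : x \in E := subsetP sVE x Vx.
  have [_ h] := realizedP Gg.
  have epi : pi g = coset (Inn E) a by rewrite ea.
  rewrite -epi -psiJ ?memV // ?epi //; congr (psi _).
  by rewrite h // ea.
- apply/eqP; have : exponent (N / T) %| p.
    apply/exponentP=> _ /morphimP[x nTx Nx ->]; rewrite -morphX //.
    by apply: coset_id; apply: expT'.
  case/primeP: prp => _ h /h /orP[/eqP e1|//].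
  case/negP: ncEN'.
  have : N / T0 == 1 by rewrite trivg_exponent e1.
  rewrite -subG1 quotient_sub1 // => sNT.
  by apply: subset_trans sNT; rewrite commg_subr (subset_trans sEN) ?normG.
- by split=> //; rewrite -indr.
- have [D' sD'N eD] := lift D (subset_trans sDE (morphimS _ sEN)).
  rewrite eD in sTD sDE iD cDN.
  rewrite subr in sTD; rewrite subr in sDE; rewrite indr in iD; rewrite commsub in cDN.
  (* The intersection of the center with [E / T] lies between [D' / T], of index [p], and [E / T];
     it is proper because [N] does not centralize [E / T]. *)
  rewrite -indexgI.
  have iDT : #|E / T0 : D' / T0| = p.
    by rewrite index_quotient_eq // subIset // sTD orbT.
  have nTD := subset_trans sD'N nTN.
  have sDZ : D' / T0 \subset (E / T0) :&: 'Z(N / T0).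
    by rewrite subsetI quotientS //= subsetI quotientS // quotient_cents2.
  have priD : prime #|E / T0 : D' / T0| by rewrite iDT.
  have [e|e] := prime_index_sandwich sDZ (subsetIl _ _) priD.
    by rewrite -[RHS]iDT -e.
  case/negP: ncEN'; rewrite -quotient_cents2 //.
  move: (subsetIr (E / T0) 'Z(N / T0)); rewrite e => h.
  exact: subset_trans h (subsetIr _ _).
have sDT : [~: Vg, Vg] \subset T0.
  by apply: subset_trans (commgSS sVE sVE) _; rewrite -commsub.
have sTV : T0 \subset Vg := joing_subr _ _.
split.
- by rewrite -(injm_abelian injr) ?subsetT.
- rewrite -[V]/(gval Vg) -(injmSK injr) ?subsetT //= (injm_center injr) ?subsetT //.
  by move: sTZ; rewrite -eV.
- by rewrite -(card_injm injr) ?subsetT // eVV.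
rewrite -(injm_cyclic_quotient injr (Y := [~: Vg, Vg]%G)) ?subsetT //=.
  by rewrite eVV.
by rewrite /normal sDT normsR // (subset_trans sTV) ?normG.
Qed.
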